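(* Let $G$ be a simply connected Lie group with a left invariant complex structure $J$, let $\Gamma\subset G$ be a uniform lattice, and equip $\Gamma\backslash G$ with the induced complex structure $J$. If the canonical bundle of $(\Gamma\backslash G,J)$ is trivial (or, more generally, holomorphically torsion) then $\operatorname{Tr}(J\operatorname{ad}([x,y]))=0$ for all $x,y\in\mathfrak{g}=\operatorname{Lie}(G)$, that is, $\psi([\mathfrak{g},\mathfrak{g}])=0$, where $\psi$ is the Koszul $1$-form of $(\mathfrak{g},J)$.
   Context: The Koszul $1$-form $\psi\in\mathfrak{g}^*$ is $\psi(x)=\operatorname{Tr}(J\operatorname{ad}x)-\operatorname{Tr}\operatorname{ad}(Jx)$, where $J$ also denotes the induced endomorphism of $\mathfrak{g}$. A uniform lattice is a discrete subgroup $\Gamma$ with $\Gamma\backslash G$ compact. The canonical bundle $K_M$ of a complex manifold $M$ of complex dimension $n$ is the $n$-th exterior power of its holomorphic cotangent bundle; it is trivial if it is holomorphically trivial (there is a nowhere vanishing holomorphic $(n,0)$-form), and holomorphically torsion if $K_M^{\otimes k}$ is holomorphically trivial for some $k\ge1$. *)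

(* Defs.v *)
From HB Require Import structures.
From mathcomp Require Import all_boot all_order all_algebra.
From mathcomp Require Import all_classical all_reals all_analysis.
From mathcomp Require Import complex.

Set Implicit Arguments.
Unset Strict Implicit.
Unset Printing Implicit Defensive.

Import Order.TTheory GRing.Theory Num.Theory.
Import numFieldNormedType.Exports.

Local Open Scope classical_set_scope.
Local Open Scope quotient_scope.
Local Open Scope ring_scope.

(** [Ck_on] and its variants are only used on open sets [U], where ['d f u]
    is the usual differential. *)

Fixpoint Ck_on (R : realType) (E F : normedModType R) (k : nat) (U : set E)
    (f : E -> F) : Prop :=
  match k with
  | 0 => forall u, U u -> {for u, continuous f}
  | k'.+1 => (forall u, U u -> differentiable f u) /\
             forall v, Ck_on k' U (fun u => 'd f u v)
  end.

Definition smooth_on (R : realType) (E F : normedModType R) (U : set E)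
  (f : E -> F) : Prop := forall k, Ck_on k U f.

(** The complex vector space [W + iW] is represented by the real one [W * W];
    [mulI] is multiplication by [i]. *)
Definition mulI (W : zmodType) (z : W * W) : W * W := (- z.2, z.1).

(** Smooth with complex linear differential (Cauchy-Riemann). *)
Definition holomorphic_on (R : realType) (E F : normedModType R)
    (U : set (E * E)) (f : E * E -> F * F) : Prop :=
  smooth_on U f /\
  forall u, U u -> forall v, 'd f u (mulI v) = mulI ('d f u v).

Notation Cvec R n := ('rV[R]_n * 'rV[R]_n)%type.

Definition toC (R : realType) (z : R * R) : R[i] := Complex z.1 z.2.

(** Determinant over C of the (complex linear) differential of [f] at [u]. *)
Definition complex_jacobian (R : realType) (n : nat) (f : Cvec R n -> Cvec R n)
    (u : Cvec R n) : R[i] :=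
  \det (\matrix_(j < n, k < n)
          toC (('d f u (delta_mx 0 j, 0)).1 0 k,
               ('d f u (delta_mx 0 j, 0)).2 0 k)).

(** The maps of a chart are total; only their values on
    [cdom] and [cimg] are meaningful. *)

Record chart (E M : Type) := Chart {
  cdom : set M;
  cimg : set E;
  cmap : M -> E;
  cinv : E -> M
}.

Definition is_chart (E M : topologicalType) (c : chart E M) : Prop :=
  [/\ open (cdom c) /\ open (cimg c),
      {homo cmap c : p / cdom c p >-> cimg c p},
      {homo cinv c : u / cimg c u >-> cdom c u},
      (forall p, cdom c p -> cinv c (cmap c p) = p) /\
      (forall u, cimg c u -> cmap c (cinv c u) = u)
    & (forall p, cdom c p -> {for p, continuous (cmap c)}) /\
      (forall u, cimg c u -> {for u, continuous (cinv c)})].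

Definition local_dom E M E' M' (c : chart E M) (c' : chart E' M')
  (f : M -> M') : set E := [set u | cimg c u /\ cdom c' (f (cinv c u))].

Definition local_expr E M E' M' (c : chart E M) (c' : chart E' M')
  (f : M -> M') : E -> E' := fun u => cmap c' (f (cinv c u)).

Definition prod_atlas E M E' M' I I' (A : I -> chart E M)
    (A' : I' -> chart E' M') (ij : I * I') : chart (E * E') (M * M') :=
  let c := A ij.1 in let c' := A' ij.2 in
  Chart (cdom c `*` cdom c') (cimg c `*` cimg c')
        (fun p => (cmap c p.1, cmap c' p.2))
        (fun u => (cinv c u.1, cinv c' u.2)).

Definition smooth_map (R : realType) (E E' : normedModType R)
    (M M' : topologicalType) (I I' : Type) (A : I -> chart E M)
    (A' : I' -> chart E' M') (f : M -> M') : Prop :=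
  continuous f /\
  forall i j, smooth_on (local_dom (A i) (A' j) f) (local_expr (A i) (A' j) f).

Definition holomorphic_map (R : realType) (n n' : nat)
    (M M' : topologicalType) (I I' : Type) (A : I -> chart (Cvec R n) M)
    (A' : I' -> chart (Cvec R n') M') (f : M -> M') : Prop :=
  continuous f /\ forall i j,
    holomorphic_on (local_dom (A i) (A' j) f) (local_expr (A i) (A' j) f).

Definition complex_manifold (R : realType) (n : nat) (M : topologicalType)
    (I : Type) (A : I -> chart (Cvec R n) M) : Prop :=
  [/\ hausdorff_space M /\ @second_countable M,
      forall i, is_chart (A i),
      forall p, exists i, cdom (A i) p
    & holomorphic_map A A id].

Section Tensors.
Context {R : realType} {n : nat} {M : Type} {I : Type}.
Variable A : I -> chart (Cvec R n) M.

(** [f_* X = X] *)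
Definition preserved_by (f : M -> M) (X : I -> Cvec R n -> Cvec R n) : Prop :=
  forall i j u, local_dom (A i) (A j) f u ->
    X j (local_expr (A i) (A j) f u)
    = 'd (local_expr (A i) (A j) f) u (X i u).

(** Components are set to 0 outside the images of the charts, so that equality
    of vector fields is Leibniz equality. *)
Definition vector_field (X : I -> Cvec R n -> Cvec R n) : Prop :=
  [/\ forall i, smooth_on (cimg (A i)) (X i),
      forall i u, ~ cimg (A i) u -> X i u = 0
    & preserved_by id X].

Definition bracket (X Y : I -> Cvec R n -> Cvec R n) :
    I -> Cvec R n -> Cvec R n :=
  fun i u => if u \in cimg (A i)
             then 'd (Y i) u (X i u) - 'd (X i) u (Y i u) else 0.

(** Multiplication by [i] commutes with the differentials of holomorphic
    transition maps, so it acts componentwise. *)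
Definition vfJ (X : I -> Cvec R n -> Cvec R n) : I -> Cvec R n -> Cvec R n :=
  fun i u => mulI (X i u).

(** Holomorphic sections of [K_M^{(x) k}].  In the chart [i], with coordinate
    [z], the section is [h i * (dz_1 /\ ... /\ dz_n)^k]; the transition functions of [K_M] are
    the complex Jacobian determinants. *)
Definition canonical_section (k : nat) (h : I -> Cvec R n -> R * R) : Prop :=
  (forall i, @holomorphic_on R 'rV[R]_n R^o (cimg (A i)) (h i)) /\
  forall i j u, local_dom (A i) (A j) id u ->
    toC (h i u) = complex_jacobian (local_expr (A i) (A j) id) u ^+ k
                  * toC (h j (local_expr (A i) (A j) id u)).

Definition canonical_power_trivial (k : nat) : Prop :=
  exists h, canonical_section k h /\
            forall i u, cimg (A i) u -> toC (h i u) != 0.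

Definition canonical_trivial : Prop := canonical_power_trivial 1.

Definition canonical_torsion : Prop :=
  exists2 k, (1 <= k)%N & canonical_power_trivial k.

End Tensors.

(** Trace of [T] on the subspace [W], with value 0 if [W] has no finite basis *)

Section Trace.
Context {R : comNzRingType} {V : lmodType R}.

Definition basis_of_set (W : set V) (d : nat) (e : 'I_d -> V) : Prop :=
  (forall i, W (e i)) /\
  forall w, W w -> exists! c : 'rV[R]_d, w = \sum_i c 0 i *: e i.

Definition matrix_in_basis (T : V -> V) (d : nat) (e : 'I_d -> V)
  (A : 'M[R]_d) : Prop := forall j, T (e j) = \sum_i A i j *: e i.

Definition is_trace (W : set V) (T : V -> V) (t : R) : Prop :=
  exists (d : nat) (e : 'I_d -> V) (A : 'M[R]_d),
    [/\ basis_of_set W e, matrix_in_basis T e A & t = \tr A].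

Definition trace_on (W : set V) (T : V -> V) : R := xget 0 (is_trace W T).

Lemma basis_of_set_coord (W : set V) (d d' : nat) (e : 'I_d -> V)
    (e' : 'I_d' -> V) : basis_of_set W e -> (forall j, W (e' j)) ->
  exists P : 'M[R]_(d, d'), forall j, e' j = \sum_i P i j *: e i.
Proof.
move=> [_ be] We'.
have ex j : exists c : 'rV[R]_d, e' j = \sum_i c 0 i *: e i.
  by have [c [? _]] := be _ (We' j); exists c.
have [f fE] := choice ex.
exists (\matrix_(i, j) f j 0 i) => j; rewrite fE.
by apply: eq_bigr => i _; rewrite mxE.
Qed.

Lemma basis_of_set_free (W : set V) (d : nat) (e : 'I_d -> V)
    (a b : 'I_d -> R) : basis_of_set W e -> W (\sum_i a i *: e i) ->
  \sum_i a i *: e i = \sum_i b i *: e i -> a =1 b.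
Proof.
move=> [_ be] Wa ab i; have [c [_ cu]] := be _ Wa.
have ca : c = \row_j a j.
  by apply: cu; apply: eq_bigr => j _; rewrite mxE.
have cb : c = \row_j b j.
  by apply: cu; rewrite ab; apply: eq_bigr => j _; rewrite mxE.
by move: (congr1 (fun r : 'rV_d => r 0 i) ca); rewrite cb !mxE.
Qed.

Lemma change_of_basis (d d' : nat) (a : 'I_d -> R) (e : 'I_d -> V)
    (e' : 'I_d' -> V) (P : 'M[R]_(d', d)) :
  (forall j, e j = \sum_i P i j *: e' i) ->
  \sum_j a j *: e j = \sum_i (\sum_j P i j * a j) *: e' i.
Proof.
move=> eP; under eq_bigr => j _ do rewrite eP scaler_sumr.
rewrite exchange_big /=; apply: eq_bigr => i _.
by rewrite scaler_suml; apply: eq_bigr => j _; rewrite scalerA mulrC.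
Qed.

Lemma change_of_basisK (W : set V) (d d' : nat) (e : 'I_d -> V)
    (e' : 'I_d' -> V) (P : 'M[R]_(d, d')) (Q : 'M[R]_(d', d)) :
  basis_of_set W e ->
  (forall j, e' j = \sum_i P i j *: e i) ->
  (forall j, e j = \sum_i Q i j *: e' i) -> P *m Q = 1%:M.
Proof.
move=> be eP eQ; apply/matrixP => i j; move: i.
have ej : e j = \sum_i (1%:M : 'M[R]_d) i j *: e i.
  rewrite (bigD1 j)//= mxE eqxx scale1r big1 ?addr0// => k kj.
  by rewrite mxE (negbTE kj) scale0r.
move=> i; rewrite mxE; apply/esym; move: i.
apply: (@basis_of_set_free W d e _ (fun i => \sum_k P i k * Q k j)) => //.
  by rewrite -ej; apply: be.1.
by rewrite -ej -(change_of_basis _ eP) -eQ.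
Qed.

(** Hence [trace_on] may be computed in any basis *)
Lemma is_trace_unique (W : set V) (T : V -> V) (s t : R) :
  (forall w, W w -> W (T w)) ->
  (forall d (e : 'I_d -> V) (c : 'I_d -> R), (forall i, W (e i)) ->
     T (\sum_i c i *: e i) = \sum_i c i *: T (e i)) ->
  is_trace W T s -> is_trace W T t -> s = t.
Proof.
move=> WT linT [d [e [A [be TA ->]]]] [d' [e' [B [be' TB ->]]]].
have [P eP] := basis_of_set_coord be be'.1.
have [Q eQ] := basis_of_set_coord be' be.1.
have PQ := change_of_basisK be eP eQ.
have QP := change_of_basisK be' eQ eP.
have QA : Q *m A = B *m Q.
  apply/matrixP => i j; rewrite !mxE; move: i.
  apply: (basis_of_set_free be').
    by rewrite -(change_of_basis _ eQ) -TA; apply: WT; apply: be.1.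
  rewrite -(change_of_basis _ eQ) -TA -(change_of_basis _ TB) {1}eQ.
  by rewrite linT//; apply: be'.1.
have -> : A = P *m (B *m Q) by rewrite -QA mulmxA PQ mul1mx.
by rewrite mxtrace_mulC -mulmxA QP mulmx1.
Qed.

End Trace.

#[short(type="topGroupType")]
HB.structure Definition TopologicalGroupType := {G of Group G & Topological G}.

(** A complex atlas [A] also carries the smooth structure of the real Lie group:
    the group operations are only required to be smooth in the real sense. *)
Definition lie_group (R : realType) (n : nat) (G : topGroupType) (I : Type)
    (A : I -> chart (Cvec R n) G) : Prop :=
  smooth_map (prod_atlas A A) A (fun p : G * G => p.1 * p.2)%g /\
  smooth_map A A (fun p : G => p^-1)%g.

Definition left_invariant (R : realType) (n : nat) (G : topGroupType)
    (I : Type) (A : I -> chart (Cvec R n) G) : Prop :=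
  forall g : G, holomorphic_map A A (fun p => g * p)%g.

Definition Lie (R : realType) (n : nat) (G : topGroupType) (I : Type)
    (A : I -> chart (Cvec R n) G) : set (I -> Cvec R n -> Cvec R n) :=
  [set X | vector_field A X /\
           forall g : G, preserved_by A (fun p => g * p)%g X].

Definition derived_Lie (R : realType) (n : nat) (G : topGroupType) (I : Type)
    (A : I -> chart (Cvec R n) G) : set (I -> Cvec R n -> Cvec R n) :=
  [set Z | exists (m : nat) (X Y : 'I_m -> I -> Cvec R n -> Cvec R n),
     [/\ forall l, Lie A (X l), forall l, Lie A (Y l)
       & Z = \sum_l bracket A (X l) (Y l)]].

Definition koszul_form (R : realType) (n : nat) (G : topGroupType) (I : Type)
    (A : I -> chart (Cvec R n) G) (X : I -> Cvec R n -> Cvec R n) : R :=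
  trace_on (Lie A) (fun Z => vfJ (bracket A X Z))
  - trace_on (Lie A) (bracket A (vfJ X)).

Definition simply_connected (R : realType) (M : topologicalType) : Prop :=
  (forall p q : M, exists f : R -> M,
     [/\ {within `[0, 1], continuous f}, f 0 = p & f 1 = q]) /\
  (forall f : R -> M, {within `[0, 1], continuous f} -> f 0 = f 1 ->
     exists H : R * R -> M,
       [/\ {within `[0, 1]%classic `*` `[0, 1]%classic, continuous H},
           forall t, 0 <= t <= 1 -> H (0, t) = f t,
           forall t, 0 <= t <= 1 -> H (1, t) = f 0
         & forall s, 0 <= s <= 1 -> H (s, 0) = f 0 /\ H (s, 1) = f 0]).

Section Quotient.
Context {G : topGroupType}.
Variable Gamma : groupClosed G.

(** [Gamma p = Gamma q] *)
Definition same_coset (p q : G) : bool := (p * q^-1)%g \in Gamma.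

Lemma same_coset_equiv : equiv_class_of same_coset.
Proof.
split=> [p|p q|q p r]; rewrite /same_coset.
- by rewrite mulgV gpred1.
- by rewrite -gpredV invgM invgK.
- move=> pq qr; rewrite -[p](mulgVK q) -mulgA; exact: gpredM.
Qed.

Definition coset_equiv : equiv_rel G := EquivRelPack same_coset_equiv.

Definition coset_space : topologicalType :=
  quotient_topology {eq_quot coset_equiv}.

Definition coset_proj (p : G) : coset_space := \pi_({eq_quot coset_equiv}) p.

Definition uniform_lattice : Prop :=
  isolated [set` Gamma] = [set` Gamma] /\ compact [set: coset_space].

(** The induced atlas: for every chart of [G], all its restrictions to open
    sets [O] on which the projection is injective, composed with the inverse
    of that projection. *)

Definition local_lift (O : set G) (q : coset_space) : G :=
  xget 1%g [set p | O p /\ coset_proj p = q].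

Definition quotient_atlas (R : realType) (n : nat) (I : Type)
    (A : I -> chart (Cvec R n) G)
    (iO : {iO : I * set G | [/\ open iO.2, iO.2 `<=` cdom (A iO.1)
                              & set_inj iO.2 coset_proj]}) :
    chart (Cvec R n) coset_space :=
  let c := A (sval iO).1 in let O := (sval iO).2 in
  Chart (coset_proj @` O) (cmap c @` O) (cmap c \o local_lift O) 
        (coset_proj \o cinv c).

End Quotient.

Arguments quotient_atlas {G} Gamma {R n I} A iO.

(* Main.v *)
From HB Require Import structures.
Require Import Defs.
From mathcomp Require Import fingroup perm.
From mathcomp Require Import all_boot all_order all_algebra.
From mathcomp Require Import all_classical all_reals all_analysis.
From mathcomp Require Import complex ring lra.

Set Implicit Arguments.
Unset Strict Implicit.
Unset Printing Implicit Defensive.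

Import Order.TTheory GRing.Theory Num.Theory.
Import numFieldNormedType.Exports.

Local Open Scope classical_set_scope.
Local Open Scope ring_scope.

(** For a left invariant field [X], let [T X] be the complex linear endomorphism
    [ad X + J ad (J X)] and [tau X] its complex trace; [Im (tau X)] is a multiple
    of the Koszul form of [X].  Read in the left invariant trivialization, a
    nowhere vanishing section of [K^k] over the quotient is a function [f] with
    [(X + i J X) f = k (tau X) f].  As the quotient is compact, [|f|] attains its
    maximum and its minimum.  At such a point [k Im (tau [X, Y])] is expressed
    by the Hessian [H] of [|f|] as [H (Y, J X) - H (X, J Y)]: this form is of
    type (1,1), and its values on the pairs [(X, J X)] are nonpositive at the
    maximum and nonnegative at the minimum, so it is zero.

    This gives [Tr (J ad Z) = Tr (ad (J Z))] for [Z] in the derived algebra, and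
    the right hand side vanishes because [G] is unimodular.  Unimodularity is
    obtained without Haar measure: if [|det (Ad a)| < 1], coverings of the
    quotient by small balls, refined along the powers of [a], would have too few
    elements. *)

(** The function [f] is not holomorphic, so no maximum principle makes it constant, and each
    extremum yields only an inequality. The way out is that [k Im (tau [X, Y])] depends on the Lie
    algebra alone: the bounds found at the maximum and at the minimum, two unrelated points, concern
    one and the same form. The equation for [f] comes from [f = h * vol ^ k], with [h] the local
    coefficient of the section and [vol] the determinant of the invariant frame read in the chart.
    The operator [X + i J X] kills the holomorphic [h], and the logarithmic derivative of a
    determinant is a trace. The map [T X] is complex linear because [J] is integrable, and [Tr (J T
    X) = 2 Re (i tau X) = - 2 Im (tau X)]. In the unimodular part the delicate point is a constant:
    covering the linear image of a cube by small cells must cost [|det|] up to a factor, here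
    [25 ^ N], that does not depend on the linear map. Passing from [a] to a power of [a] then beats
    this factor. *)

(** * Differentials as a relation *)

Section Differentials.
Context {R : realType}.
Implicit Types V W : normedModType R.

(** Identities between chart expressions hold only near a point; the differential depends on the
    germ alone. *)
Lemma is_diff_near V W (f g : V -> W) x df :
  {near x, f =1 g} -> is_diff x f df -> is_diff x g df.
Proof.
move=> fg dfx.
have fx : f x = g x by apply: (nbhs_singleton fg).
have dfc : continuous ('d f x) by apply: diff_continuous.
have gE : g \o shift x = cst (g x) + 'd f x +o_ 0 id.
  have /diff_locally/eqaddoP fo : differentiable f x by [].
  apply/eqaddoP => e e0; near=> h.
  have fgh : f (h + x) = g (h + x).
    by near: h; move: fg; rewrite (near_shift 0) subr0.
  have -> : (g \o shift x - (cst (g x) + 'd f x)) h =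
            (f \o shift x - (cst (f x) + 'd f x)) h by rewrite !fctE fgh fx.
  by near: h; exact: (fo e e0).
have dg : 'd g x = 'd f x :> (V -> W) by apply: diff_unique.
apply: DiffDef; last by rewrite dg diff_val.
by apply/diff_locallyP; rewrite dg.
Unshelve. all: by end_near. Qed.

Lemma is_diff_uniq V W (f : V -> W) x df df' :
  is_diff x f df -> is_diff x f df' -> df =1 df'.
Proof. by move=> [_ <-] [_ <-]. Qed.

Lemma is_diff_ext V W (f : V -> W) x (df df' : V -> W) :
  is_diff x f df -> df =1 df' -> is_diff x f df'.
Proof. by move=> d /funext <-. Qed.

Lemma is_diff_lin V W (f : {linear V -> W}) x : continuous f -> is_diff x f f.
Proof.
by move=> fc; apply: DiffDef; [exact: linear_differentiable|exact: diff_lin].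
Qed.

Lemma is_diff_fD V W (f g df dg : V -> W) x : is_diff x f df ->
  is_diff x g dg -> is_diff x (fun v => f v + g v) (fun v => df v + dg v).
Proof. exact: is_diffD. Qed.

Lemma is_diff_fN V W (f df : V -> W) x :
  is_diff x f df -> is_diff x (fun v => - f v) (fun v => - df v).
Proof. exact: is_diffN. Qed.

Lemma is_diff_fZ V W (f df : V -> W) c x :
  is_diff x f df -> is_diff x (fun v => c *: f v) (fun v => c *: df v).
Proof. exact: is_diffZ. Qed.

Lemma is_diff_fM V (f g df dg : V -> R) x : is_diff x f df ->
  is_diff x g dg ->
  is_diff x (fun v => f v * g v) (fun v => f x * dg v + g x * df v).
Proof. exact: is_diffM. Qed.

Lemma is_diff_cM V (f df : V -> R) c x :
  is_diff x f df -> is_diff x (fun v => c * f v) (fun v => c * df v).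
Proof. exact: is_diffZ. Qed.

Lemma is_diff_addc V (c : V) x : is_diff x (+%R^~ c) id.
Proof.
have : is_diff x (id + cst c) (id + 0) by apply: is_diffD.
by rewrite addr0.
Qed.

End Differentials.

(** * Stability of smoothness on open sets *)

Section SmoothOn.
Context {R : realType}.
Implicit Types E F : normedModType R.

Lemma Ck_on_ext E F k (U : set E) (f g : E -> F) : open U ->
  {in U, f =1 g} -> Ck_on k U f -> Ck_on k U g.
Proof.
move=> oU.
have nearU (u : E) (f' g' : E -> F) : U u -> {in U, f' =1 g'} -> {near u, f' =1 g'}.
  move=> Uu fg; near=> v; apply: fg; rewrite inE.
  by near: v; exact: open_nbhs_nbhs.
elim: k f g => [|k IHk] f g fg /=.
  move=> fc u Uu.
  have fgu := nearU _ _ _ Uu fg.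
  have fgE := nbhs_singleton fgu.
  change (g x @[x --> u] --> g u); rewrite -fgE.
  by apply: cvg_trans (fc u Uu); apply: near_eq_cvg.
move=> [fd dfC]; split=> [u Uu|v].
  have dfu : is_diff u f ('d f u) by apply: differentiableP; exact: fd.
  by have [] := is_diff_near (nearU _ _ _ Uu fg) dfu.
apply: IHk (dfC v) => u /[1!inE] Uu.
have dfu : is_diff u f ('d f u) by apply: differentiableP; exact: fd.
by have [_ ->] := is_diff_near (nearU _ _ _ Uu fg) dfu.
Unshelve. all: by end_near. Qed.

Lemma Ck_on_sub E F k (U U' : set E) (f : E -> F) :
  U' `<=` U -> Ck_on k U f -> Ck_on k U' f.
Proof.
move=> UU'; elim: k f => [|k IHk] f /=; first by move=> fU u /UU'; exact: fU.
by move=> [fd dfC]; split=> [u /UU'|v]; [exact: fd|exact: IHk].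
Qed.

Lemma Ck_onS E F k (U : set E) (f : E -> F) : Ck_on k.+1 U f -> Ck_on k U f.
Proof.
elim: k f => [|k IHk] f /= [fd dfC].
  by move=> u Uu; apply: differentiable_continuous; exact: fd.
by split=> // v; exact/IHk/dfC.
Qed.

Lemma Ck_on_linear E F F' k (U : set E) (f : E -> F) (L : {linear F -> F'}) :
  open U -> continuous L -> Ck_on k U f -> Ck_on k U (L \o f).
Proof.
move=> oU Lc; elim: k f => [|k IHk] f /=.
  by move=> fU u Uu; apply: continuous_comp; [exact: fU|exact: Lc].
move=> [fd dfC].
have dLf u : U u -> is_diff u (L \o f) (L \o 'd f u).
  move=> Uu; apply: is_diff_comp; first exact/differentiableP/fd.
  exact: is_diff_lin.
split=> [u /dLf []//|v].
apply: (Ck_on_ext oU) (IHk _ (dfC v)) => u /[1!inE] /dLf[_ ->] //.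
Qed.

(** Meant for the slices [u -> (u, e0)] of the product of the group. For an affine inner map the
    differential along [v] is the outer one along the fixed vector [L v], so the induction on [k]
    closes without a product rule. *)
Lemma Ck_on_affine E E' F k (U : set E) (f : E -> F) (L : {linear E' -> E})
    (c : E) : open U -> continuous L -> Ck_on k U f ->
  Ck_on k [set u | U (L u + c)] (f \o (fun u => L u + c)).
Proof.
move=> oU Lc; have ac : continuous (fun u => L u + c).
  by move=> u; apply: cvgD; [exact: Lc|exact: cvg_cst].
have oU' : open [set u | U (L u + c)].
  exact: (open_comp (D := U) (f := fun u => L u + c)).
have da u : is_diff u (fun u => L u + c) L.
  have -> : (fun u => L u + c) = (+%R^~ c) \o L by [].
  have -> : (L : E' -> E) = id \o L by [].
  by apply: is_diff_comp; [exact: is_diff_lin|exact: is_diff_addc].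
elim: k f => [|k IHk] f /=.
  by move=> fU u Uu; apply: continuous_comp; [exact: ac|exact: fU].
move=> [fd dfC].
have dfa u : U (L u + c) ->
    is_diff u (f \o (fun u => L u + c)) ('d f (L u + c) \o L).
  by move=> Uu; apply: is_diff_comp; exact/differentiableP/fd.
split=> [u /dfa[]//|v].
apply: (Ck_on_ext oU') (IHk _ (dfC (L v))) => u /[1!inE] /dfa[_ ->] //.
Qed.

Lemma Ck_on_cst E F k (U : set E) (c : F) : open U -> Ck_on k U (cst c).
Proof.
move=> oU; elim: k c => [|k IHk] c /=; first by move=> u _; exact: cvg_cst.
split=> [u _ //|v].
by apply: Ck_on_ext oU _ (IHk 0) => u _; rewrite diff_cst.
Qed.

Lemma Ck_onD E F k (U : set E) (f g : E -> F) : open U ->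
  Ck_on k U f -> Ck_on k U g -> Ck_on k U (f \+ g).
Proof.
move=> oU; elim: k f g => [|k IHk] f g /=.
  by move=> fU gU u Uu; apply: cvgD; [exact: fU|exact: gU].
move=> [fd dfC] [gd dgC].
have dfg u : U u -> is_diff u (f \+ g) ('d f u \+ 'd g u).
  by move=> Uu; apply: is_diffD; apply: differentiableP; [exact: fd|exact: gd].
split=> [u /dfg[]//|v].
apply: Ck_on_ext oU _ (IHk _ _ (dfC v) (dgC v)) => u /[1!inE] /dfg[_ ->] //.
Qed.

Lemma Ck_onM E k (U : set E) (f g : E -> R^o) : open U ->
  Ck_on k U f -> Ck_on k U g -> Ck_on k U (f \* g : E -> R^o).
Proof.
move=> oU; elim: k f g => [|k IHk] f g /=.
  by move=> fU gU u Uu; apply: cvgM; [exact: fU|exact: gU].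
move=> fC gC; have [fd dfC] := fC; have [gd dgC] := gC.
have dfg u : U u ->
    is_diff u (f \* g : E -> R^o) (f u *: ('d g u : E -> R) + g u *: ('d f u : E -> R)).
  by move=> Uu; apply: is_diffM; apply: differentiableP; [exact: fd|exact: gd].
split=> [u /dfg[]//|v].
(* The Leibniz rule brings back [f] and [g] themselves, which [Ck_onS] provides at the lower
   order. *)
have /= := Ck_onD oU (IHk _ _ (Ck_onS fC) (dgC v)) (IHk _ _ (Ck_onS gC) (dfC v)).
by apply: Ck_on_ext oU _ => u /[1!inE] /dfg[_ ->].
Qed.

Section smooth_on_theory.
Variables (E F F' : normedModType R) (U : set E).
Hypothesis oU : open U.

Lemma smooth_on_ext (f g : E -> F) :
  {in U, f =1 g} -> smooth_on U f -> smooth_on U g.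
Proof. by move=> fg fs k; exact: Ck_on_ext fg (fs k). Qed.

Lemma smooth_on_sub (U' : set E) (f : E -> F) :
  U' `<=` U -> smooth_on U f -> smooth_on U' f.
Proof. by move=> UU' fs k; exact: Ck_on_sub UU' (fs k). Qed.

Lemma smooth_on_differentiable (f : E -> F) u :
  smooth_on U f -> U u -> differentiable f u.
Proof. by move=> /(_ 1)[fd _]; exact: fd. Qed.

Lemma smooth_on_diff (f : E -> F) v :
  smooth_on U f -> smooth_on U (fun u => 'd f u v).
Proof. by move=> fs k; have [_] := fs k.+1; apply. Qed.

Lemma smooth_on_linear (f : E -> F) (L : {linear F -> F'}) :
  continuous L -> smooth_on U f -> smooth_on U (L \o f).
Proof. by move=> Lc fs k; exact: Ck_on_linear. Qed.

Lemma smooth_on_cst (c : F) : smooth_on U (cst c).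
Proof. by move=> k; exact: Ck_on_cst. Qed.

Lemma smooth_onD (f g : E -> F) :
  smooth_on U f -> smooth_on U g -> smooth_on U (f \+ g).
Proof. by move=> fs gs k; exact: Ck_onD. Qed.

Lemma smooth_onM (f g : E -> R^o) :
  smooth_on U f -> smooth_on U g -> smooth_on U (f \* g : E -> R^o).
Proof. by move=> fs gs k; exact: Ck_onM. Qed.

End smooth_on_theory.
End SmoothOn.

(* ['d f u] unfolds to a choice operator, which makes failing comparisons of
   differentials very slow; [dif] is an opaque copy of it. *)
HB.lock Definition dif (R : realType) (V W : normedModType R) (f : V -> W)
  (u : V) : {linear V -> W} := 'd f u.

Section Dif.
Context {R : realType} {V W : normedModType R}.
Implicit Types f : V -> W.

Lemma difE f u : dif f u = 'd f u. Proof. by rewrite dif.unlock. Qed.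

Lemma is_diff_dif f u : differentiable f u -> is_diff u f (dif f u).
Proof. by rewrite difE => /differentiableP. Qed.

Lemma is_diffP f u df : is_diff u f df -> differentiable f u.
Proof. by case. Qed.

Lemma dif_val f u df : is_diff u f df -> forall v, dif f u v = df v.
Proof. by rewrite difE => -[_ ->]. Qed.

Lemma smooth_on_dif (U : set V) f v :
  smooth_on U f -> smooth_on U (fun u => dif f u v).
Proof.
have -> : (fun u => dif f u v) = (fun u => 'd f u v).
  by apply/funext => u; rewrite difE.
exact: smooth_on_diff.
Qed.

End Dif.

Lemma is_diff_derive (R : realType) (V W : normedModType R) (f : V -> W) u v df :
  is_diff u f df -> is_derive u v f (df v).
Proof.
move=> [fd <-]; apply: DeriveDef; first exact: diff_derivable.
by rewrite deriveE.
Qed.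

(** * Second order conditions for real functions *)

Section SecondOrder.
Context {R : realType} {V : normedModType R}.
Implicit Types (W : normedModType R) (f : V -> R).

Lemma differentiable_eps W (f : V -> W) u e : differentiable f u -> 0 < e ->
  exists2 d, 0 < d & forall h, `|h| < d ->
    `|f (u + h) - f u - dif f u h| <= e * `|h|.
Proof.
rewrite difE; move=> /diff_locally/eqaddoP fo /fo/nbhs_ballP[d /= d0 dP].
exists d => // h hd; have := dP h; rewrite /= -ball_normE /= sub0r normrN => /(_ hd).
by rewrite !fctE [h + u]addrC opprD addrA.
Qed.

Lemma is_diff_line (u v : V) (s : R) :
  is_diff s (fun s => s *: v + u) ( *:%R^~ v).
Proof.
have -> : (fun s => s *: v + u) = (fun s : R => s *: v) + cst u by [].
by rewrite -[X in is_diff _ _ X]addr0; apply: is_diffD.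
Qed.

Lemma MVT_line f u v (t : R) : 0 < t ->
  (forall s, 0 <= s <= t -> differentiable f (s *: v + u)) ->
  exists2 s, 0 < s < t & f (t *: v + u) - f u = t * dif f (s *: v + u) v.
Proof.
move=> t0 fd.
have gd s : 0 <= s <= t ->
    is_derive s 1 (fun s => f (s *: v + u)) (dif f (s *: v + u) v).
  move=> /fd fds.
  have -> : dif f (s *: v + u) v = (dif f (s *: v + u) \o *:%R^~ v) 1.
    by rewrite /= scale1r.
  have := is_diff_line u v s => d1.
  have d2 := is_diff_dif fds.
  have d12 : is_diff s (f \o (fun s => s *: v + u))
      (dif f (s *: v + u) \o *:%R^~ v) by exact: is_diff_comp.
  exact: (is_diff_derive (1 : R) d12).
have [s| |s] := @MVT _ (fun s => f (s *: v + u))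
                        (fun s => dif f (s *: v + u) v) 0 t t0.
- by rewrite in_itv /= => /andP[s0 st]; apply: gd; rewrite !ltW.
- apply: derivable_within_continuous => s; rewrite in_itv /= => st.
  by have [] := gd s st.
- rewrite in_itv /= => st E; exists s => //.
  by move: E; rewrite scale0r add0r subr0 mulrC.
Qed.

Lemma bounded_diff_lipschitz f (c : V) (r C : R) :
  (forall u, ball c r u -> differentiable f u) ->
  (forall u w, ball c r u -> `|dif f u w| <= C * `|w|) ->
  forall u v, ball c r u -> ball c r v -> `|f v - f u| <= C * `|v - u|.
Proof.
move=> fd fC u v cu cv.
have seg s : 0 <= s <= 1 -> ball c r (s *: (v - u) + u).
  move=> /andP[s0 s1]; move: cu cv; rewrite -!ball_normE /= => cu cv.
  have -> : c - (s *: (v - u) + u) = s *: (c - v) + (1 - s) *: (c - u).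
    rewrite scalerBl scale1r addrCA -scalerBr.
    have -> : c - v - (c - u) = - (v - u).
      by rewrite !opprB addrC addrA subrK.
    by rewrite scalerN opprD addrA addrAC.
  rewrite (le_lt_trans (ler_normD _ _))// !normrZ !ger0_norm ?subr_ge0//.
  (* The strict inequality comes from the term with factor [s], so [s = 0] is separate. *)
  have [->|sn0] := eqVneq s 0; first by rewrite mul0r add0r subr0 mul1r.
  have sp : 0 < s by rewrite lt_neqAle eq_sym sn0.
  have -> : r = s * r + (1 - s) * r by rewrite -mulrDl addrC subrK mul1r.
  apply: ltr_leD; first by rewrite ltr_pM2l.
  by rewrite ler_wpM2l ?subr_ge0// ltW.
have [s|s st E] := @MVT_line f u (v - u) 1 ltr01; first by move/seg/fd.
move: E; rewrite scale1r subrK mul1r => ->; apply: fC; apply: seg.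
by case/andP: st => ? ?; rewrite !ltW.
Qed.

Variables (f : V -> R) (u0 : V).
Hypothesis fd : \forall u \near u0, differentiable f u.
Hypothesis fdd : forall v, differentiable (fun u => dif f u v) u0.

Local Notation D2 v w := (dif (fun u => dif f u v) u0 w).

(** The mean value theorem in the direction [v] is applied to the increment [f (u + t w) - f u]. The
    two values of [dif f _ v] that it produces are expanded to first order at [u0], and their terms
    in [s v] cancel. *)
Lemma second_difference v w e : 0 < e ->
  exists2 d, 0 < d & forall t, 0 < t < d ->
    `|f (t *: v + (t *: w + u0)) - f (t *: v + u0) - f (t *: w + u0) + f u0
      - t * (t * D2 v w)| <= e * (t * t).
Proof.
move=> e0.
pose M := `|v| + `|w| + 1.
have M0 : 0 < M by rewrite ltr_wpDl// addr_ge0.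
have vM : `|v| <= M by rewrite /M -addrA lerDl addr_ge0.
have [d1 d10 fd1] : exists2 d, 0 < d & forall h, `|h| < d -> differentiable f (h + u0).
  move/nbhs_ballP: fd => [d /= d0 dP]; exists d => // h hd; apply: dP.
  by rewrite -ball_normE /= opprD addrCA subrr addr0 normrN.
(* Two errors of size at most [e / (2 M) * (t M)] add up to [e t]. *)
have e'0 : 0 < e / (M + M) by rewrite divr_gt0// addr_gt0.
have [d2 d20 fd2] := differentiable_eps (fdd v) e'0.
have dM0 : 0 < Num.min d1 d2 / M by rewrite divr_gt0// lt_min d10.
exists (Num.min d1 d2 / M) => // t /andP[t0].
rewrite ltr_pdivlMr// lt_min => /andP[td1 td2].
have norm1 s : 0 <= s <= t -> `|s *: v| <= t * M.
  move=> /andP[s0 st]; rewrite normrZ ger0_norm//.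
  by rewrite ler_pM// /M -addrA lerDl addr_ge0.
have norm2 s : 0 <= s <= t -> `|s *: v + t *: w| <= t * M.
  move=> /andP[s0 st]; rewrite (le_trans (ler_normD _ _))// !normrZ.
  rewrite (ger0_norm s0) (gtr0_norm t0).
  by have := ler_wpM2r (normr_ge0 v) st; move: t0; rewrite /M; lra.
pose F u := f (u + t *: w) - f u.
have Fdiff s : 0 <= s <= t ->
    is_diff (s *: v + u0) F
      (dif f (s *: v + t *: w + u0) \- dif f (s *: v + u0)).
  move=> st; have f1 : differentiable f (s *: v + u0).
    by apply: fd1; apply: le_lt_trans td1; exact: norm1.
  have f2 : differentiable f (s *: v + t *: w + u0).
    by apply: fd1; apply: le_lt_trans td1; exact: norm2.
  apply: is_diffB; last exact: is_diff_dif.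
  have -> : (fun u => f (u + t *: w)) = f \o (+%R^~ (t *: w)) by [].
  rewrite -[X in is_diff _ _ X]/(dif f (s *: v + t *: w + u0) \o id).
  apply: is_diff_comp; first exact: is_diff_addc.
  have -> : s *: v + u0 + t *: w = s *: v + t *: w + u0 by rewrite addrAC.
  exact: is_diff_dif.
have [s st E] : exists2 s, 0 < s < t &
    F (t *: v + u0) - F u0 = t * dif F (s *: v + u0) v.
  by apply: MVT_line => // s st; have [] := Fdiff s st.
have {}st : 0 <= s <= t by case/andP: st => ? ?; rewrite !ltW.
have -> : f (t *: v + (t *: w + u0)) - f (t *: v + u0) - f (t *: w + u0) + f u0
    = F (t *: v + u0) - F u0.
  rewrite /F opprB addrA [t *: v + _ + _]addrAC -addrA [u0 + _]addrC.
  by ring.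
rewrite {}E (dif_val (Fdiff _ st)).
rewrite -mulrBr normrM (gtr0_norm t0) mulrCA ler_pM2l//.
rewrite /=.
have A1 := fd2 _ (le_lt_trans (norm2 _ st) td2).
have A2 := fd2 _ (le_lt_trans (norm1 _ st) td2).
have D2D : D2 v (s *: v + t *: w) = D2 v (s *: v) + t * D2 v w.
  by rewrite [LHS]linearD; congr (_ + _); exact: linearZ.
have -> : dif f (s *: v + t *: w + u0) v - dif f (s *: v + u0) v - t * D2 v w =
  (dif f (u0 + (s *: v + t *: w)) v - dif f u0 v - D2 v (s *: v + t *: w))
  - (dif f (u0 + s *: v) v - dif f u0 v - D2 v (s *: v)).
  rewrite D2D.
  by rewrite [_ + u0]addrC [s *: v + u0]addrC; ring.
apply: le_trans (ler_normB _ _) _; apply: le_trans (lerD A1 A2) _.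
have H : e / (M + M) * (t * M) + e / (M + M) * (t * M) = e * t.
  by rewrite -mulrDr -mulrDr (mulrC t) mulrA divfK// gt_eqF// addr_gt0.
by rewrite -H lerD// ler_wpM2l ?norm1 ?norm2//; exact: ltW.
Qed.

(** The second difference is symmetric in [v] and [w], and [t ^ 2] times either mixed derivative is
    its leading term. *)
Lemma second_diff_sym v w : D2 v w = D2 w v.
Proof.
apply/eqP; rewrite -subr_eq0 -normr_le0; apply/ler_addgt0Pr => e e0.
rewrite add0r.
have e20 : 0 < e / 2 by rewrite divr_gt0.
have [d1 d10 P1] := second_difference v w e20.
have [d2 d20 P2] := second_difference w v e20.
pose t := Num.min d1 d2 / 2.
have m0 : 0 < Num.min d1 d2 by rewrite lt_min d10.
have t0 : 0 < t by rewrite divr_gt0.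
have tm : t < Num.min d1 d2 by rewrite ltr_pdivrMr// ltr_pMr// ltr1n.
have /P1 H1 : 0 < t < d1 by rewrite t0 (lt_le_trans tm)// ge_min lexx.
have /P2 H2 : 0 < t < d2 by rewrite t0 (lt_le_trans tm)// ge_min lexx orbT.
rewrite -(ler_pM2r (mulr_gt0 t0 t0)).
have -> : e * (t * t) = e / 2 * (t * t) + e / 2 * (t * t) by field.
apply: le_trans (lerD H2 H1); apply: le_trans (ler_normB _ _).
rewrite -[X in _ * X <= _](ger0_norm (x := t * t)) ?mulr_ge0
  ?(ltW t0)//; try exact: ltW.
rewrite -normrM addrCA [t *: v + (t *: w + _)]addrCA.
set a := f _; set b := f _; set c := f _; set d := f _.
by rewrite le_eqVlt; apply/orP; left; apply/eqP; congr `|_|; ring.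
Qed.

Hypothesis fmax : \forall u \near u0, f u <= f u0.

Let half_ratio_lt1 (w : V) : 2^-1 * ((`|w| + 1)^-1 * `|w|) < 1.
Proof.
have w0 := normr_ge0 w.
rewrite mulrA -invfM mulrC ltr_pdivrMr ?mulr_gt0 ?ltr_wpDl// mul1r; lra.
Qed.

Lemma diff_eq0_at_max v : dif f u0 v = 0.
Proof.
have fd0 : differentiable f u0 := nbhs_singleton fd.
suff H w : dif f u0 w <= 0.
  apply/eqP; rewrite eq_le H/= -oppr_le0 -raddfN; exact: H.
rewrite leNgt; apply/negP => c0.
set c := dif f u0 w in c0.
have M0 : 0 < `|w| + 1 by rewrite ltr_wpDl.
(* With this tolerance the error along [t w] stays below half of the main term [t c]. *)
have e0 : 0 < c / 2 / (`|w| + 1) by rewrite !divr_gt0.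
have [d d0 dP] := differentiable_eps fd0 e0.
move/nbhs_ballP: fmax => [d' /= d'0 d'P].
pose t := Num.min d d' / 2 / (`|w| + 1).
have m0 : 0 < Num.min d d' by rewrite lt_min d0.
have t0 : 0 < t by rewrite !divr_gt0.
have tw : `|t *: w| < Num.min d d'.
  rewrite normrZ gtr0_norm// (@le_lt_trans _ _ (t * (`|w| + 1)))//.
    by rewrite ler_pM2l// lerDl.
  by rewrite /t divfK ?gt_eqF// ltr_pdivrMr// ltr_pMr// ltr1n.
move: tw; rewrite lt_min => /andP[/dP td td'].
have /d'P/= : ball u0 d' (u0 + t *: w).
  by rewrite -ball_normE /= opprD addrA subrr sub0r normrN.
apply/negP; rewrite -ltNge -subr_gt0.
move: td; rewrite linearZ /= -/c ler_norml => /andP[td _].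
apply: lt_le_trans (_ : t * c - c / 2 / (`|w| + 1) * `|t *: w| <= _).
  rewrite normrZ gtr0_norm// subr_gt0 mulrCA ltr_pM2l//.
  by rewrite -!mulrA gtr_pMr// half_ratio_lt1.
by move: td; rewrite -[t *: c]/(t * c); lra.
Qed.

(** Otherwise the derivative along [v], zero at [u0], would be positive just after it, and the mean
    value theorem would give a value above the maximum. *)
Lemma second_diff_le0_at_max v : D2 v v <= 0.
Proof.
rewrite leNgt; apply/negP => a0; set a := D2 v v in a0.
have M0 : 0 < `|v| + 1 by rewrite ltr_wpDl.
have e0 : 0 < a / 2 / (`|v| + 1) by rewrite !divr_gt0.
have [d d0 dP] := differentiable_eps (fdd v) e0.
have fmd : \forall u \near u0, f u <= f u0 /\ differentiable f u.
  by near=> u; split; near: u; [exact: fmax|exact: fd].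
move/nbhs_ballP: fmd => [d' /= d'0 d'P].
pose t := Num.min d d' / 2 / (`|v| + 1).
have m0 : 0 < Num.min d d' by rewrite lt_min d0.
have t0 : 0 < t by rewrite !divr_gt0.
have tw s : 0 <= s <= t -> `|s *: v| < Num.min d d'.
  move=> /andP[s0 st]; rewrite normrZ ger0_norm// (@le_lt_trans _ _ (t * (`|v| + 1)))//.
    by rewrite ler_pM// lerDl.
  by rewrite /t divfK ?gt_eqF// ltr_pdivrMr// ltr_pMr// ltr1n.
have inb s : 0 <= s <= t -> ball u0 d' (s *: v + u0).
  move=> /tw; rewrite lt_min => /andP[_ ?].
  by rewrite -ball_normE /= opprD addrCA subrr addr0 normrN.
have [s|s /andP[s0 st] E] := @MVT_line f u0 v t t0.
  by move=> /inb/d'P[].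
have /inb/d'P[/= +_] : 0 <= t <= t by rewrite lexx ltW.
apply/negP; rewrite -ltNge -subr_gt0 E mulr_gt0// addrC.
have /tw : 0 <= s <= t by rewrite !ltW.
rewrite lt_min => /andP[/dP + _].
rewrite diff_eq0_at_max subr0 linearZ /= -/a ler_norml => /andP[sd _].
apply: lt_le_trans (_ : s * a - a / 2 / (`|v| + 1) * `|s *: v| <= _).
  rewrite normrZ gtr0_norm// subr_gt0 mulrCA ltr_pM2l//.
  by rewrite -!mulrA gtr_pMr// half_ratio_lt1.
by move: sd; rewrite -[s *: a]/(s * a); lra.
Unshelve. all: by end_near. Qed.

End SecondOrder.

(** Linear coordinates for which the norm is the sup norm. The geometry is developed over an
    abstract normed module with such a frame, and the model space of the charts is supplied later.
    The two norm fields make coordinates continuous and turn coordinatewise bounds into bounds in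
    norm. *)
Record frame (R : realType) (E : normedModType R) (N : nat) := Frame {
  fcoord :> 'I_N -> {linear E -> R^o};
  fvec : 'I_N -> E;
  fcoord_vec : forall i j, fcoord i (fvec j) = (i == j)%:R;
  fcoord_inj : forall z z', fcoord^~ z =1 fcoord^~ z' -> z = z';
  fcoord_norm : forall j z, `|fcoord j z| <= `|z|;
  norm_le_fcoord : forall z c, 0 <= c -> (forall j, `|fcoord j z| <= c) ->
    `|z| <= c
}.

(** * Coordinates, product rules and symmetry for vector valued maps *)

Section FrameTheory.
Context {R : realType} {E : normedModType R} {N : nat}.
Variable fr : frame E N.

Lemma fcoord_sum (c : 'I_N -> R) i : fr i (\sum_j c j *: fvec fr j) = c i.
Proof.
rewrite linear_sum (bigD1 i)//= linearZ /= fcoord_vec eqxx big1 ?addr0.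
  exact: mulr1.
by move=> k ki; rewrite linearZ /= fcoord_vec eq_sym (negbTE ki); exact: mulr0.
Qed.

Lemma fvec_decomp (z : E) : z = \sum_j fr j z *: fvec fr j.
Proof. by apply: (fcoord_inj (f := fr)) => i; rewrite fcoord_sum. Qed.

Lemma fcoord_continuous j : continuous (fr j).
Proof.
move=> z; apply/cvgrPdist_lt => e e0.
apply/(nbhs_ballP z); exists e => //= y.
rewrite -ball_normE /= => zy; rewrite -linearB.
by apply: le_lt_trans zy; exact: fcoord_norm.
Qed.

Definition frame_trace (T : E -> E) : R := \sum_j fr j (T (fvec fr j)).

End FrameTheory.

Section ProductRule.
Context {R : realType}.

Lemma is_diff_scale (V W : normedModType R) (k : V -> R^o) (f : V -> W) u dk df :
  is_diff u k dk -> is_diff u f df ->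
  is_diff u (fun v => k v *: f v) (fun v => k u *: df v + dk v *: f u).
Proof.
move=> dku dfu.
have scale_diff (p : R^o * W) :
    is_diff p (fun q => q.1 *: q.2) (fun q => p.1 *: q.2 + q.1 *: p.2).
  pose m (a : R^o) (w : W) : W := a *: w.
  have mbil : bilinear_for (GRing.Scale.Law.clone _ _ *:%R _)
      (GRing.Scale.Law.clone _ _ *:%R _) m.
    split=> [w|b] a x y; rewrite /m /=; first by rewrite scalerDl scalerA.
    by rewrite scalerDr !scalerA mulrC.
  pose mB := bilinear_isBilinear.Build R R^o W W _ _ m mbil.
  pose M : {bilinear R^o -> W -> W} := HB.pack m mB.
  have Mc : continuous (fun q => M q.1 q.2) by exact: scale_continuous.
  by apply: DiffDef;
    [exact: (differentiable_bilin p Mc)|exact: (diff_bilin p Mc)].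
have := @is_diff_comp _ _ _ _ (fun v => (k v, f v)) _ (fun q => q.1 *: q.2)
  _ u (is_diff_pair dku dfu) (scale_diff (k u, f u)).
by [].
Qed.

Lemma is_diff_sum (V W : normedModType R) (I : Type) (r : seq I)
    (f df : I -> V -> W) u : (forall i, is_diff u (f i) (df i)) ->
  is_diff u (fun v => \sum_(i <- r) f i v) (fun v => \sum_(i <- r) df i v).
Proof.
move=> fd; elim: r => [|i r IHr].
  have -> : (fun v => \sum_(i <- [::]) f i v) = cst 0.
    by apply/funext => v; rewrite big_nil.
  apply: (is_diff_ext (is_diff_cst 0 u)) => v /=.
  by rewrite big_nil.
have -> : (fun v => \sum_(i <- i :: r) f i v) =
    f i \+ (fun v => \sum_(i <- r) f i v).
  by apply/funext => v; rewrite big_cons.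
apply: (is_diff_ext (is_diffD (fd i) IHr)) => v.
by rewrite big_cons.
Qed.

Variables (E : normedModType R) (N : nat) (fr : frame E N).

(* Linearity of [dif F v] lets [X v] be expanded in coordinates, so that only
   the directional derivatives of [F] along fixed vectors are differentiated. *)
Lemma is_diff_app (W : normedModType R) (F : E -> W) (X : E -> E) u :
  (forall v, differentiable (fun u' => dif F u' v) u) -> differentiable X u ->
  is_diff u (fun u' => dif F u' (X u'))
    (fun w => dif F u (dif X u w) + dif (fun u' => dif F u' (X u)) u w).
Proof.
move=> ddF dX.
have dec u' z : dif F u' z = \sum_j fr j z *: dif F u' (fvec fr j).
  by rewrite {1}(fvec_decomp fr z) linear_sum; apply: eq_bigr => j _; rewrite linearZ.
have -> : (fun u' => dif F u' (X u')) =
    (fun u' => \sum_j fr j (X u') *: dif F u' (fvec fr j)).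
  by apply/funext => u'; exact: dec.
have dc j : is_diff u (fr j \o X : E -> R^o) (fr j \o dif X u).
  apply: is_diff_comp; first exact: is_diff_dif.
  by apply: is_diff_lin; exact: fcoord_continuous.
have dD v : is_diff u (fun u' => dif F u' v) (dif (fun u' => dif F u' v) u).
  exact: is_diff_dif.
have S := is_diff_sum (index_enum 'I_N)
  (fun j => is_diff_scale (dc j) (dD (fvec fr j))).
have T : is_diff u (fun u' => dif F u' (X u))
    (fun w => \sum_j fr j (X u) *: dif (fun u' => dif F u' (fvec fr j)) u w).
  have -> : (fun u' => dif F u' (X u)) =
      (fun u' => \sum_j fr j (X u) *: dif F u' (fvec fr j)).
    by apply/funext => u'; exact: dec.
  exact: is_diff_sum.
have TE w : dif (fun u' => dif F u' (X u)) u w =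
    \sum_j fr j (X u) *: dif (fun u' => dif F u' (fvec fr j)) u w.
  exact: (dif_val T).
refine (is_diff_ext S _) => w.
rewrite big_split addrC.
congr (_ + _).
  exact/esym/TE.
exact/esym/(dec u).
Qed.

Lemma second_diff_sym_vec (V : normedModType R) (F : V -> E) u0 v w :
  (\forall u \near u0, differentiable F u) ->
  (forall v, differentiable (fun u => dif F u v) u0) ->
  dif (fun u => dif F u v) u0 w = dif (fun u => dif F u w) u0 v.
Proof.
move=> Fd Fdd; apply: (fcoord_inj (f := fr)) => j.
pose f u := fr j (F u) : R.
have fE u : differentiable F u -> is_diff u f (fr j \o dif F u).
  move=> Fu; apply: is_diff_comp; first exact: is_diff_dif.
  by apply: is_diff_lin; exact: fcoord_continuous.
have fd : \forall u \near u0, differentiable f u.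
  by near=> u; apply: is_diffP; apply: fE; near: u.
have ddE z : is_diff u0 (fun u => dif f u z) (fr j \o dif (fun u => dif F u z) u0).
  have : is_diff u0 (fr j \o (fun u => dif F u z))
      (fr j \o dif (fun u => dif F u z) u0).
    apply: is_diff_comp; first exact: is_diff_dif.
    by apply: is_diff_lin; exact: fcoord_continuous.
  apply: is_diff_near; near=> u.
  by apply/esym/(dif_val (df := fr j \o dif F u)); apply: fE; near: u.
have := second_diff_sym fd (fun z => is_diffP (ddE z)) v w.
by rewrite !(dif_val (ddE _)).
Unshelve. all: by end_near. Qed.

End ProductRule.

(** * Extrema of the modulus of a complex function *)

Section CriticalPoint.
Context {R : realType} {E : normedModType R} {N : nat}.
Variable fr : frame E N.
Variables (P Q : E -> R) (u0 : E).
Hypothesis dP : \forall u \near u0, differentiable P u.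
Hypothesis dQ : \forall u \near u0, differentiable Q u.
Hypothesis ddP : forall v, differentiable (fun u => dif P u v) u0.
Hypothesis ddQ : forall v, differentiable (fun u => dif Q u v) u0.
Hypotheses (P1 : P u0 = 1) (Q0 : Q u0 = 0).

(* Half of the Hessian of [P ^ 2 + Q ^ 2] at [u0], when [dif P u0 = 0]. *)
Definition half_hessian (v w : E) : R :=
  dif (fun u => dif P u w) u0 v + dif Q u0 v * dif Q u0 w.

Lemma half_hessian_sym v w : half_hessian v w = half_hessian w v.
Proof. by rewrite /half_hessian (second_diff_sym dP ddP) mulrC. Qed.

Let sqnorm u := P u * P u + Q u * Q u.

Let is_diff_sqnorm u : differentiable P u -> differentiable Q u ->
  is_diff u sqnorm (fun v => 2 * (P u * dif P u v + Q u * dif Q u v)).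
Proof.
move=> /is_diff_dif Pu /is_diff_dif Qu.
apply: is_diff_ext (is_diff_fD (is_diff_fM Pu Pu) (is_diff_fM Qu Qu)) _ => v.
by ring.
Qed.

Let sqnorm_diff : \forall u \near u0, differentiable sqnorm u.
Proof.
near=> u; apply: is_diffP; apply: is_diff_sqnorm; near: u; [exact: dP|exact: dQ].
Unshelve. all: by end_near. Qed.

(** The normalization [P = 1], [Q = 0] at [u0] removes the second derivatives of [Q]. Besides
    [half_hessian] there remains a product of two values of [dif P u0], zero at an extremum. *)
Let sqnorm_ddiff v : is_diff u0 (fun u => dif sqnorm u v)
  (fun w => 2 * (dif P u0 w * dif P u0 v + half_hessian w v)).
Proof.
have /is_diff_dif Pu := nbhs_singleton dP.
have /is_diff_dif Qu := nbhs_singleton dQ.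
have /is_diff_dif Pv := ddP v.
have /is_diff_dif Qv := ddQ v.
have D := is_diff_cM 2 (is_diff_fD (is_diff_fM Pu Pv) (is_diff_fM Qu Qv)).
have {D} := is_diff_ext D
  (df' := fun w => 2 * (dif P u0 w * dif P u0 v + half_hessian w v)).
have ext (w : E) : 2 * (dif P u0 w * dif P u0 v + half_hessian w v) =
   2 * (P u0 * dif (fun u => dif P u v) u0 w + dif P u0 v * dif P u0 w
      + (Q u0 * dif (fun u => dif Q u v) u0 w + dif Q u0 v * dif Q u0 w)).
  by rewrite P1 Q0 /half_hessian; ring.
move=> D; have {}D := D (fun w => esym (ext w)).
apply: is_diff_near D; near=> u.
apply/esym/(dif_val (df := fun v => 2 * (P u * dif P u v + Q u * dif Q u v))).
by apply: is_diff_sqnorm; near: u; [exact: dP|exact: dQ].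
Unshelve. all: by end_near. Qed.

(** By the normalization at [u0], the differential of [P ^ 2 + Q ^ 2] there is [2 dif P]: an
    extremum constrains the real part and leaves [dif Q] free. *)
Lemma critical_real_part v :
  (\forall u \near u0, sqnorm u <= sqnorm u0) \/
  (\forall u \near u0, sqnorm u0 <= sqnorm u) -> dif P u0 v = 0.
Proof.
have dS : dif sqnorm u0 v = 2 * dif P u0 v.
  have := is_diff_sqnorm (nbhs_singleton dP) (nbhs_singleton dQ).
  by move=> /dif_val ->; rewrite P1 Q0; ring.
move=> ext; suff : 2 * dif P u0 v = 0 by move/eqP; rewrite mulf_eq0 => /orP[|/eqP//]; lra.
rewrite -dS; case: ext => [mx|mn].
  exact: (diff_eq0_at_max sqnorm_diff).
have dN : \forall u \near u0, is_diff u (fun u => - sqnorm u)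
    (fun v => - dif sqnorm u v).
  near=> u; apply: is_diff_fN; apply: is_diff_dif; near: u; exact: sqnorm_diff.
have := @diff_eq0_at_max _ _ ((fun u => - sqnorm u)) u0.
move=> H.
apply/oppr_inj; rewrite oppr0 -[LHS](dif_val (nbhs_singleton dN)); apply: H; near=> u.
- by apply: (is_diffP (df := fun v => - dif sqnorm u v)); near: u.
- by rewrite /= lerN2; near: u.
Unshelve. all: by end_near. Qed.

Lemma half_hessian_max v : (\forall u \near u0, sqnorm u <= sqnorm u0) ->
  half_hessian v v <= 0.
Proof.
move=> mx; have := @second_diff_le0_at_max _ _ sqnorm u0 sqnorm_diff
  (fun v => is_diffP (sqnorm_ddiff v)) mx v.
rewrite (dif_val (sqnorm_ddiff v)) (critical_real_part v (or_introl mx)) mul0r add0r; lra.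
Qed.

Lemma half_hessian_min v : (\forall u \near u0, sqnorm u0 <= sqnorm u) ->
  0 <= half_hessian v v.
Proof.
move=> mn; pose S := (fun u => - sqnorm u).
have dN : \forall u \near u0, is_diff u S (fun v => - dif sqnorm u v).
  near=> u; apply: is_diff_fN; apply: is_diff_dif; near: u; exact: sqnorm_diff.
have ddN w : is_diff u0 (fun u => dif S u w)
    (fun v => - dif (fun u => dif sqnorm u w) u0 v).
  have := is_diff_fN (is_diff_dif (is_diffP (sqnorm_ddiff w))).
  apply: is_diff_near; near=> u.
  by apply/esym/(dif_val (df := fun v => - dif sqnorm u v)); near: u.
have SN : \forall u \near u0, differentiable S u.
  by near=> u; apply: (is_diffP (df := fun v => - dif sqnorm u v)); near: u.
have mx : \forall u \near u0, S u <= S u0.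
  by near do rewrite /S /= lerN2.
have := @second_diff_le0_at_max _ _ S u0 SN (fun v => is_diffP (ddN v)) mx v.
rewrite (dif_val (ddN v)) /= (dif_val (sqnorm_ddiff v)).
rewrite (critical_real_part v (or_intror mn)) mul0r add0r; lra.
Unshelve. all: by end_near. Qed.

(* The two hypotheses on each field are the real and imaginary parts of
   [(X + i JX) (P + i Q) = (a + i b) (P + i Q)]; the first is used only at [u0]. *)
Lemma critical_bracket (X X' Y Y' : E -> E) (a b a' b' : R) :
  (forall v, dif P u0 v = 0) ->
  [/\ differentiable X u0, differentiable X' u0, differentiable Y u0
    & differentiable Y' u0] ->
  - dif Q u0 (X' u0) = a -> - dif Q u0 (Y' u0) = a' ->
  (\forall u \near u0, dif Q u (X u) + dif P u (X' u) = a * Q u + b * P u) ->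
  (\forall u \near u0, dif Q u (Y u) + dif P u (Y' u) = a' * Q u + b' * P u) ->
  dif Q u0 (dif Y u0 (X u0) - dif X u0 (Y u0))
  = half_hessian (Y u0) (X' u0) - half_hessian (X u0) (Y' u0).
Proof.
move=> P'0 [dX dX' dY dY'] aE a'E XE YE.
(* The imaginary equation is differentiated along [w]; the derivative of [Z'] enters only through
   [dif P u0], which is zero. *)
have key (Z Z' : E -> E) (c d : R) (w : E) :
  differentiable Z u0 -> differentiable Z' u0 ->
  (\forall u \near u0, dif Q u (Z u) + dif P u (Z' u) = c * Q u + d * P u) ->
  dif Q u0 (dif Z u0 w) + dif (fun u => dif Q u (Z u0)) u0 w
    + dif (fun u => dif P u (Z' u0)) u0 w = c * dif Q u0 w.
  move=> dZ dZ' ZE.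
  have L := is_diff_fD (is_diff_app fr ddQ dZ) (is_diff_app fr ddP dZ').
  have /is_diff_dif Pu := nbhs_singleton dP.
  have /is_diff_dif Qu := nbhs_singleton dQ.
  have Rr := is_diff_fD (is_diff_cM c Qu) (is_diff_cM d Pu).
  have := is_diff_uniq (is_diff_near ZE L) Rr w.
  by rewrite !P'0 mulr0 add0r addr0.
have KX := key X X' a b (Y u0) dX dX' XE.
have KY := key Y Y' a' b' (X u0) dY dY' YE.
rewrite linearB /= /half_hessian.
(* In the difference of [KX] and [KY] the second derivatives of [Q] cancel. The constants [a] and
   [a'], rewritten by the real equation at [u0], supply the products of values of [dif Q] in the
   half Hessians. *)
have := second_diff_sym dQ ddQ (X u0) (Y u0).
rewrite -aE in KX; rewrite -a'E in KY.
lra.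
Qed.

End CriticalPoint.

(** * Derivations applied to determinants *)

Section DetDerivation.
Variables (K : comNzRingType) (T : Type) (t0 : T) (der : (T -> K) -> K -> Prop).
Hypothesis der_cst : forall c, der (fun=> c) 0.
Hypothesis derD : forall f g f' g', der f f' -> der g g' ->
  der (fun t => f t + g t) (f' + g').
Hypothesis derM : forall f g f' g', der f f' -> der g g' ->
  der (fun t => f t * g t) (f t0 * g' + g t0 * f').

Lemma der_sum (I : Type) (r : seq I) (f : I -> T -> K) (f' : I -> K) :
  (forall i, der (f i) (f' i)) ->
  der (fun t => \sum_(i <- r) f i t) (\sum_(i <- r) f' i).
Proof.
move=> fd; elim: r => [|i r IHr].
  rewrite big_nil (_ : (fun _ => _) = fun=> 0) //.
  by apply/funext => t; rewrite big_nil.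
rewrite big_cons (_ : (fun _ => _) = fun t => f i t + \sum_(i <- r) f i t).
  exact: derD.
by apply/funext => t; rewrite big_cons.
Qed.

Lemma der_prod (I : eqType) (r : seq I) (f : I -> T -> K) (f' : I -> K) :
  (forall i, der (f i) (f' i)) -> uniq r ->
  der (fun t => \prod_(i <- r) f i t)
    (\sum_(i <- r) \prod_(j <- r) (if j == i then f' j else f j t0)).
Proof.
move=> fd; elim: r => [|i r IHr] /=.
  rewrite big_nil (_ : (fun _ => _) = fun=> 1) //.
  by apply/funext => t; rewrite big_nil.
move=> /andP[ir /IHr dr].
rewrite (_ : (fun _ => _) = fun t => f i t * \prod_(i <- r) f i t); last first.
  by apply/funext => t; rewrite big_cons.
have := derM (fd i) dr; congr der; rewrite big_cons addrC; congr (_ + _).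
  rewrite big_cons eqxx mulrC; congr (_ * _).
  apply: eq_big_seq => j jr; case: eqP => // ji.
  by rewrite -ji jr in ir.
rewrite mulr_sumr; apply: eq_big_seq => j jr; rewrite big_cons.
by case: eqP => // ij; rewrite ij jr in ir.
Qed.

(** Jacobi's formula. The relation [der] is abstract so as to cover the operator [X + i J X], real
    directional derivatives and, with its second argument ignored, smoothness of determinants. *)
Lemma der_det m (M : T -> 'M[K]_m) (M' : 'M[K]_m) :
  (forall i j, der (fun t => M t i j) (M' i j)) ->
  der (fun t => \det (M t)) (\tr (M' *m \adj (M t0))).
Proof.
move=> Md; rewrite /determinant.
(* [N i] is [M t0] with row [i] taken from [M']; expanding its determinant along that row gives a
   diagonal entry of [M' adj (M t0)]. *)
pose N i := \matrix_(k, j) (if k == i then M' k j else M t0 k j).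
have -> : \tr (M' *m \adj (M t0)) = \sum_i \det (N i).
  apply: eq_bigr => i _; rewrite (expand_det_row _ i) mxE.
  apply: eq_bigr => j _; rewrite !mxE eqxx; congr (_ * (_ * \det _)).
  by apply/matrixP => k l; rewrite !mxE eq_sym (negbTE (neq_lift _ _)).
rewrite (exchange_big_dep xpredT)//=.
apply: der_sum => s; have -> : \sum_i (-1) ^+ s * \prod_j N i j (s j) =
   (-1) ^+ s * (\sum_i \prod_j (if j == i then M' j (s j) else M t0 j (s j)))
   + (\prod_i M t0 i (s i)) * 0.
  rewrite mulr0 addr0 mulr_sumr; apply: eq_bigr => i _; congr (_ * _).
  by apply: eq_bigr => j _; rewrite mxE.
apply: (derM (f := fun=> (-1) ^+ s)) => //.
by apply: der_prod => //; exact: index_enum_uniq.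
Qed.

(** As [M adj M] is the scalar matrix [det M], Jacobi's formula becomes Liouville's: the logarithmic
    derivative is the trace of [S]. *)
Lemma der_det_row m (M : T -> 'M[K]_m) (S : 'M[K]_m) :
  (forall i j, der (fun t => M t i j) ((S *m M t0) i j)) ->
  der (fun t => \det (M t)) (\tr S * \det (M t0)).
Proof.
move=> /der_det; congr der.
by rewrite -mulmxA mul_mx_adj mxtrace_mulC mul_scalar_mx mxtraceZ mulrC.
Qed.

End DetDerivation.

(** * The linear algebra of (1,1) forms *)

Section AlternatingForm.
Context {R : realType} {E : lmodType R}.
Variables (J : E -> E) (JK : forall v, J (J v) = - v).

(* A form of type (1,1) vanishing on the pairs [(x, J x)] is zero. *)
Lemma alternating_eq0 (F : lmodType R) (J' : {linear F -> F}) (val val' : F -> E)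
    (H H' : E -> E -> R) (beta : F -> F -> R) :
  (forall x, J' (J' x) = - x) -> (forall x, val (J' x) = J (val x)) ->
  (forall x, val' (J' x) = J (val' x)) ->
  (forall x y z, beta (x + y) z = beta x z + beta y z) ->
  (forall x y z, beta z (x + y) = beta z x + beta z y) ->
  (forall v w, H v w = H w v) ->
  (forall v w, H v (- w) = - H v w) ->
  (forall v, H v v <= 0) -> (forall v, 0 <= H' v v) ->
  (forall v w, H' v (- w) = - H' v w) ->
  (forall x y, beta x y = H (val y) (J (val x)) - H (val x) (J (val y))) ->
  (forall x y, beta x y = H' (val' y) (J (val' x)) - H' (val' x) (J (val' y))) ->
  forall x y, beta x y = 0.
Proof.
move=> J'K vJ v'J bD bD' Hs HN Hle Hge H'N bH bH' x y.
(* This value is [H (J z) (J z) + H z z] at one point and the same with [H'] at the other, so it has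
   both signs. *)
have bJ z : beta z (J' z) = 0.
  apply/eqP; rewrite eq_le {1}bH bH' !vJ !v'J !JK HN H'N !opprK.
  by apply/andP; split; [rewrite -oppr_ge0 opprD addr_ge0// oppr_ge0|rewrite addr_ge0].
have bC z w : beta z w = - beta w z by rewrite !bH opprB.
have bN z w : beta z (- w) = - beta z w.
  have b0 : beta z 0 = 0 by have := bD' 0 0 z; rewrite addr0; lra.
  by apply/eqP; rewrite -addr_eq0 -bD' addNr b0.
(* Polarization of [bJ]. *)
have bpol z w : beta z (J' w) = beta (J' z) w.
  have := bJ (z + w).
  rewrite linearD bD !bD' !bJ (bC (J' z) w); lra.
have b11 : beta (J' x) (J' y) = beta x y.
  by rewrite !bH !vJ !JK !HN Hs [H (J _) _]Hs; lra.
(* [bpol] gives [- beta x y = beta (J' x) (J' y)], while [b11] gives the opposite sign. *)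
have := bpol x (J' y); rewrite J'K bN b11; lra.
Qed.

End AlternatingForm.

(** * Charts and their domains *)

Section Charts.

Lemma chart_continuous_at (E M : topologicalType) (c : chart E M) p :
  is_chart c -> cdom c p -> {for p, continuous (cmap c)}.
Proof. by case=> _ _ _ _ [+ _] => /[apply]. Qed.

Lemma chart_inv_continuous_at (E M : topologicalType) (c : chart E M) u :
  is_chart c -> cimg c u -> {for u, continuous (cinv c)}.
Proof. by case=> _ _ _ _ [_ +] => /[apply]. Qed.

Lemma cmapK (E M : topologicalType) (c : chart E M) p :
  is_chart c -> cdom c p -> cinv c (cmap c p) = p.
Proof. by case=> _ _ _ [+ _] _ => /[apply]. Qed.

Lemma cinvK (E M : topologicalType) (c : chart E M) u :
  is_chart c -> cimg c u -> cmap c (cinv c u) = u.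
Proof. by case=> _ _ _ [_ +] _ => /[apply]. Qed.

Lemma cimg_cmap (E M : topologicalType) (c : chart E M) p :
  is_chart c -> cdom c p -> cimg c (cmap c p).
Proof. by case=> _ + _ _ _ => /[apply]. Qed.

Lemma cdom_cinv (E M : topologicalType) (c : chart E M) u :
  is_chart c -> cimg c u -> cdom c (cinv c u).
Proof. by case=> _ _ + _ _ => /[apply]. Qed.

Lemma open_cdom (E M : topologicalType) (c : chart E M) :
  is_chart c -> open (cdom c).
Proof. by case=> -[]. Qed.

Lemma open_cimg (E M : topologicalType) (c : chart E M) :
  is_chart c -> open (cimg c).
Proof. by case=> -[]. Qed.

Lemma open_local_dom (E M E' M' : topologicalType) (c : chart E M)
    (c' : chart E' M') (f : M -> M') :
  is_chart c -> is_chart c' -> continuous f -> open (local_dom c c' f).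
Proof.
move=> cc cc' fc; rewrite openE => u [cu c'u]; apply: filterI.
  by apply: open_nbhs_nbhs; split=> //; exact: open_cimg.
have : {for u, continuous (f \o cinv c)}.
  by apply: continuous_comp; [exact: chart_inv_continuous_at|exact: fc].
by apply; apply: open_nbhs_nbhs; split=> //; exact: open_cdom.
Qed.

Lemma is_chart_prod (E M E' M' : topologicalType) (I I' : Type)
    (A : I -> chart E M) (A' : I' -> chart E' M') i i' :
  is_chart (A i) -> is_chart (A' i') -> is_chart (prod_atlas A A' (i, i')).
Proof.
move=> Ai Ai'; split=> /=.
- have openX (X Y : topologicalType) (U : set X) (W : set Y) :
      open U -> open W -> open (U `*` W).
    move=> oU oW; apply: openI.
      by apply: (open_comp (f := fst)) => // p _; exact: cvg_fst.
    by apply: (open_comp (f := snd)) => // p _; exact: cvg_snd.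
  by split; apply: openX; by [exact: open_cdom|exact: open_cimg].
- by move=> -[p q] [/= ? ?]; split; exact: cimg_cmap.
- by move=> -[p q] [/= ? ?]; split; exact: cdom_cinv.
- split=> -[p q] [/= ? ?]; first by rewrite !cmapK.
  by rewrite !cinvK.
- split=> -[p q] [/= ? ?].
    apply: cvg_pair => /=.
      apply: (@cvg_comp _ _ _ fst (cmap (A i)) _ (nbhs p)).
        exact: cvg_fst.
      exact: chart_continuous_at.
    apply: (@cvg_comp _ _ _ snd (cmap (A' i')) _ (nbhs q)).
      exact: cvg_snd.
    exact: chart_continuous_at.
  apply: cvg_pair => /=.
    apply: (@cvg_comp _ _ _ fst (cinv (A i)) _ (nbhs p)).
      exact: cvg_fst.
    exact: chart_inv_continuous_at.
  apply: (@cvg_comp _ _ _ snd (cinv (A' i')) _ (nbhs q)).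
    exact: cvg_snd.
  exact: chart_inv_continuous_at.
Qed.

Lemma chart_imageE (E M : topologicalType) (c : chart E M) (U : set M) :
  is_chart c -> U `<=` cdom c -> cmap c @` U = cimg c `&` cinv c @^-1` U.
Proof.
move=> cc Uc; apply/seteqP; split=> u /=.
  move=> [p Up <-]; have cp := Uc p Up; rewrite cmapK//; split=> //.
  exact: cimg_cmap.
by move=> [iu Uu]; exists (cinv c u) => //; rewrite cinvK.
Qed.

Lemma open_chart_image (E M : topologicalType) (c : chart E M) (U : set M) :
  is_chart c -> U `<=` cdom c -> open U -> open (cmap c @` U).
Proof.
move=> cc Uc oU; rewrite chart_imageE// openE => u [iu cu]; apply: filterI.
  by apply: open_nbhs_nbhs; split=> //; exact: open_cimg.
by apply: (chart_inv_continuous_at cc iu); exact: open_nbhs_nbhs.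
Qed.

End Charts.

(** * Left invariant vector fields in charts *)

Section LeftInvariantFields.
Context {R : realType} {E : normedModType R} {N : nat}.
Variable fr : frame E N.
Context {G : topGroupType} {I : Type}.
Variable A : I -> chart E G.
Hypothesis Ac : forall i, is_chart (A i).
Hypothesis mul_smooth :
  smooth_map (prod_atlas A A) A (fun p : G * G => p.1 * p.2)%g.
Hypothesis trans_smooth : forall g : G, smooth_map A A (fun p => g * p)%g.
Variable i0 : I.
Hypothesis i0P : cdom (A i0) 1%g.

Let e0 := cmap (A i0) 1%g.
Let e0P : cimg (A i0) e0. Proof. exact: cimg_cmap. Qed.
Let cinv_e0 : cinv (A i0) e0 = 1%g. Proof. exact: cmapK. Qed.

Definition ltrans (g : G) i j : E -> E :=
  local_expr (A i) (A j) (fun p => g * p)%g.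

Definition ltrans_dom (g : G) i j : set E :=
  local_dom (A i) (A j) (fun p => g * p)%g.

Lemma open_ltrans_dom g i j : open (ltrans_dom g i j).
Proof. by apply: open_local_dom => //; have [] := trans_smooth g. Qed.

Lemma ltrans_smooth g i j : smooth_on (ltrans_dom g i j) (ltrans g i j).
Proof. by have [_] := trans_smooth g; apply. Qed.

Lemma is_diff_ltrans g i j u : ltrans_dom g i j u ->
  is_diff u (ltrans g i j) (dif (ltrans g i j) u).
Proof.
move=> Du; apply: is_diff_dif.
exact: smooth_on_differentiable (@ltrans_smooth g i j) Du.
Qed.

Lemma near_ltrans_dom g i j u : ltrans_dom g i j u ->
  \forall u' \near u, ltrans_dom g i j u'.
Proof. by move=> Du; apply: open_nbhs_nbhs; split=> //; exact: open_ltrans_dom. Qed.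

Lemma cinv_ltrans g i j u : ltrans_dom g i j u ->
  cinv (A j) (ltrans g i j u) = (g * cinv (A i) u)%g.
Proof. by move=> [iu ju]; rewrite /ltrans /local_expr cmapK. Qed.

Lemma cimg_ltrans g i j u : ltrans_dom g i j u -> cimg (A j) (ltrans g i j u).
Proof. by move=> [iu ju]; exact: cimg_cmap. Qed.

Lemma ltrans_domM g h i j k u : ltrans_dom h i j u ->
  ltrans_dom (g * h)%g i k u -> ltrans_dom g j k (ltrans h i j u).
Proof.
move=> Du [_ Dku]; split; first exact: cimg_ltrans.
by rewrite cinv_ltrans// mulgA.
Qed.

Lemma ltransM g h i j k u : ltrans_dom h i j u ->
  ltrans g j k (ltrans h i j u) = ltrans (g * h)%g i k u.
Proof. by move=> Du; rewrite /ltrans {1}/local_expr cinv_ltrans// mulgA. Qed.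

Lemma dif_ltransM g h i j k u v : ltrans_dom h i j u ->
  ltrans_dom (g * h)%g i k u ->
  dif (ltrans (g * h)%g i k) u v
  = dif (ltrans g j k) (ltrans h i j u) (dif (ltrans h i j) u v).
Proof.
move=> Dh Dgh; have Dg := ltrans_domM Dh Dgh.
apply: (dif_val (df := dif (ltrans g j k) (ltrans h i j u) \o dif (ltrans h i j) u)).
have := is_diff_comp (g := ltrans g j k) (is_diff_ltrans Dh) (is_diff_ltrans Dg).
apply: is_diff_near; near=> u'; rewrite /= ltransM//.
by near: u'; exact: near_ltrans_dom.
Unshelve. all: by end_near. Qed.

Lemma ltrans_dom_e0 i p : cdom (A i) p -> ltrans_dom p i0 i e0.
Proof. by move=> ip; split; rewrite ?cinv_e0 ?mulg1. Qed.

Lemma ltrans_e0 i u : cimg (A i) u -> ltrans (cinv (A i) u) i0 i e0 = u.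
Proof. by move=> iu; rewrite /ltrans /local_expr cinv_e0 mulg1 cinvK. Qed.

(** Left translation carries [v], a tangent vector at the identity read in the chart [i0], to the
    point of coordinate [u]. The value 0 off the chart follows the convention of [vector_field]. *)
Definition lfield (v : E) i (u : E) : E :=
  if u \in cimg (A i) then dif (ltrans (cinv (A i) u) i0 i) e0 v else 0.

Lemma lfieldE v i u : cimg (A i) u ->
  lfield v i u = dif (ltrans (cinv (A i) u) i0 i) e0 v.
Proof. by move=> iu; rewrite /lfield mem_set. Qed.

Lemma lfield_out v i u : ~ cimg (A i) u -> lfield v i u = 0.
Proof. by move=> iu; rewrite /lfield memNset. Qed.

Lemma lfield_is_linear i u : linear (fun v => lfield v i u).
Proof.
move=> a v w; rewrite /lfield; case: ifP => _; last by rewrite scaler0 addr0.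
exact: linearP.
Qed.

Lemma lfieldD v w i u : lfield (v + w) i u = lfield v i u + lfield w i u.
Proof. by have := lfield_is_linear i u 1 v w; rewrite !scale1r. Qed.

Lemma lfield0 i u : lfield 0 i u = 0.
Proof. by apply/(addrI (lfield 0 i u)); rewrite -lfieldD !addr0. Qed.

Lemma lfieldZ a v i u : lfield (a *: v) i u = a *: lfield v i u.
Proof. by have := lfield_is_linear i u a v 0; rewrite lfield0 !addr0. Qed.

Lemma lfield_ltrans v g i j u : ltrans_dom g i j u ->
  lfield v j (ltrans g i j u) = dif (ltrans g i j) u (lfield v i u).
Proof.
move=> Du; have [iu ju] := Du.
rewrite (lfieldE v (cimg_ltrans Du)) cinv_ltrans// (lfieldE v iu).
rewrite (dif_ltransM (j := i)) ?ltrans_e0//.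
- by apply: ltrans_dom_e0; exact: cdom_cinv.
- exact: ltrans_dom_e0.
Qed.

Lemma lfield_e0 v : lfield v i0 e0 = v.
Proof.
rewrite lfieldE// cinv_e0; apply: (dif_val (df := id)).
have D := is_diff_id e0; apply: is_diff_near D; near=> u.
have iu : cimg (A i0) u.
  by near: u; apply: open_nbhs_nbhs; split=> //; exact: open_cimg.
by rewrite /ltrans /local_expr mul1g cinvK.
Unshelve. all: by end_near. Qed.

Lemma lfield_inv v i u : cimg (A i) u ->
  v = dif (ltrans (cinv (A i) u)^-1%g i i0) u (lfield v i u).
Proof.
move=> iu; rewrite -[LHS]lfield_e0.
have Du : ltrans_dom (cinv (A i) u)^-1%g i i0 u by split=> //; rewrite mulVg.
by rewrite -lfield_ltrans// /ltrans /local_expr mulVg.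
Qed.

Lemma lfield_inj v w i u : cimg (A i) u -> lfield v i u = lfield w i u -> v = w.
Proof. by move=> iu vw; rewrite (lfield_inv v iu) vw -(lfield_inv w iu). Qed.

Lemma lfield_unique (Y : I -> E -> E) :
  (forall g i j u, ltrans_dom g i j u ->
     Y j (ltrans g i j u) = dif (ltrans g i j) u (Y i u)) ->
  forall i u, cimg (A i) u -> Y i u = lfield (Y i0 e0) i u.
Proof.
move=> YE i u iu; rewrite lfieldE// -YE ?ltrans_e0//.
exact/ltrans_dom_e0/cdom_cinv.
Qed.

(* The product in the charts [i], [i0] at the source and [i] at the target. *)
Definition mulc i : E * E -> E :=
  local_expr (prod_atlas A A (i, i0)) (A i) (fun p : G * G => p.1 * p.2)%g.

Definition mulc_dom i : set (E * E) :=
  local_dom (prod_atlas A A (i, i0)) (A i) (fun p : G * G => p.1 * p.2)%g.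

Lemma open_mulc_dom i : open (mulc_dom i).
Proof.
by apply: open_local_dom => //; [exact: is_chart_prod|have [] := mul_smooth].
Qed.

Lemma mulc_smooth i : smooth_on (mulc_dom i) (mulc i).
Proof. by have [_] := mul_smooth; apply. Qed.

Lemma mulc_dom_e0 i u : cimg (A i) u -> mulc_dom i (u, e0).
Proof. by move=> iu; split=> //=; rewrite cinv_e0 mulg1; exact: cdom_cinv. Qed.

(** In [lfield] the translation itself varies with [u]. As a partial differential of the product,
    which is smooth in both factors, the field is visibly smooth in [u]. *)
Lemma lfield_mulc v i u : cimg (A i) u ->
  lfield v i u = dif (mulc i) (u, e0) (0, v).
Proof.
move=> iu; rewrite lfieldE//.
apply: (dif_val (df := dif (mulc i) (u, e0) \o (fun w => (0, w)))).
have D1 : is_diff e0 (fun w : E => (u, w)) (fun w => (0, w)).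
  exact: is_diff_pair.
have D2 : is_diff (u, e0) (mulc i) (dif (mulc i) (u, e0)).
  apply: is_diff_dif.
  by apply: (smooth_on_differentiable (@mulc_smooth i)); exact: mulc_dom_e0.
exact: (is_diff_comp D1 D2).
Qed.

Lemma lfield_smooth v i : smooth_on (cimg (A i)) (lfield v i).
Proof.
have oi := open_cimg (Ac i).
have Llin : linear ((fun u => (u, 0)) : E -> (E * E)%type).
  by move=> a x y; congr pair; rewrite /= ?scaler0 ?addr0.
pose LB := GRing.isLinear.Build _ _ _ _ _ Llin.
pose L : {linear E -> (E * E)%type} := HB.pack (fun u : E => (u, 0 : E)) LB.
have Lc : continuous L.
  by move=> u; apply: cvg_pair => /=; [exact: cvg_id|exact: cvg_cst].
have S := smooth_on_dif (0, v) (@mulc_smooth i).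
apply: (smooth_on_ext oi) (_ : smooth_on (cimg (A i))
    ((fun u => dif (mulc i) u (0, v)) \o (fun u => L u + (0, e0)))).
  move=> u /[1!inE] iu /=; rewrite lfield_mulc//; congr (dif _ _ _).
  by congr pair; rewrite /= ?addr0 ?add0r.
move=> k; have := Ck_on_affine (0, e0) (open_mulc_dom (i := i)) Lc (S k).
apply: Ck_on_sub => u iu /=.
rewrite (_ : _ + _ = (u, e0)); first exact: mulc_dom_e0.
by congr pair; rewrite /= ?addr0 ?add0r.
Qed.

Lemma is_diff_lfield v i u : cimg (A i) u ->
  is_diff u (lfield v i) (dif (lfield v i) u).
Proof.
move=> iu; apply: is_diff_dif.
exact: (smooth_on_differentiable (@lfield_smooth v i)).
Qed.

Definition vbracket (X Y : E -> E) u := dif Y u (X u) - dif X u (Y u).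

(** Differentiating the invariance of each field brings in the second differential of the
    translation; its two occurrences in the bracket cancel by symmetry. *)
Lemma vbracket_ltrans v w g i j u : ltrans_dom g i j u ->
  vbracket (lfield v j) (lfield w j) (ltrans g i j u)
  = dif (ltrans g i j) u (vbracket (lfield v i) (lfield w i) u).
Proof.
move=> Du; set F := ltrans g i j; have [iu _] := Du.
have Fd : \forall u' \near u, differentiable F u'.
  near=> u'; apply: is_diffP; apply: is_diff_ltrans.
  by near: u'; exact: near_ltrans_dom.
have Fdd z : differentiable (fun u' => dif F u' z) u.
  by apply: (smooth_on_differentiable (smooth_on_dif z (@ltrans_smooth g i j))).
have key z w' : dif (lfield z j) (F u) (dif F u w')
    = dif F u (dif (lfield z i) u w') + dif (fun u' => dif F u' (lfield z i u)) u w'.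
  have jFu : cimg (A j) (F u) by exact: cimg_ltrans.
  have D1 := is_diff_comp (is_diff_ltrans Du) (is_diff_lfield z jFu).
  have D2 := is_diff_app fr Fdd (is_diffP (is_diff_lfield z iu)).
  have {}D1 : is_diff u (fun u' => dif F u' (lfield z i u'))
      (dif (lfield z j) (F u) \o dif F u).
    apply: is_diff_near D1; near=> u'.
    by rewrite /= lfield_ltrans//; near: u'; exact: near_ltrans_dom.
  exact: (is_diff_uniq D1 D2).
rewrite /vbracket !lfield_ltrans// !key linearB /=.
rewrite (second_diff_sym_vec fr (lfield w i u) (lfield v i u) Fd Fdd) opprD addrACA subrr.
by rewrite addr0.
Unshelve. all: by end_near. Qed.

Definition lie_bracket (v w : E) : E := vbracket (lfield v i0) (lfield w i0) e0.

Lemma vbracket_lfield v w i u : cimg (A i) u ->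
  vbracket (lfield v i) (lfield w i) u = lfield (lie_bracket v w) i u.
Proof.
by move: i u; apply: lfield_unique => g i j u; exact: vbracket_ltrans.
Qed.

End LeftInvariantFields.

(** * The Lie bracket at the identity and the complex structure *)

Section LieBracketAlgebra.
Context {R : realType} {E : normedModType R} {N : nat}.
Variable fr : frame E N.
Context {G : topGroupType} {I : Type}.
Variable A : I -> chart E G.
Hypothesis Ac : forall i, is_chart (A i).
Hypothesis mul_smooth :
  smooth_map (prod_atlas A A) A (fun p : G * G => p.1 * p.2)%g.
Hypothesis trans_smooth : forall g : G, smooth_map A A (fun p => g * p)%g.
Variable i0 : I.
Hypothesis i0P : cdom (A i0) 1%g.

Local Notation field := (lfield A i0).
Local Notation brk := (lie_bracket A i0).
Local Notation e0 := (cmap (A i0) 1%g).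

Let e0P : cimg (A i0) e0. Proof. exact: cimg_cmap. Qed.
Let dfield v i u (iu : cimg (A i) u) : is_diff u (field v i) (dif (field v i) u) :=
  is_diff_lfield Ac mul_smooth i0P v iu.

Lemma dif_lfieldD v w i u z : cimg (A i) u ->
  dif (field (v + w) i) u z = dif (field v i) u z + dif (field w i) u z.
Proof.
move=> iu; apply: (dif_val (df := fun z => dif (field v i) u z + dif (field w i) u z)).
have -> : field (v + w) i = fun u' => field v i u' + field w i u'.
  by apply/funext => u'; rewrite lfieldD.
by apply: is_diff_fD; exact: dfield.
Qed.

Lemma dif_lfieldZ a v i u z : cimg (A i) u ->
  dif (field (a *: v) i) u z = a *: dif (field v i) u z.
Proof.
move=> iu; apply: (dif_val (df := fun z => a *: dif (field v i) u z)).
have -> : field (a *: v) i = fun u' => a *: field v i u'.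
  by apply/funext => u'; rewrite lfieldZ.
by apply: is_diff_fZ; exact: dfield.
Qed.

Lemma lie_bracketC v w : brk v w = - brk w v.
Proof. by rewrite /lie_bracket /vbracket opprB. Qed.

Lemma lie_bracketDr v w w' : brk v (w + w') = brk v w + brk v w'.
Proof.
by rewrite /lie_bracket /vbracket dif_lfieldD// lfieldD linearD opprD addrACA.
Qed.

Lemma lie_bracketDl v v' w : brk (v + v') w = brk v w + brk v' w.
Proof. by rewrite lie_bracketC lie_bracketDr opprD -!lie_bracketC. Qed.

Lemma lie_bracketZr v a w : brk v (a *: w) = a *: brk v w.
Proof.
by rewrite /lie_bracket /vbracket dif_lfieldZ// lfieldZ linearZ scalerBr.
Qed.

Variable J : {linear E -> E}.
Hypothesis Jc : continuous J.
Hypothesis JK : forall v, J (J v) = - v.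
Hypothesis transJ : forall g i j u v, ltrans_dom A g i j u ->
  dif (ltrans A g i j) u (J v) = J (dif (ltrans A g i j) u v).

Lemma lfieldJ v i u : field (J v) i u = J (field v i u).
Proof.
have [iu|iu] := pselect (cimg (A i) u); last by rewrite !lfield_out// linear0.
by rewrite !lfieldE// transJ//; apply: ltrans_dom_e0 => //; exact: cdom_cinv.
Qed.

Lemma dif_lfieldJ v i u z : cimg (A i) u ->
  dif (field (J v) i) u z = J (dif (field v i) u z).
Proof.
move=> iu; apply: (dif_val (df := J \o dif (field v i) u)).
have -> : field (J v) i = J \o field v i.
  by apply/funext => u'; rewrite lfieldJ.
by apply: is_diff_comp; [exact: dfield|exact: is_diff_lin].
Qed.

Definition antiholo_ad (v w : E) : E := brk v w + J (brk (J v) w).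

(** This is the vanishing of the Nijenhuis tensor: [J] has constant coefficients in the charts and
    commutes with the differentials of translations, so it passes through the derivatives of
    invariant fields. *)
Lemma antiholo_adJ v w : antiholo_ad v (J w) = J (antiholo_ad v w).
Proof.
have cancel (x y z : E) : x - y + (- z - - y) = x - z.
  by rewrite opprK [- z + y]addrC addrA subrK.
rewrite /antiholo_ad (raddfD J) /lie_bracket /vbracket !dif_lfieldJ// !lfieldJ.
by rewrite !(raddfD J, raddfN J) /= !JK !cancel.
Qed.

Lemma antiholo_adDl v v' w :
  antiholo_ad (v + v') w = antiholo_ad v w + antiholo_ad v' w.
Proof. by rewrite /antiholo_ad (raddfD J v) !lie_bracketDl (raddfD J) addrACA. Qed.

(* [(X + i JX) Y = [X, Y] + J [JX, Y]]: the derivatives of [X] cancel. *)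
Lemma antiholo_deriv_lfield v y i u : cimg (A i) u ->
  dif (field y i) u (field v i u) + J (dif (field y i) u (J (field v i u)))
  = field (antiholo_ad v y) i u.
Proof.
move=> iu; rewrite /antiholo_ad lfieldD lfieldJ.
rewrite -!(vbracket_lfield fr Ac mul_smooth trans_smooth i0P)// /vbracket.
rewrite lfieldJ dif_lfieldJ// linearB /= JK opprK.
by rewrite [X in _ = _ + X]addrC addrA subrK.
Qed.

End LieBracketAlgebra.

(** * The operator [X + i J X] as a derivation *)

Section ComplexDerivation.
Context {R : realType} {E : normedModType R}.
Variable J : {linear E -> E}.

(* [d = D F(w) + i D F(J w)], where [D F] is the differential of [F] at [u]. *)
Definition dbar_at (u w : E) (F : E -> R[i]) (d : R[i]) : Prop :=
  exists dr di : E -> R,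
    [/\ is_diff u (fun v => complex.Re (F v)) dr,
        is_diff u (fun v => complex.Im (F v)) di
      & d = Complex (dr w - di (J w)) (di w + dr (J w))].

Variables u w : E.

Lemma dbar_cst c : dbar_at u w (fun=> c) 0.
Proof.
exists (fun=> 0), (fun=> 0); split; last by rewrite subr0 addr0.
  exact: (is_diff_cst (complex.Re c)).
exact: (is_diff_cst (complex.Im c)).
Qed.

Lemma dbarD F H d d' : dbar_at u w F d -> dbar_at u w H d' ->
  dbar_at u w (fun v => F v + H v) (d + d').
Proof.
move=> [r [i [Fr Fi ->]]] [r' [i' [Hr Hi ->]]].
exists (fun v => r v + r' v), (fun v => i v + i' v); split.
- rewrite (_ : (fun _ => _) = fun v => complex.Re (F v) + complex.Re (H v)).
    exact: is_diff_fD.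
  by apply/funext => v; case: (F v) (H v) => [? ?] [].
- rewrite (_ : (fun _ => _) = fun v => complex.Im (F v) + complex.Im (H v)).
    exact: is_diff_fD.
  by apply/funext => v; case: (F v) (H v) => [? ?] [].
- by apply/eqP; rewrite eq_complex /=; apply/andP; split; apply/eqP; ring.
Qed.

Lemma dbarM F H d d' : dbar_at u w F d -> dbar_at u w H d' ->
  dbar_at u w (fun v => F v * H v) (F u * d' + H u * d).
Proof.
move=> [r [i [Fr Fi ->]]] [r' [i' [Hr Hi ->]]].
have D1 := is_diff_fD (is_diff_fM Fr Hr) (is_diff_fN (is_diff_fM Fi Hi)).
have D2 := is_diff_fD (is_diff_fM Fr Hi) (is_diff_fM Fi Hr).
eexists; eexists; split.
- rewrite (_ : (fun _ => _) = (fun v => complex.Re (F v) * complex.Re (H v)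
     + - (complex.Im (F v) * complex.Im (H v)))); first exact: D1.
  by apply/funext => v; case: (F v) (H v) => [? ?] [].
- rewrite (_ : (fun _ => _) = (fun v => complex.Re (F v) * complex.Im (H v)
     + complex.Im (F v) * complex.Re (H v))); first exact: D2.
  by apply/funext => v; case: (F v) (H v) => [? ?] [].
- case: (F u) (H u) => [a b] [a' b'] /=.
  by apply/eqP; rewrite eq_complex /=; apply/andP; split; apply/eqP; ring.
Qed.

Lemma dbarX F t k : dbar_at u w F (t * F u) ->
  dbar_at u w (fun v => F v ^+ k) (k%:R * t * F u ^+ k).
Proof.
move=> Fd; elim: k => [|k IHk].
  by rewrite !mul0r; exact: (dbar_cst 1).
have := dbarM Fd IHk.
rewrite (_ : (fun v => F v * F v ^+ k) = (fun v => F v ^+ k.+1)); last first.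
  by apply/funext => v; rewrite exprS.
by congr dbar_at; rewrite exprS -natr1; ring.
Qed.

End ComplexDerivation.

(** * Complex coordinates and complex traces *)

Section ComplexCoordinates.
Context {R : realType} {E : normedModType R} {n : nat}.
Variables (fr : frame E (n + n)) (J : {linear E -> E}).
Hypothesis fr_reJ : forall k z, fr (lshift n k) (J z) = - fr (rshift n k) z.
Hypothesis fr_imJ : forall k z, fr (rshift n k) (J z) = fr (lshift n k) z.

Definition ccoord (k : 'I_n) (z : E) : R[i] :=
  Complex (fr (lshift n k) z) (fr (rshift n k) z).

Definition cvec (k : 'I_n) : E := fvec fr (lshift n k).

Lemma ccoordD k z z' : ccoord k (z + z') = ccoord k z + ccoord k z'.
Proof. by rewrite /ccoord !linearD. Qed.

Lemma ccoord0 k : ccoord k 0 = 0.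
Proof. by rewrite /ccoord !linear0. Qed.

Lemma ccoordZ k a z : ccoord k (a *: z) = Complex a 0 * ccoord k z.
Proof.
rewrite /ccoord !linearZ; apply/eqP; rewrite eq_complex /=.
by rewrite !mul0r subr0 addr0 !eqxx.
Qed.

Lemma ccoordJ k z : ccoord k (J z) = Complex 0 1 * ccoord k z.
Proof.
rewrite /ccoord fr_reJ fr_imJ; apply/eqP; rewrite eq_complex /=.
by rewrite !mul0r !mul1r sub0r add0r !eqxx.
Qed.

Lemma fvec_rshift k : fvec fr (rshift n k) = J (cvec k).
Proof.
apply: (fcoord_inj (f := fr)) => j; rewrite fcoord_vec -[j]splitK.
case: (fintype.split j) => l /=; rewrite ?fr_reJ ?fr_imJ fcoord_vec.
  by rewrite eq_lrshift eq_rlshift oppr0.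
by rewrite (inj_eq (@rshift_inj _ _)) (inj_eq (@lshift_inj _ _)).
Qed.

Lemma cvec_decomp z :
  z = \sum_k (fr (lshift n k) z *: cvec k + fr (rshift n k) z *: J (cvec k)).
Proof.
rewrite {1}(fvec_decomp fr z) big_split_ord big_split; congr (_ + _).
by apply: eq_bigr => k _; rewrite fvec_rshift.
Qed.

Lemma ccoord_vec k l : ccoord k (cvec l) = (l == k)%:R.
Proof.
rewrite /ccoord !fcoord_vec eq_rlshift (inj_eq (@lshift_inj _ _)) eq_sym.
by case: eqP.
Qed.

Section JLinear.
Variable S : E -> E.
Hypothesis SD : forall z z', S (z + z') = S z + S z'.
Hypothesis SZ : forall a z, S (a *: z) = a *: S z.
Hypothesis SJ : forall z, S (J z) = J (S z).

Lemma ccoord_Jlinear k z : ccoord k (S z) = \sum_l ccoord l z * ccoord k (S (cvec l)).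
Proof.
have S0 : S 0 = 0 by have := SZ 0 0; rewrite !scale0r.
rewrite {1}(cvec_decomp z) (big_morph S SD S0).
rewrite (big_morph (ccoord k) (ccoordD k) (ccoord0 k)).
apply: eq_bigr => l _; rewrite SD !SZ SJ ccoordD !ccoordZ ccoordJ mulrA -mulrDl.
congr (_ * _); apply/eqP; rewrite eq_complex /=.
by rewrite !(mul0r, mulr0, mulr1, subr0, addr0, add0r) !eqxx.
Qed.

Definition ctrace := \sum_k ccoord k (S (cvec k)).

(** The frame consists of the vectors [cvec k] and [J (cvec k)]; since [S] commutes with [J], both
    halves of the real diagonal have the same sum. *)
Lemma frame_trace_ctrace : frame_trace fr S = 2 * complex.Re ctrace.
Proof.
rewrite /frame_trace big_split_ord /ctrace.
rewrite (big_morph (@complex.Re R) (id1 := 0) (op1 := +%R)) //; last first.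
  by move=> [? ?] [].
rewrite -[2]/(1 + 1) mulrDl mul1r; congr (_ + _).
by apply: eq_bigr => k _; rewrite fvec_rshift SJ fr_imJ.
Qed.

End JLinear.

Lemma ctraceJ (S : E -> E) : ctrace (J \o S) = Complex 0 1 * ctrace S.
Proof. by rewrite /ctrace mulr_sumr; apply: eq_bigr => k _; rewrite ccoordJ. Qed.

(** Counterpart of [complex_jacobian] for an abstract frame. Rows hold the images of basis vectors,
    so composition multiplies matrices on the right. *)
Definition cjac (f : E -> E) (u : E) : R[i] :=
  \det (\matrix_(j < n, k < n) ccoord k (dif f u (cvec j))).

End ComplexCoordinates.

(** * Smooth complex valued functions *)

Section SmoothComplex.
Context {R : realType} {E : normedModType R}.

Definition csmooth (U : set E) (F : E -> R[i]) : Prop :=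
  smooth_on U (fun u => complex.Re (F u) : R^o) /\
  smooth_on U (fun u => complex.Im (F u) : R^o).

Variable U : set E.
Hypothesis oU : open U.

Lemma csmooth_cst c : csmooth U (fun=> c).
Proof. by split; exact: smooth_on_cst. Qed.

Lemma csmoothD F H : csmooth U F -> csmooth U H ->
  csmooth U (fun u => F u + H u).
Proof.
move=> [Fr Fi] [Hr Hi]; split.
  apply: (smooth_on_ext oU) (smooth_onD oU Fr Hr) => u _ /=.
  by case: (F u) (H u) => [? ?] [].
apply: (smooth_on_ext oU) (smooth_onD oU Fi Hi) => u _ /=.
by case: (F u) (H u) => [? ?] [].
Qed.

Lemma csmoothM F H : csmooth U F -> csmooth U H ->
  csmooth U (fun u => F u * H u).
Proof.
move=> [Fr Fi] [Hr Hi]; split.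
  have sN : smooth_on U (fun u => -1 * (complex.Im (F u) * complex.Im (H u)) : R^o).
    by apply: (smooth_onM oU); [exact: smooth_on_cst|exact: smooth_onM].
  apply: (smooth_on_ext oU) (smooth_onD oU (smooth_onM oU Fr Hr) sN) => u _ /=.
  by rewrite mulN1r; case: (F u) (H u) => [? ?] [].
apply: (smooth_on_ext oU)
  (smooth_onD oU (smooth_onM oU Fr Hi) (smooth_onM oU Fi Hr)) => u _ /=.
by case: (F u) (H u) => [? ?] [].
Qed.

Lemma csmoothX F k : csmooth U F -> csmooth U (fun u => F u ^+ k).
Proof.
move=> Fs; elim: k => [|k IHk]; first exact: (csmooth_cst 1).
rewrite (_ : (fun _ => _) = fun u => F u * F u ^+ k); first exact: csmoothM.
by apply/funext => u; rewrite exprS.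
Qed.

Lemma csmooth_det m (M : E -> 'M[R[i]]_m) :
  (forall i j, csmooth U (fun u => M u i j)) -> csmooth U (fun u => \det (M u)).
Proof.
move=> Ms; apply: (@der_det _ _ 0 (fun F _ => csmooth U F)
  csmooth_cst _ _ m M 0) => [F H _ _|F H _ _|]; [exact: csmoothD|exact: csmoothM|].
exact: Ms.
Qed.

End SmoothComplex.

(** * The volume of the invariant frame *)

Section InvariantVolume.
Context {R : realType} {E : normedModType R} {n : nat}.
Variables (fr : frame E (n + n)) (J : {linear E -> E}).
Hypothesis fr_reJ : forall k z, fr (lshift n k) (J z) = - fr (rshift n k) z.
Hypothesis fr_imJ : forall k z, fr (rshift n k) (J z) = fr (lshift n k) z.
Hypothesis Jc : continuous J.
Hypothesis JK : forall v, J (J v) = - v.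
Context {G : topGroupType} {I : Type}.
Variable A : I -> chart E G.
Hypothesis Ac : forall i, is_chart (A i).
Hypothesis mul_smooth :
  smooth_map (prod_atlas A A) A (fun p : G * G => p.1 * p.2)%g.
Hypothesis trans_smooth : forall g : G, smooth_map A A (fun p => g * p)%g.
Variable i0 : I.
Hypothesis i0P : cdom (A i0) 1%g.
Hypothesis transJ : forall g i j u v, ltrans_dom A g i j u ->
  dif (ltrans A g i j) u (J v) = J (dif (ltrans A g i j) u v).

Local Notation field := (lfield A i0).
Local Notation brk := (lie_bracket A i0).
Local Notation T := (antiholo_ad A i0 J).
Local Notation cc := (ccoord fr).
Local Notation beta := (cvec fr).

Let ccoord_field k i u z :
  cc k (field z i u) = \sum_l cc l z * cc k (field (beta l) i u).
Proof.
apply: (ccoord_Jlinear fr_reJ fr_imJ (S := fun z => field z i u)).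
- by move=> *; rewrite lfieldD.
- by move=> *; rewrite lfieldZ.
- by move=> *; rewrite (lfieldJ Ac i0P transJ).
Qed.

Definition volmx i u : 'M[R[i]]_n := \matrix_(j, k) cc k (field (beta j) i u).
(** The value of [dz_1 /\ ... /\ dz_n] on the left invariant frame. Multiplying the coefficient of a
    section of [K^k] by [vol ^ k] reads the section in the invariant trivialization. *)
Definition vol i u : R[i] := \det (volmx i u).

Definition adtrace (v : E) : R[i] := ctrace fr (T v).

Lemma adtraceD v w : adtrace (v + w) = adtrace v + adtrace w.
Proof.
rewrite /adtrace /ctrace -big_split; apply: eq_bigr => k _.
by rewrite (antiholo_adDl Ac mul_smooth i0P) ccoordD.
Qed.

Lemma adtrace_sum_eq0 m (z : 'I_m -> E) :
  (forall l, complex.Im (adtrace (z l)) = 0) ->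
  complex.Im (adtrace (\sum_l z l)) = 0.
Proof.
move=> z0; elim/big_ind: _ => // [|v w v0 w0].
  have := adtraceD 0 0; rewrite addr0 => /(congr1 (@complex.Im R)).
  by case: (adtrace 0) => a b /=; lra.
rewrite adtraceD; move: v0 w0.
by case: (adtrace v) (adtrace w) => [? ?] [? ?] /= -> ->; rewrite addr0.
Qed.

(** By [antiholo_deriv_lfield] the operator sends row [j] of [volmx] to the invariant field of
    [T v (beta j)], a complex combination of the rows whose coefficients form the matrix of [T v].
    Liouville's formula concludes. *)
Lemma vol_dbar v i u : cimg (A i) u ->
  dbar_at J u (field v i u) (vol i) (adtrace v * vol i u).
Proof.
move=> iu.
pose S : 'M[R[i]]_n := \matrix_(j, l) cc l (T v (beta j)).
have -> : adtrace v = \tr S by apply: eq_bigr => j _; rewrite mxE.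
apply: (der_det_row (der := dbar_at J u (field v i u))) => [c|F H d d'|F H d d'|j k].
- exact: dbar_cst.
- exact: dbarD.
- exact: dbarM.
have -> : (S *m volmx i u) j k = cc k (field (T v (beta j)) i u).
  by rewrite ccoord_field mxE; apply: eq_bigr => l _; rewrite !mxE.
have Y := is_diff_lfield Ac mul_smooth i0P (beta j) iu.
have D N : is_diff u (fr N \o field (beta j) i) (fr N \o dif (field (beta j) i) u).
  by apply: is_diff_comp Y _; apply: is_diff_lin; exact: fcoord_continuous.
exists (fr (lshift n k) \o dif (field (beta j) i) u).
exists (fr (rshift n k) \o dif (field (beta j) i) u); split.
- rewrite (_ : (fun _ => _) = fr (lshift n k) \o field (beta j) i); first exact: D.
  by apply/funext => z; rewrite mxE.
- rewrite (_ : (fun _ => _) = fr (rshift n k) \o field (beta j) i); first exact: D.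
  by apply/funext => z; rewrite mxE.
rewrite -(antiholo_deriv_lfield fr Ac mul_smooth trans_smooth i0P Jc JK transJ)//.
by rewrite /ccoord !linearD /= fr_reJ fr_imJ.
Qed.

Lemma vol_smooth i : csmooth (cimg (A i)) (vol i).
Proof.
have oi := open_cimg (Ac i).
apply: (csmooth_det oi) => j k; split.
- apply: (smooth_on_ext oi) (smooth_on_linear oi
    (fcoord_continuous (fr := fr) (j := lshift n k))
    (lfield_smooth Ac mul_smooth i0P (beta j) i)) => u _.
  by rewrite mxE.
- apply: (smooth_on_ext oi) (smooth_on_linear oi
    (fcoord_continuous (fr := fr) (j := rshift n k))
    (lfield_smooth Ac mul_smooth i0P (beta j) i)) => u _.
  by rewrite mxE.
Qed.

Let cjacM g i j u z k : ltrans_dom A g i j u ->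
  cc k (dif (ltrans A g i j) u z) =
  \sum_l cc l z * cc k (dif (ltrans A g i j) u (beta l)).
Proof.
move=> Du; apply: (ccoord_Jlinear fr_reJ fr_imJ (S := dif (ltrans A g i j) u)).
- by move=> *; rewrite linearD.
- by move=> *; rewrite linearZ.
- by move=> *; rewrite transJ.
Qed.

Lemma vol_ltrans g i j u : ltrans_dom A g i j u ->
  vol j (ltrans A g i j u) = vol i u * cjac fr (ltrans A g i j) u.
Proof.
move=> Du; rewrite /vol /cjac -det_mulmx; congr (\det _).
apply/matrixP => a b; rewrite !mxE (lfield_ltrans Ac trans_smooth i0P)// cjacM//.
by apply: eq_bigr => l _; rewrite !mxE.
Qed.

(** The differential of the translation back to the identity inverts [volmx]. *)
Lemma vol_neq0 i u : cimg (A i) u -> vol i u != 0.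
Proof.
move=> iu; pose g := (cinv (A i) u)^-1%g.
have Du : ltrans_dom A g i i0 u by split=> //; rewrite mulVg.
have M1 : volmx i u *m (\matrix_(j, k) cc k (dif (ltrans A g i i0) u (beta j))) = 1%:M.
  apply/matrixP => a b; rewrite !mxE.
  rewrite -(ccoord_vec fr b a).
  rewrite [in RHS](lfield_inv Ac trans_smooth i0P (beta a) iu) cjacM//.
  by apply: eq_bigr => l _; rewrite !mxE.
apply/eqP => v0; have := congr1 determinant M1.
by rewrite det_mulmx det1 -/(vol i u) v0 mul0r => /esym/eqP; rewrite oner_eq0.
Qed.

(** The difference of the two sides is the real trace of [J T x], twice the real part of
    [i tau x]. *)
Lemma adtrace_eq0 x : complex.Im (adtrace x) = 0 ->
  frame_trace fr (fun z => J (brk x z)) = frame_trace fr (brk (J x)).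
Proof.
move=> t0; apply/eqP; rewrite -subr_eq0.
have -> : frame_trace fr (fun z => J (brk x z)) - frame_trace fr (brk (J x))
    = frame_trace fr (J \o T x).
  rewrite /frame_trace -sumrB; apply: eq_bigr => j _.
  set z := fvec fr j; change ((J \o T x) z) with (J (brk x z + J (brk (J x) z))).
  have JE a b : J (a + J b) = J a - b by rewrite linearD JK.
  by rewrite JE [RHS]raddfB.
rewrite (frame_trace_ctrace fr_reJ fr_imJ); last first.
  by move=> z; rewrite /= (antiholo_adJ Ac mul_smooth i0P Jc JK transJ).
rewrite ctraceJ //; move: t0; rewrite -/(adtrace x).
by case: (adtrace x) => a b /= ->; rewrite !mul0r mulr0 subr0 mulr0.
Qed.

End InvariantVolume.

(** * The Hessian at an extremum *)

Section Extremum.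
Context {R : realType} {E : normedModType R} {n : nat}.
Variables (fr : frame E (n + n)) (J : {linear E -> E}).
Hypothesis fr_reJ : forall k z, fr (lshift n k) (J z) = - fr (rshift n k) z.
Hypothesis fr_imJ : forall k z, fr (rshift n k) (J z) = fr (lshift n k) z.
Hypothesis Jc : continuous J.
Hypothesis JK : forall v, J (J v) = - v.
Context {G : topGroupType} {I : Type}.
Variable A : I -> chart E G.
Hypothesis Ac : forall i, is_chart (A i).
Hypothesis mul_smooth :
  smooth_map (prod_atlas A A) A (fun p : G * G => p.1 * p.2)%g.
Hypothesis trans_smooth : forall g : G, smooth_map A A (fun p => g * p)%g.
Variable i0 : I.
Hypothesis i0P : cdom (A i0) 1%g.
Hypothesis transJ : forall g i j u v, ltrans_dom A g i j u ->
  dif (ltrans A g i j) u (J v) = J (dif (ltrans A g i j) u v).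

Local Notation field := (lfield A i0).
Local Notation brk := (lie_bracket A i0).
Local Notation adtr := (adtrace fr J A i0).

Definition cnorm2 (z : R[i]) : R :=
  complex.Re z * complex.Re z + complex.Im z * complex.Im z.

Lemma cnorm2M z w : cnorm2 (z * w) = cnorm2 z * cnorm2 w.
Proof. by case: z w => [a b] [c d]; rewrite /cnorm2 /=; ring. Qed.

Lemma cnorm2_ge0 z : 0 <= cnorm2 z.
Proof. by rewrite addr_ge0// -expr2 sqr_ge0. Qed.

(** Dividing [F] by its value at [u0] preserves the linear equation and the extremum and gives the
    normalization [P = 1], [Q = 0]; the form [H] is then the half Hessian of the squared modulus. *)
Lemma extremum_form (mx : bool) k i (V : set E) (F : E -> R[i]) u0 :
  open V -> V `<=` cimg (A i) -> csmooth V F ->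
  (forall u v, V u ->
     dbar_at J u (field v i u) F (k%:R * adtr v * F u)) ->
  V u0 -> F u0 != 0 ->
  (forall u, V u -> if mx then cnorm2 (F u) <= cnorm2 (F u0)
                    else cnorm2 (F u0) <= cnorm2 (F u)) ->
  exists H : E -> E -> R,
    [/\ forall v w, H v w = H w v,
        forall v w, H v (- w) = - H v w,
        forall v, if mx then H v v <= 0 else 0 <= H v v
      & forall x y, complex.Im (k%:R * adtr (brk x y)) =
          H (field y i u0) (J (field x i u0))
          - H (field x i u0) (J (field y i u0))].
Proof.
move=> oV Vi Fs Fd Vu0 F0 ext.
pose phi u := (F u0)^-1 * F u.
pose P u : R := complex.Re (phi u); pose Q u : R := complex.Im (phi u).
have [Ps Qs] : csmooth V phi by apply: csmoothM => //; exact: csmooth_cst.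
have nearV : \forall u \near u0, V u by apply: open_nbhs_nbhs.
have P1 : P u0 = 1 by rewrite /P /phi mulVf.
have Q0 : Q u0 = 0 by rewrite /Q /phi mulVf.
have Pd u : V u -> is_diff u P (dif P u).
  by move=> Vu; apply: is_diff_dif; exact: (smooth_on_differentiable Ps).
have Qd u : V u -> is_diff u Q (dif Q u).
  by move=> Vu; apply: is_diff_dif; exact: (smooth_on_differentiable Qs).
have dP : \forall u \near u0, differentiable P u.
  by near=> u; apply: is_diffP; apply: Pd; near: u.
have dQ : \forall u \near u0, differentiable Q u.
  by near=> u; apply: is_diffP; apply: Qd; near: u.
have ddP v : differentiable (fun u => dif P u v) u0.
  exact: (smooth_on_differentiable (smooth_on_dif v Ps)).
have ddQ v : differentiable (fun u => dif Q u v) u0.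
  exact: (smooth_on_differentiable (smooth_on_dif v Qs)).
have phid u v : V u -> dbar_at J u (field v i u) phi (k%:R * adtr v * phi u).
  move=> Vu; have := dbarM (dbar_cst J u (field v i u) (F u0)^-1) (Fd u v Vu).
  by rewrite mulr0 addr0 /phi; congr dbar_at; rewrite mulrCA.
have eqs u v : V u -> let t := k%:R * adtr v in
    dif P u (field v i u) - dif Q u (J (field v i u))
      = complex.Re t * P u - complex.Im t * Q u /\
    dif Q u (field v i u) + dif P u (J (field v i u))
      = complex.Re t * Q u + complex.Im t * P u.
  move=> Vu t; have [r [s [/dif_val rE /dif_val sE tE]]] := phid u v Vu.
  rewrite -/t in tE; rewrite !rE !sE /P /Q.
  by case: t (phi u) tE => [a b] [c d] [-> ->] /=; split=> //; rewrite addrC.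
have sq u : P u * P u + Q u * Q u = cnorm2 (F u0)^-1 * cnorm2 (F u).
  by rewrite -cnorm2M.
have extP : if mx
    then \forall u \near u0, P u * P u + Q u * Q u <= P u0 * P u0 + Q u0 * Q u0
    else \forall u \near u0, P u0 * P u0 + Q u0 * Q u0 <= P u * P u + Q u * Q u.
  by case: mx ext => ext; near=> u; rewrite !sq ler_wpM2l ?cnorm2_ge0//;
    apply: ext; near: u.
have P'0 v : dif P u0 v = 0.
  apply: (critical_real_part dP dQ P1 Q0).
  by case: mx extP {ext} => ?; [left|right].
have hs v w : half_hessian P Q u0 v w = half_hessian P Q u0 w v.
  exact: half_hessian_sym.
exists (half_hessian P Q u0); split=> //.
- by move=> v w; rewrite !(hs v) /half_hessian !linearN mulNr opprD.
- move=> v; case: mx extP {ext} => ext.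
    exact: (half_hessian_max dP dQ ddP ddQ P1 Q0).
  exact: (half_hessian_min dP dQ ddP ddQ P1 Q0).
move=> x y.
have iu0 := Vi _ Vu0.
(* With [dif P u0 = 0] the equations at [u0] say that [dif Q] reads off [Im (k tau)]. Evaluated on a
   bracket, [dif Q] is therefore the quantity sought. *)
have b z : dif Q u0 (field z i u0) = complex.Im (k%:R * adtr z).
  have [_] := eqs u0 z Vu0.
  by rewrite P'0 P1 Q0 mulr0 mulr1 addr0 add0r.
have a z : - dif Q u0 (J (field z i u0)) = complex.Re (k%:R * adtr z).
  have [+ _] := eqs u0 z Vu0.
  by rewrite P'0 P1 Q0 mulr0 mulr1 subr0 sub0r.
have fd z : differentiable (field z i) u0.
  exact: (is_diffP (is_diff_lfield Ac mul_smooth i0P z iu0)).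
have := @critical_bracket _ _ _ fr P Q u0 dP dQ ddP ddQ
  (field x i) (field (J x) i) (field y i) (field (J y) i)
  (complex.Re (k%:R * adtr x)) (complex.Im (k%:R * adtr x))
  (complex.Re (k%:R * adtr y)) (complex.Im (k%:R * adtr y)) P'0.
rewrite !(lfieldJ Ac i0P transJ) !a => H.
rewrite -b -(vbracket_lfield fr Ac mul_smooth trans_smooth i0P)// /vbracket.
apply: H => //.
- near=> u; rewrite (lfieldJ Ac i0P transJ).
  have Vu : V u by near: u; exact: nearV.
  by have [_ ->] := eqs u x Vu.
- near=> u; rewrite (lfieldJ Ac i0P transJ).
  have Vu : V u by near: u; exact: nearV.
  by have [_ ->] := eqs u y Vu.
Unshelve. all: by end_near. Qed.

End Extremum.

(** * The quotient by a lattice *)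

Section CosetSpace.
Context {G : topGroupType}.
Variable Gamma : groupClosed G.
Hypothesis mul_continuous : continuous (fun p : G * G => p.1 * p.2)%g.
Hypothesis inv_continuous : continuous (fun p : G => p^-1)%g.

Lemma coset_projP (p q : G) :
  reflect (coset_proj Gamma p = coset_proj Gamma q) ((p * q^-1)%g \in Gamma).
Proof. exact: (@eqquotP _ (coset_equiv Gamma) _ p q). Qed.

Lemma coset_projM (g p : G) : g \in Gamma ->
  coset_proj Gamma (g * p)%g = coset_proj Gamma p.
Proof. by move=> gG; apply/coset_projP; rewrite mulgK. Qed.

Lemma coset_projE (p q : G) : coset_proj Gamma p = coset_proj Gamma q ->
  exists2 g, g \in Gamma & p = (g * q)%g.
Proof. by move=> /coset_projP pq; exists (p * q^-1)%g; rewrite ?mulgVK. Qed.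

Lemma coset_proj_surj (x : coset_space Gamma) : exists p, coset_proj Gamma p = x.
Proof. by exists (repr x); rewrite /coset_proj reprK. Qed.

Lemma mul_continuous_at (p q : G) (W : set G) : nbhs (p * q)%g W ->
  exists U V, [/\ nbhs p U, nbhs q V & forall a b, U a -> V b -> W (a * b)%g].
Proof.
move=> /(@mul_continuous (p, q))[[U V] /= [Up Vq] UV].
by exists U, V; split=> // a b Ua Vb; exact: (UV (a, b)).
Qed.

Lemma ltrans_continuous (g : G) : continuous (fun p => g * p)%g.
Proof.
move=> p W /mul_continuous_at[U [V [Ug Vp UV]]].
by apply: filterS Vp => b Vb; apply: UV => //; exact: nbhs_singleton.
Qed.

Lemma open_coset_image (U : set G) : open U -> open (coset_proj Gamma @` U).
Proof.
move=> oU.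
have pre : coset_proj Gamma @^-1` (coset_proj Gamma @` U)
    = \bigcup_(g in [set` Gamma]) (fun p => g * p)%g @^-1` U.
  apply/seteqP; split=> p /=.
    by move=> [q Uq /coset_projE[g gG qE]]; exists g => //=; rewrite -qE.
  by move=> [g /= gG Up]; exists (g * p)%g => //; exact: coset_projM.
rewrite /open /= /quotient_open [X in open X]pre; apply: bigcup_open => g _.
by apply: open_comp => // p _; exact: ltrans_continuous.
Qed.

Hypothesis discrete : isolated [set` Gamma] = [set` Gamma].

Lemma discrete_nbhs : exists W : set G,
  [/\ open W, W 1%g & forall g, g \in Gamma -> W g -> g = 1%g].
Proof.
have : isolated [set` Gamma] 1%g by rewrite discrete /=; exact: gpred1.
move=> [_ [V + VG]]; rewrite nbhsE => -[W [oW W1] WV].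
exists W; split=> // g gG Wg.
have : (V `&` [set` Gamma]) g by split=> //; exact: WV.
by rewrite VG.
Qed.

(** Take [B] with [B B^-1] inside a neighbourhood of 1 that meets [Gamma] only in 1. *)
Lemma coset_proj_injective_near (p : G) : exists B : set G,
  [/\ open B, B p & set_inj B (coset_proj Gamma)].
Proof.
have [W [oW W1 Winj]] := discrete_nbhs.
have : nbhs (p * p^-1)%g W by rewrite mulgV; exact: open_nbhs_nbhs.
move=> /mul_continuous_at[U [V [Up Vp UV]]].
have Vp' := inv_continuous Vp.
have : nbhs p (U `&` (fun q => q^-1)%g @^-1` V) by exact: filterI.
rewrite nbhsE => -[B [oB Bp] BUV].
exists B; split=> // a b /[!inE] /BUV[Ua _] /BUV[_ Vb] /coset_projP ab.
have /(Winj _ ab) ab1 : W (a * b^-1)%g by exact: UV.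
by rewrite -[a](mulgVK b) ab1 mul1g.
Qed.

Lemma invariant_extremum (R : realType) (f : G -> R) :
  compact [set: coset_space Gamma] ->
  continuous f -> (forall g p, g \in Gamma -> f (g * p)%g = f p) ->
  forall mx : bool, exists p, forall q, if mx then f q <= f p else f p <= f q.
Proof.
move=> cpt fc finv mx.
pose F : coset_space Gamma -> R := f \o repr.
have FE p : F (coset_proj Gamma p) = f p.
  have [g gG E] : exists2 g, g \in Gamma & repr (coset_proj Gamma p) = (g * p)%g.
    by apply: coset_projE; rewrite /coset_proj reprK.
  by rewrite /F /= E finv.
have Fc : continuous F.
  apply/quotient_continuous; rewrite (_ : _ \o _ = f) //.
  by apply/funext => p; exact: FE.
have ne : [set: coset_space Gamma] !=set0 by exists (coset_proj Gamma 1%g).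
have Fw : {within [set: coset_space Gamma], continuous F}.
  exact: continuous_subspaceT.
case: mx.
  have [c _ cP] := compact_EVT_max ne cpt Fw.
  have [p pE] := coset_proj_surj c; exists p => q.
  by rewrite -!FE pE cP// inE.
have [c _ cP] := compact_EVT_min ne cpt Fw.
have [p pE] := coset_proj_surj c; exists p => q.
by rewrite -!FE pE cP// inE.
Qed.

End CosetSpace.

(** * From a section of [K^k] to the trace identity *)

Section CanonicalSection.
Context {R : realType} {E : normedModType R} {n : nat}.
Variables (fr : frame E (n + n)) (J : {linear E -> E}).
Hypothesis fr_reJ : forall k z, fr (lshift n k) (J z) = - fr (rshift n k) z.
Hypothesis fr_imJ : forall k z, fr (rshift n k) (J z) = fr (lshift n k) z.
Hypothesis Jc : continuous J.
Hypothesis JK : forall v, J (J v) = - v.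
Context {G : topGroupType} {I : Type}.
Variable A : I -> chart E G.
Hypothesis Ac : forall i, is_chart (A i).
Hypothesis mul_smooth :
  smooth_map (prod_atlas A A) A (fun p : G * G => p.1 * p.2)%g.
Hypothesis trans_smooth : forall g : G, smooth_map A A (fun p => g * p)%g.
Variable i0 : I.
Hypothesis i0P : cdom (A i0) 1%g.
Hypothesis transJ : forall g i j u v, ltrans_dom A g i j u ->
  dif (ltrans A g i j) u (J v) = J (dif (ltrans A g i j) u v).
Variable Gamma : groupClosed G.
Hypothesis cpt : compact [set: coset_space Gamma].

Variables (K : Type) (ci : K -> I) (cO : K -> set G) (k : nat).
Variable h : K -> E -> R[i].
Hypothesis oO : forall c, open (cO c).
Hypothesis Oi : forall c, cO c `<=` cdom (A (ci c)).
Hypothesis Ocov : forall p, exists c, cO c p.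
Let V c := cmap (A (ci c)) @` cO c.
Hypothesis h_smooth : forall c, csmooth (V c) (h c).
Hypothesis h_dbar : forall c u w, V c u -> dbar_at J u w (h c) 0.
Hypothesis h_neq0 : forall c u, V c u -> h c u != 0.
Hypothesis h_trans : forall c d g p, g \in Gamma -> cO c p -> cO d (g * p)%g ->
  h c (cmap (A (ci c)) p)
  = cjac fr (ltrans A g (ci c) (ci d)) (cmap (A (ci c)) p) ^+ k
    * h d (cmap (A (ci d)) (g * p)%g).

Local Notation brk := (lie_bracket A i0).
Local Notation adtr := (adtrace fr J A i0).

Let VE c : V c = cimg (A (ci c)) `&` cinv (A (ci c)) @^-1` cO c.
Proof. by rewrite /V chart_imageE//; exact: Oi. Qed.

Let oV c : open (V c).
Proof. by apply: open_chart_image => //; exact: Oi. Qed.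

(* The section [h], read in the left invariant trivialization of the canonical
   bundle: a function on the quotient, although not a holomorphic one. *)
Let F c u : R[i] := h c u * vol fr A i0 (ci c) u ^+ k.

(** The powers of the Jacobian in the transition rules of [h] and of [vol] cancel. *)
Let F_inv c d g p : g \in Gamma -> cO c p -> cO d (g * p)%g ->
  F c (cmap (A (ci c)) p) = F d (cmap (A (ci d)) (g * p)%g).
Proof.
move=> gG cp dgp.
have Du : ltrans_dom A g (ci c) (ci d) (cmap (A (ci c)) p).
  have [ip dp] := (Oi cp, Oi dgp); split; first exact: cimg_cmap.
  by rewrite cmapK.
have LE : ltrans A g (ci c) (ci d) (cmap (A (ci c)) p) = cmap (A (ci d)) (g * p)%g.
  by rewrite /ltrans /local_expr cmapK//; exact: Oi.
rewrite /F (h_trans gG cp dgp) -LE.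
rewrite (vol_ltrans fr_reJ fr_imJ Ac trans_smooth i0P transJ Du) exprMn; ring.
Qed.

Let F_smooth c : csmooth (V c) (F c).
Proof.
apply: csmoothM => //; apply: csmoothX => //.
have [v1 v2] := vol_smooth fr Ac mul_smooth i0P (ci c).
by split; [apply: smooth_on_sub v1|apply: smooth_on_sub v2]; rewrite VE => u [].
Qed.

Let F_dbar c u v : V c u ->
  dbar_at J u (lfield A i0 v (ci c) u) (F c) (k%:R * adtr v * F c u).
Proof.
move=> Vu; have iu : cimg (A (ci c)) u by move: Vu; rewrite VE => -[].
have D := vol_dbar fr_reJ fr_imJ Jc JK Ac mul_smooth trans_smooth i0P transJ v iu.
have := dbarM (h_dbar (lfield A i0 v (ci c) u) Vu) (dbarX k D).
by rewrite mulr0 addr0 /F; congr dbar_at; ring.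
Qed.

Let F_neq0 c u : V c u -> F c u != 0.
Proof.
move=> Vu; have iu : cimg (A (ci c)) u by move: Vu; rewrite VE => -[].
rewrite mulf_neq0 ?h_neq0// expf_neq0//.
exact: (vol_neq0 fr_reJ fr_imJ Ac trans_smooth i0P transJ iu).
Qed.

Let cpick := choice Ocov.
Let kap := projT1 cpick.
Let kapP p : cO (kap p) p := projT2 cpick p.

(** The piece containing [p] is an arbitrary choice; [F_inv] at [g = 1] shows that the value does
    not depend on it. *)
Let f p : R := cnorm2 (F (kap p) (cmap (A (ci (kap p))) p)).

Let fE c p : cO c p -> f p = cnorm2 (F c (cmap (A (ci c)) p)).
Proof.
move=> cp; have := @F_inv (kap p) c 1%g p (gpred1 : 1%g \in Gamma) (kapP p).
by rewrite mul1g /f => ->.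
Qed.

Let f_inv g p : g \in Gamma -> f (g * p)%g = f p.
Proof. by move=> gG; rewrite /f -(F_inv gG (kapP p)). Qed.

Let f_continuous : continuous f.
Proof.
move=> p; set c := kap p; have cp : cO c p := kapP p.
have Vp : V c (cmap (A (ci c)) p) by exists p.
have [Fr Fi] := F_smooth c.
have rc := Fr 0%N _ Vp; have imc := Fi 0%N _ Vp.
have mc := chart_continuous_at (Ac (ci c)) (Oi cp).
have C1 : {for p, continuous ((fun u => complex.Re (F c u)) \o cmap (A (ci c)))}.
  exact: continuous_comp.
have C2 : {for p, continuous ((fun u => complex.Im (F c u)) \o cmap (A (ci c)))}.
  exact: continuous_comp.
have nc : \forall q \near p, cO c q by apply: open_nbhs_nbhs.
change (f q @[q --> p] --> f p); rewrite (fE cp).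
apply: cvg_trans (cvgD (cvgM C1 C1) (cvgM C2 C2)).
by apply: near_eq_cvg; near=> q; rewrite /= (@fE c)//; near: q.
Unshelve. all: by end_near. Qed.

Lemma extremum_exists (mx : bool) : exists i u (H : E -> E -> R),
  [/\ cimg (A i) u, forall v w, H v w = H w v,
      forall v w, H v (- w) = - H v w,
      forall v, if mx then H v v <= 0 else 0 <= H v v
    & forall x y, complex.Im (k%:R * adtr (brk x y)) =
        H (lfield A i0 y i u) (J (lfield A i0 x i u))
        - H (lfield A i0 x i u) (J (lfield A i0 y i u))].
Proof.
have [p pP] := invariant_extremum cpt f_continuous f_inv mx.
set c := kap p; have cp : cO c p := kapP p.
pose u := cmap (A (ci c)) p; have Vu : V c u by exists p.
have ext u' : V c u' -> if mx then cnorm2 (F c u') <= cnorm2 (F c u)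
    else cnorm2 (F c u) <= cnorm2 (F c u').
  by move=> [q cq <-]; have := pP q; rewrite (fE cq) (fE cp).
have Vi : V c `<=` cimg (A (ci c)) by rewrite VE => ? [].
have [H [Hs HN Hle HE]] := extremum_form Ac mul_smooth trans_smooth
  i0P transJ (@oV c) Vi (@F_smooth c) (@F_dbar c) Vu (F_neq0 Vu) ext.
by exists (ci c), u, H; split=> //; exact: Vi.
Qed.

Lemma adtrace_bracket_eq0 x y : complex.Im (k%:R * adtr (brk x y)) = 0.
Proof.
have [i [u [H [iu Hs HN Hle HE]]]] := extremum_exists true.
have [i' [u' [H' [iu' H's H'N Hge H'E]]]] := extremum_exists false.
pose b z := complex.Im (k%:R * adtr z).
have bD z w : b (z + w) = b z + b w.
  rewrite /b (adtraceD _ _ Ac mul_smooth i0P) mulrDr.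
  by case: (_ * _) (_ * _) => [? ?] [].
apply: (alternating_eq0 JK (J' := J) (val := fun z => lfield A i0 z i u)
   (val' := fun z => lfield A i0 z i' u') (beta := fun x y => b (brk x y))
   JK _ _ _ _ Hs HN Hle Hge H'N HE H'E).
- by move=> z; rewrite (lfieldJ Ac i0P transJ).
- by move=> z; rewrite (lfieldJ Ac i0P transJ).
- by move=> z w t; rewrite (lie_bracketDl Ac mul_smooth i0P).
- by move=> z w t; rewrite (lie_bracketDr Ac mul_smooth i0P).
Qed.

End CanonicalSection.

(** * Counting cells in the linear image of a cube *)

Section LinearCodes.
Context {R : realType}.

Definition cube n (w : 'rV[R]_n) : Prop := forall j, `|w 0 j| <= 1.

(* The image of the cube under [A] is covered by at most [mu] sets of
   diameter at most [eta]: the fibers of [code]. *)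
Definition cube_code n (A : 'M[R]_n) (mu eta : R) : Prop :=
  exists (C : finType) (code : 'rV[R]_n -> C), #|C|%:R <= mu /\
    forall w w', cube w -> cube w' -> code w = code w' ->
      forall j, `|((w - w') *m A) 0 j| <= eta.

Lemma code_repr n (C : Type) (code : 'rV[R]_n -> C) : exists r : C -> 'rV[R]_n,
  forall w, cube w -> cube (r (code w)) /\ code (r (code w)) = code w.
Proof.
have ex c : exists z, forall w, cube w -> code w = c -> cube z /\ code z = c.
  have [[z [zc zE]]|no] := pselect (exists z, cube z /\ code z = c).
    by exists z.
  by exists 0 => w wc wE; case: no; exists w.
have [r rP] := choice ex.
by exists r => w wc; exact: rP.
Qed.

(** What the code of [A] leaves undetermined lies, after division by [eta], in the cube again, so
    the code of [B] applies to it. Counts and diameters multiply. *)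
Lemma cube_codeM n (A B : 'M[R]_n) mu mu' eta eta' : 0 < eta ->
  cube_code A mu eta -> cube_code B mu' eta' ->
  cube_code (A *m B) (mu * mu') (eta * eta').
Proof.
move=> eta0 [C [a [Cmu aP]]] [D [b [Dmu bP]]].
have [r rP] := code_repr a.
pose v w := eta^-1 *: ((w - r (a w)) *m A).
have vc w : cube w -> cube (v w).
  move=> wc j; have [rc rE] := rP w wc.
  rewrite mxE normrM gtr0_norm ?invr_gt0// mulrC ler_pdivrMr// mul1r.
  by apply: aP.
exists (C * D)%type, (fun w => (a w, b (v w))); split.
  by rewrite card_prod natrM ler_pM.
move=> w w' wc w'c [aE bE] j.
have := bP _ _ (vc w wc) (vc w' w'c) bE j.
have -> : v w - v w' = eta^-1 *: ((w - w') *m A).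
  rewrite /v aE -scalerBr -mulmxBl; congr (_ *: (_ *m _)).
  by rewrite opprB addrA subrK.
rewrite -scalemxAl mulmxA mxE normrM gtr0_norm ?invr_gt0//.
by rewrite mulrC ler_pdivrMr// mulrC.
Qed.

Lemma cube_code_perml n (s : 'S_n) (A : 'M[R]_n) mu eta :
  cube_code A mu eta -> cube_code (perm_mx s *m A) mu eta.
Proof.
move=> [C [a [Cmu aP]]]; exists C, (fun w => a (w *m perm_mx s)); split=> //.
have cP w : cube w -> cube (w *m perm_mx s).
  by move=> wc j; rewrite -[s]invgK -col_permE mxE.
move=> w w' wc w'c E j; rewrite mulmxA mulmxBl.
by apply: aP => //; exact: cP.
Qed.

Lemma cube_code_permr n (s : 'S_n) (A : 'M[R]_n) mu eta :
  cube_code A mu eta -> cube_code (A *m perm_mx s) mu eta.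
Proof.
move=> [C [a [Cmu aP]]]; exists C, a; split=> // w w' wc w'c E j.
by rewrite mulmxA -[s]invgK -col_permE mxE; exact: aP.
Qed.

Lemma cube_code_trig n (A : 'M[R]_n) : is_trig_mx A -> \det A != 0 ->
  exists2 eta0, 0 < eta0 & forall eta, 0 < eta <= eta0 ->
    cube_code A (5 ^+ n * `|\det A| / eta ^+ n) eta.
Proof.
elim: n A => [|n IHn] A.
  move=> _ _; exists 1 => // eta _; exists unit, (fun=> tt); split.
    by rewrite card_unit det_mx00 normr1 !expr0 invr1 !mulr1.
  by move=> w w' _ _ _ [].
move: A; rewrite -[n.+1]/(1 + n)%N => A.
rewrite -[A]submxK; set a := ulsubmx A; set c := dlsubmx A; set D := drsubmx A.
move=> At dA; have ur0 : ursubmx A = 0.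
  apply/matrixP => i j; have /is_trig_mxP/(_ (lshift n i) (rshift 1 j)) := At.
  by rewrite block_mxEur => ->; rewrite ?mxE//= ord1.
rewrite ur0 in At dA *.
have Dt : is_trig_mx D.
  apply/is_trig_mxP => i j ij.
  have /is_trig_mxP/(_ (rshift 1 i) (rshift 1 j)) := At.
  by rewrite block_mxEdr; apply; rewrite /= ltn_add2l.
have detE : \det (block_mx a 0 c D) = a 0 0 * \det D.
  by rewrite (@det_lblock _ 1) det_mx11.
move: dA; rewrite detE mulf_eq0 negb_or => /andP[a0 dD].
have [etaD etaD0 DP] := IHn D Dt dD.
(* [L] measures the influence of the column [c] once the other coordinates are known up to [eta],
   through [(w - z) c = (w - z) D (D^-1 c)]. *)
pose L := \sum_j `|(invmx D *m c) j 0|.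
have L0 : 0 <= L by apply: sumr_ge0.
have pa : 0 < `|a 0 0| by rewrite normr_gt0.
exists (Num.min etaD (`|a 0 0| / (L + 1))).
  by rewrite lt_min etaD0 divr_gt0// ltr_wpDl.
move=> eta; rewrite le_min => /and3P[eta0 eD eL].
have [|C [cD [Cmu cDP]]] := DP eta; first by rewrite eta0.
move: eL; rewrite ler_pdivlMr ?ltr_wpDl// => eL.
have ea : eta <= `|a 0 0| by apply: le_trans eL; rewrite ler_peMr ?lerDr ?(ltW eta0).
have Lea : L * eta <= `|a 0 0|.
  by apply: le_trans eL; rewrite mulrC ler_wpM2l ?lerDl ?(ltW eta0).
have [r rP] := code_repr cD.
have DV : D *m invmx D = 1%:M by apply: mulmxV; rewrite unitmxE unitfE.
have Ddiff (w z : 'rV[R]_n) :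
    ((w - z) *m c) 0 0 = \sum_l ((w - z) *m D) 0 l * (invmx D *m c) l 0.
  by rewrite -[c in LHS]mul1mx -DV -mulmxA mulmxA mxE.
have sub00 (u v : 'M[R]_1) : (u - v) 0 0 = u 0 0 - v 0 0 by rewrite !mxE.
pose y (w : 'rV[R]_(1 + n)) : R := w 0 0 * a 0 0 + (rsubmx w *m c) 0 0.
(* Relative to the contribution of the representative, the first coordinate [y w] stays within
   [2 |a|]: one [|a|] from [w 0 0], one from [L eta]. [x] rescales this interval to
   [[0, 4 |a| / eta]], which is cut into [K] unit cells. *)
pose x (w : 'rV[R]_(1 + n)) : R :=
  (y w - (r (cD (rsubmx w)) *m c) 0 0 + 2 * `|a 0 0|) / eta.
pose K := (Num.truncn (4 * `|a 0 0| / eta)).+1.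
have rc (w : 'rV[R]_(1 + n)) : cube w -> cube (rsubmx w).
  by move=> wc j; rewrite mxE; exact: wc.
have xP w : cube w -> 0 <= x w <= 4 * `|a 0 0| / eta.
  move=> wc; have [zc zE] := rP _ (rc _ wc); set z := r _ in zc zE.
  have H : `|y w - (z *m c) 0 0| <= 2 * `|a 0 0|.
    have -> : y w - (z *m c) 0 0 = w 0 0 * a 0 0 + ((rsubmx w - z) *m c) 0 0.
      by rewrite mulmxBl sub00 addrA.
    apply: le_trans (ler_normD _ _) _; rewrite mulr_natl mulr2n; apply: lerD.
      by rewrite normrM ler_piMl.
    apply: le_trans Lea; rewrite Ddiff mulr_suml; apply: le_trans (ler_norm_sum _ _ _) _.
    apply: ler_sum => l _; rewrite normrM mulrC ler_wpM2l//.
    by apply: cDP => //; exact: rc.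
  move: H; rewrite ler_norml => /andP[H1 H2].
  rewrite /x -/z divr_ge0 ?(ltW eta0)//=; last by lra.
  by rewrite ler_pM2r ?invr_gt0//; lra.
pose k w : 'I_K := inord (Num.truncn (x w)).
have kP w w' : cube w -> cube w' -> k w = k w' -> `|x w - x w'| <= 1.
  move=> wc w'c /(congr1 val); have := xP w wc; have := xP w' w'c.
  move=> /andP[x'0 x'K] /andP[x0 xK].
  rewrite /= !inordK ?ltnS ?le_truncn// => E.
  have := truncn_itv x0; have := truncn_itv x'0; rewrite E -natr1.
  by move=> /andP[? ?] /andP[? ?]; rewrite ler_norml; apply/andP; split; lra.
exists (C * 'I_K)%type, (fun w => (cD (rsubmx w), k w)); split.
  rewrite card_prod card_ord natrM.
  have KP : K%:R <= 5 * `|a 0 0| / eta.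
    have q0 : 0 <= 4 * `|a 0 0| / eta by rewrite divr_ge0 ?mulr_ge0 ?(ltW eta0).
    rewrite /K -natr1; have /andP[tq _] := truncn_itv q0.
    (* The rounding by one costs at most [|a| / eta], so the 4 becomes 5. *)
    have : 1 <= `|a 0 0| / eta by rewrite ler_pdivlMr// mul1r.
    by move: tq; rewrite -!mulrA; lra.
  have -> : 5 ^+ (1 + n) * `|a 0 0 * \det D| / eta ^+ (1 + n)
      = (5 ^+ n * `|\det D| / eta ^+ n) * (5 * `|a 0 0| / eta).
    by rewrite normrM !exprS; field; rewrite gt_eqF//= expf_neq0// gt_eqF.
  by rewrite ler_pM.
move=> w w' wc w'c [cE kE] j.
rewrite -[w - w']hsubmxK mul_row_block mulmx0 add0r.
case: (fintype.split_ordP j) => l ->.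
  rewrite row_mxEl [l]ord1.
  have -> : (lsubmx (w - w') *m a + rsubmx (w - w') *m c) 0 0 = y w - y w'.
    rewrite !linearB /= !mulmxBl /y mxE !sub00 ![(lsubmx _ *m a) 0 0]mxE !big_ord1.
    rewrite ![lsubmx _ 0 0]mxE.
    have -> : lshift n 0 = 0 :> 'I_(1 + n) by apply: val_inj.
    by ring.
  have := kP _ _ wc w'c kE; rewrite /x cE -mulrBl.
  rewrite normrM [`|eta^-1|]gtr0_norm ?invr_gt0// ler_pdivrMr// mul1r.
  by congr (`|_| <= _); ring.
rewrite row_mxEr linearB /=; apply: cDP => //; exact: rc.
Qed.

(** The LUP decomposition reduces the claim to triangular matrices, since permutations preserve the
    cube and the sup norm. Each triangular factor contributes [5 ^ n], whence [25 ^ n]. However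
    small [eta] has to be, the bound on [mu * eta ^ n] involves [A] through its determinant only. *)
Lemma cube_code_exists n (A : 'M[R]_n) : \det A != 0 ->
  exists mu eta, [/\ 0 < eta, cube_code A mu eta
    & mu * eta ^+ n <= 25 ^+ n * `|\det A|].
Proof.
case: n A => [|n] A dA.
  exists 1, 1; split=> //; last by rewrite det_mx00 normr1 expr0.
  by exists unit, (fun=> tt); split; [rewrite card_unit|move=> ? ? _ _ _ []].
have := cormen_lup_correct A; have := cormen_lup_perm A.
have := cormen_lup_detL A; have := @cormen_lup_lower _ _ A.
have := @cormen_lup_upper _ _ A.
case: (cormen_lup A) => [[P L] U] /= Uu Ll dL /is_perm_mxP[s ->] PA.
have AE : A = perm_mx s^-1%g *m (L *m U).
  by rewrite -[L *m U]PA mulmxA -perm_mxM mulVg perm_mx1 mul1mx.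
have Lt : is_trig_mx L.
  apply/is_trig_mxP => i j ij; rewrite Ll ?(ltnW ij)//.
  by case: eqP ij => // ->; rewrite ltnn.
have nA : `|\det A| = `|\det U|.
  by rewrite AE !det_mulmx det_perm dL mul1r normrM normrX normrN1 expr1n mul1r.
(* Reversing the order of the basis on both sides makes the upper triangular factor lower
   triangular. *)
pose rv : 'S_n.+1 := perm (can_inj (@rev_ordK n.+1)).
pose U' := perm_mx rv *m U *m perm_mx rv^-1%g.
have U't : is_trig_mx U'.
  apply/is_trig_mxP => i j ij; rewrite /U' -col_permE -row_permE !mxE.
  by apply: Uu; rewrite !permE /= !subSS ltn_sub2l// (leq_trans ij)// -ltnS.
have dU' : `|\det U'| = `|\det U|.
  rewrite /U' !det_mulmx !det_perm !normrM !normrX !normrN1 !expr1n.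
  by rewrite mul1r mulr1.
have UE : U = perm_mx rv^-1%g *m U' *m perm_mx rv.
  rewrite /U' !mulmxA -perm_mxM mulVg perm_mx1 mul1mx -mulmxA -perm_mxM.
  by rewrite mulVg perm_mx1 mulmx1.
have [|eL eL0 LP] := cube_code_trig Lt; first by rewrite dL oner_eq0.
have [|eU eU0 UP] := cube_code_trig U't.
  by rewrite -normr_gt0 dU' -nA normr_gt0.
pose N := n.+1.
exists ((5 ^+ N * `|\det L| / eL ^+ N) * (5 ^+ N * `|\det U'| / eU ^+ N)), (eL * eU).
split; first exact: mulr_gt0.
  rewrite AE; apply: cube_code_perml; apply: cube_codeM => //.
    by apply: LP; rewrite eL0 lexx.
  rewrite UE; apply: cube_code_permr; apply: cube_code_perml.
  by apply: UP; rewrite eU0 lexx.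
rewrite dU' nA dL normr1 mulr1 exprMn.
have -> : 25 ^+ n.+1 = 5 ^+ N * 5 ^+ N :> R by rewrite -exprMn -natrM.
rewrite le_eqVlt; apply/orP; left; apply/eqP; field.
by rewrite !expf_neq0// gt_eqF.
Qed.

End LinearCodes.

(** * The adjoint representation and its determinant *)

Section AdjointDeterminant.
Context {R : realType} {E : normedModType R} {N : nat}.
Variable fr : frame E N.

Definition frame_mx (T : E -> E) : 'M[R]_N := \matrix_(i, j) fr j (T (fvec fr i)).

Lemma frame_mx_comp (T S : E -> E) : linear T ->
  frame_mx (T \o S) = frame_mx S *m frame_mx T.
Proof.
move=> lT; pose TB := GRing.isLinear.Build R E E *:%R T lT.
pose L : {linear E -> E} := HB.pack T TB.
apply/matrixP => i j; rewrite !mxE /= -[T (S _)]/(L (S (fvec fr i))).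
rewrite {1}(fvec_decomp fr (S _)) !linear_sum; apply: eq_bigr => l _.
by rewrite !linearZ !mxE.
Qed.

Lemma frame_mx_id : frame_mx id = 1%:M.
Proof. by apply/matrixP => i j; rewrite !mxE fcoord_vec eq_sym. Qed.

Context {G : topGroupType} {I : Type}.
Variable A : I -> chart E G.
Hypothesis Ac : forall i, is_chart (A i).
Hypothesis Acov : forall p, exists i, cdom (A i) p.
Hypothesis mul_smooth :
  smooth_map (prod_atlas A A) A (fun p : G * G => p.1 * p.2)%g.
Hypothesis trans_smooth : forall g : G, smooth_map A A (fun p => g * p)%g.
Variable i0 : I.
Hypothesis i0P : cdom (A i0) 1%g.

Local Notation e0 := (cmap (A i0) 1%g).
Local Notation m := (mulc A i0 i0).
Local Notation m_dom := (mulc_dom A i0 i0).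
Local Notation field := (lfield A i0).
Local Notation brk := (lie_bracket A i0).

Let e0P : cimg (A i0) e0. Proof. exact: cimg_cmap. Qed.
Let cinv_e0 : cinv (A i0) e0 = 1%g. Proof. exact: cmapK. Qed.

Let mul_cont : continuous (fun p : G * G => p.1 * p.2)%g.
Proof. by have [] := mul_smooth. Qed.

Let prod_smooth i j k : smooth_on
  (local_dom (prod_atlas A A (i, j)) (A k) (fun p : G * G => p.1 * p.2)%g)
  (local_expr (prod_atlas A A (i, j)) (A k) (fun p : G * G => p.1 * p.2)%g).
Proof. by have [_] := mul_smooth; apply. Qed.

Definition conjc (a : G) : E -> E :=
  local_expr (A i0) (A i0) (fun p => a * p * a^-1)%g.

Definition conjc_dom (a : G) : set E :=
  local_dom (A i0) (A i0) (fun p => a * p * a^-1)%g.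

Lemma open_conjc_dom a : open (conjc_dom a).
Proof.
apply: open_local_dom => // p W /(mul_continuous_at mul_cont)[U [V [Up Vp UV]]].
have aU : nbhs p (fun q => U (a * q)%g) by exact: (ltrans_continuous mul_cont Up).
change (nbhs p (fun q => W (a * q * a^-1)%g)).
by apply: filterS aU => q Uq; apply: UV => //; exact: nbhs_singleton.
Qed.

Lemma conjc_dom_e0 a : conjc_dom a e0.
Proof. by split=> //; rewrite cinv_e0 mulg1 mulgV. Qed.

Lemma near_conjc_dom a : \forall w \near e0, conjc_dom a w.
Proof.
by apply: open_nbhs_nbhs; split; [exact: open_conjc_dom|exact: conjc_dom_e0].
Qed.

Lemma conjc_e0 a : conjc a e0 = e0.
Proof. by rewrite /conjc /local_expr cinv_e0 mulg1 mulgV. Qed.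

Lemma cinv_conjc a w : conjc_dom a w ->
  cinv (A i0) (conjc a w) = (a * cinv (A i0) w * a^-1)%g.
Proof. by move=> [_ dw]; rewrite cmapK. Qed.

Definition Ad (a : G) : {linear E -> E} := dif (conjc a) e0.

(** Conjugation leaves the chart [i0] on the way, so it is factored as a translation into a chart
    around [a], followed by the product with [a^-1] taken in a chart around [a^-1]. *)
Lemma is_diff_conjc a : is_diff e0 (conjc a) (Ad a).
Proof.
apply: is_diff_dif.
have [j ja] := Acov a; have [l la] := Acov a^-1%g.
pose b := cmap (A l) a^-1%g.
pose M := local_expr (prod_atlas A A (j, l)) (A i0) (fun p : G * G => p.1 * p.2)%g.
have Da : ltrans_dom A a i0 j e0 by split=> //; rewrite cinv_e0 mulg1.
pose c := ltrans A a i0 j e0.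
have cE : cinv (A j) c = a by rewrite cinv_ltrans// cinv_e0 mulg1.
have dM : differentiable M (c, b).
  apply: (smooth_on_differentiable (@prod_smooth j l i0)).
  split; first by split=> /=; [exact: cimg_ltrans|exact: cimg_cmap].
  by rewrite /= cE cmapK// mulgV.
have D1 : is_diff c (fun w : E => (w, b)) (fun w => (w, 0)).
  exact: is_diff_pair.
have D2 := is_diff_comp D1 (is_diff_dif dM).
have D3 := is_diff_comp (is_diff_ltrans trans_smooth Da) D2.
apply: (is_diffP (is_diff_near _ D3)); near=> w.
have Dw : ltrans_dom A a i0 j w.
  by near: w; exact: (near_ltrans_dom Ac trans_smooth Da).
by rewrite /= /M /local_expr /= cinv_ltrans// cmapK.
Unshelve. all: by end_near. Qed.

Lemma AdM a b z : Ad (a * b)%g z = Ad a (Ad b z).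
Proof.
apply: (dif_val (df := Ad a \o Ad b)).
have Da : is_diff (conjc b e0) (conjc a) (Ad a).
  by rewrite conjc_e0; exact: is_diff_conjc.
apply: (is_diff_near _ (is_diff_comp (is_diff_conjc b) Da)); near=> w.
have Dw : conjc_dom b w by near: w; exact: near_conjc_dom.
by rewrite /= /conjc {1}/local_expr cinv_conjc// /local_expr invMg !mulgA.
Unshelve. all: by end_near. Qed.

Lemma Ad1 z : Ad 1%g z = z.
Proof.
apply: (dif_val (df := id)); apply: (is_diff_near _ (is_diff_id e0)); near=> w.
have [iw _] : conjc_dom 1%g w by near: w; exact: near_conjc_dom.
by rewrite /= /conjc /local_expr mul1g invg1 mulg1 cinvK.
Unshelve. all: by end_near. Qed.

Definition detAd a : R := \det (frame_mx (Ad a)).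

Lemma detAdM a b : detAd (a * b)%g = detAd a * detAd b.
Proof.
rewrite /detAd mulrC -det_mulmx -frame_mx_comp; last exact: linearP.
congr (\det _).
by apply/matrixP => i j; rewrite !mxE AdM.
Qed.

Lemma detAd1 : detAd 1%g = 1.
Proof.
rewrite /detAd -(det1 R N) -frame_mx_id; congr (\det _).
by apply/matrixP => i j; rewrite !mxE Ad1.
Qed.

Lemma detAd_neq0 a : detAd a != 0.
Proof.
apply/eqP => d0; have := detAdM a a^-1%g.
by rewrite mulgV detAd1 d0 mul0r => /eqP; rewrite oner_eq0.
Qed.

Lemma m_smooth_at u w : m_dom (u, w) ->
  is_diff (u, w) m (dif m (u, w)).
Proof.
move=> Duw; apply: is_diff_dif.
exact: (smooth_on_differentiable (mulc_smooth mul_smooth i0 i0)).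
Qed.

Lemma m_dom_l u : cimg (A i0) u -> m_dom (e0, u).
Proof. by move=> iu; split=> //=; rewrite cinv_e0 mul1g; exact: cdom_cinv. Qed.

(** The right invariant field with value [z] at the identity: the product is differentiated in its
    left factor. *)
Definition rfield (z u : E) : E := dif m (e0, u) (z, 0).

(** This is [a p = (a p a^-1) a], differentiated at [p = 1]. *)
Lemma lfield_Ad z u : cimg (A i0) u ->
  field z i0 u = rfield (Ad (cinv (A i0) u) z) u.
Proof.
move=> iu; rewrite (lfield_mulc Ac mul_smooth i0P)// /rfield.
set a := cinv (A i0) u.
have D1 : is_diff e0 (fun w : E => (u, w)) (fun w => (0, w)) by exact: is_diff_pair.
have D2 := is_diff_comp D1 (m_smooth_at (mulc_dom_e0 Ac i0P iu)).
have D3 : is_diff e0 (fun w => (conjc a w, u)) (fun w => (Ad a w, 0)).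
  by apply: is_diff_pair; exact: is_diff_conjc.
have D4 : is_diff (conjc a e0, u) m (dif m (e0, u)).
  by rewrite conjc_e0; apply: m_smooth_at; exact: m_dom_l.
have D5 := is_diff_comp D3 D4.
apply: (is_diff_uniq D2 (is_diff_near _ D5) z); near=> w.
have Dw : conjc_dom a w by near: w; exact: near_conjc_dom.
by rewrite /= /mulc /local_expr /= cinv_conjc// mulgVK.
Unshelve. all: by end_near. Qed.

Lemma rfield_e0 z : rfield z e0 = z.
Proof.
have D1 : is_diff e0 (fun w : E => (w, e0)) (fun w => (w, 0)) by exact: is_diff_pair.
have D2 := is_diff_comp D1 (m_smooth_at (mulc_dom_e0 Ac i0P e0P)).
apply: (is_diff_uniq D2 (is_diff_near _ (is_diff_id e0)) z); near=> w.
have iw : cimg (A i0) w.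
  by near: w; apply: open_nbhs_nbhs; split=> //; exact: open_cimg.
by rewrite /= /mulc /local_expr /= cinv_e0 mulg1 cinvK.
Unshelve. all: by end_near. Qed.

(** Both derivatives are the mixed second derivative of the product at [(e0, e0)], taken in opposite
    orders. *)
Lemma is_diff_rfield z :
  is_diff e0 (rfield z) (fun v => dif (field v i0) e0 z).
Proof.
have D00 : m_dom (e0, e0) by exact: mulc_dom_e0.
have ms := mulc_smooth mul_smooth i0 i0.
have md : \forall p \near (e0, e0), differentiable m p.
  have : \forall p \near (e0, e0), m_dom p.
    by apply: open_nbhs_nbhs; split=> //; exact: open_mulc_dom.
  by apply: filterS => p Dp; exact: (smooth_on_differentiable ms).
have mdd v : differentiable (fun p => dif m p v) (e0, e0).
  exact: (smooth_on_differentiable (smooth_on_dif v ms)).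
have D1 : is_diff e0 (fun w : E => (e0, w)) (fun w => (0, w)) by exact: is_diff_pair.
have D2 := is_diff_comp D1 (is_diff_dif (mdd (z, 0))).
refine (is_diff_ext D2 _) => v /=.
rewrite (second_diff_sym_vec fr (z, 0) (0, v) md mdd).
have D3 : is_diff e0 (fun w : E => (w, e0)) (fun w => (w, 0)) by exact: is_diff_pair.
have D4 := is_diff_comp D3 (is_diff_dif (mdd (0, v))).
apply/esym; apply: (dif_val (is_diff_near _ D4)); near=> w.
have iw : cimg (A i0) w.
  by near: w; apply: open_nbhs_nbhs; split=> //; exact: open_cimg.
by rewrite /= (lfield_mulc Ac mul_smooth i0P).
Unshelve. all: by end_near. Qed.

(* The matrices of the left and of the right invariant frames differ by that of
   [Ad], so when [detAd a ^ 2 = 1] their squared determinants agree near the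
   identity; comparing the derivatives there gives the trace of the bracket. *)
Lemma trace_bracket_eq0 v : (forall a, `|detAd a| = 1) ->
  frame_trace fr (brk v) = 0.
Proof.
move=> Ad1.
pose X u := frame_mx (fun z => field z i0 u).
pose Y u := frame_mx (fun z => rfield z u).
have XY u : cimg (A i0) u -> \det (X u) ^+ 2 = \det (Y u) ^+ 2.
  move=> iu; have -> : X u = frame_mx (Ad (cinv (A i0) u)) *m Y u.
    rewrite -frame_mx_comp; last first.
      move=> k z w; rewrite /rfield -linearP; congr (dif _ _ _).
      by congr pair; rewrite /= scaler0 addr0.
    by apply/matrixP => i j; rewrite !mxE lfield_Ad.
  by rewrite det_mulmx exprMn -[_ ^+ 2]real_normK ?num_real// Ad1 expr1n mul1r.
pose der (F : E -> R) (d : R) := exists2 dF : E -> R, is_diff e0 F dF & dF v = d.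
have der_cst c : der (fun=> c) 0 by exists (fun=> 0) => //; exact: (is_diff_cst c).
have derD F H d d' : der F d -> der H d' -> der (fun t => F t + H t) (d + d').
  by move=> [f Fd <-] [h Hd <-]; eexists; first exact: (is_diff_fD Fd Hd).
have derM F H d d' : der F d -> der H d' ->
    der (fun t => F t * H t) (F e0 * d' + H e0 * d).
  by move=> [f Fd <-] [h Hd <-]; eexists; first exact: (is_diff_fM Fd Hd).
have fr_der (Z : E -> E) dZ j : is_diff e0 Z dZ -> der (fun u => fr j (Z u)) (fr j (dZ v)).
  move=> Zd; exists (fr j \o dZ) => //; apply: is_diff_comp Zd _.
  by apply: is_diff_lin; exact: fcoord_continuous.
(* [SX] and [SY] are the derivatives along [v] of the two matrices at the identity; their traces are
   the two halves of the trace of the bracket. *)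
pose SX : 'M[R]_N := \matrix_(i, j) fr j (dif (field (fvec fr i) i0) e0 v).
pose SY : 'M[R]_N := \matrix_(i, j) fr j (dif (field v i0) e0 (fvec fr i)).
have X0 : X e0 = 1%:M.
  by rewrite -frame_mx_id; apply/matrixP => i j; rewrite !mxE (lfield_e0 Ac i0P).
have Y0 : Y e0 = 1%:M.
  by rewrite -frame_mx_id; apply/matrixP => i j; rewrite !mxE rfield_e0.
have dX : der (fun u => \det (X u)) (\tr SX * \det (X e0)).
  apply: (der_det_row der_cst derD derM) => i j; rewrite X0 mulmx1 mxE.
  rewrite (_ : (fun _ => _) = fun u => fr j (field (fvec fr i) i0 u)).
    by apply: fr_der; exact: (is_diff_lfield Ac mul_smooth i0P).
  by apply/funext => u; rewrite mxE.
have dY : der (fun u => \det (Y u)) (\tr SY * \det (Y e0)).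
  apply: (der_det_row der_cst derD derM) => i j; rewrite Y0 mulmx1 mxE.
  rewrite (_ : (fun _ => _) = fun u => fr j (rfield (fvec fr i) u)).
    exact: (fr_der _ _ j (is_diff_rfield (fvec fr i))).
  by apply/funext => u; rewrite mxE.
have [fX FX fXv] := derM _ _ _ _ dX dX; have [fY FY fYv] := derM _ _ _ _ dY dY.
have : fX v = fY v.
  apply: (is_diff_uniq (is_diff_near _ FX) FY v); near=> u.
  rewrite /= -!expr2; apply: XY; near: u.
  by apply: open_nbhs_nbhs; split=> //; exact: open_cimg.
rewrite fXv fYv X0 Y0 det1 !mul1r !mulr1 => SE.
have {}SE : \tr SX = \tr SY by lra.
rewrite /frame_trace /lie_bracket /vbracket; under eq_bigr => j _ do rewrite linearB.
rewrite sumrB; apply/eqP; rewrite subr_eq0; apply/eqP.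
move: SE; rewrite /mxtrace; under eq_bigr => j _ do rewrite mxE.
under [in RHS]eq_bigr => j _ do rewrite mxE.
move=> SE; under eq_bigr => j _ do rewrite (lfield_e0 Ac i0P).
by under [in RHS]eq_bigr => j _ do rewrite (lfield_e0 Ac i0P).
Unshelve. all: by end_near. Qed.

End AdjointDeterminant.

(** * Coverings of the quotient by chart balls *)

Section Covers.
Context {R : realType} {E : normedModType R} {N : nat}.
Variable fr : frame E N.
Context {G : topGroupType} {I : Type}.
Variable A : I -> chart E G.
Hypothesis Ac : forall i, is_chart (A i).
Hypothesis Acov : forall p, exists i, cdom (A i) p.
Hypothesis mul_smooth :
  smooth_map (prod_atlas A A) A (fun p : G * G => p.1 * p.2)%g.
Hypothesis trans_smooth : forall g : G, smooth_map A A (fun p => g * p)%g.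
Hypothesis inv_cont : continuous (fun p : G => p^-1)%g.
Variable i0 : I.
Hypothesis i0P : cdom (A i0) 1%g.
Variable Gamma : groupClosed G.
Hypothesis cpt : compact [set: coset_space Gamma].
Hypothesis discrete : isolated [set` Gamma] = [set` Gamma].

Local Notation e0 := (cmap (A i0) 1%g).
Local Notation m := (mulc A i0 i0).
Local Notation m_dom := (mulc_dom A i0 i0).
Local Notation ci := (cinv (A i0)).

Let e0P : cimg (A i0) e0. Proof. exact: cimg_cmap. Qed.
Let cinv_e0 : ci e0 = 1%g. Proof. exact: cmapK. Qed.
Let mul_cont : continuous (fun p : G * G => p.1 * p.2)%g.
Proof. by have [] := mul_smooth. Qed.
Let D00 : m_dom (e0, e0). Proof. exact: mulc_dom_e0. Qed.
Let ms := mulc_smooth mul_smooth i0 i0.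

(** A covering of the quotient stated in [G]: modulo [Gamma] on the left, the left translates by [s]
    of one chart ball at the identity fill the group. *)
Definition cover_by (eps : R) (s : seq G) : Prop :=
  forall p, exists g t u,
    [/\ g \in Gamma, t \in s, ball e0 eps u & p = (g * t * ci u)%g].

Lemma cover_exists eps : 0 < eps -> exists s, cover_by eps s.
Proof.
move=> eps0; pose O := cdom (A i0) `&` cmap (A i0) @^-1` ball e0 eps.
have oO : open O.
  rewrite openE => p [ip bp]; apply: filterI.
    by apply: open_nbhs_nbhs; split=> //; exact: open_cdom.
  apply: (chart_continuous_at (Ac i0) ip); apply: open_nbhs_nbhs; split=> //.
  exact: ball_open.
pose f (t : G) : set (coset_space Gamma) :=
  coset_proj Gamma @` ((fun p => t^-1 * p)%g @^-1` O).
have of_ t : open (f t).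
  apply: (open_coset_image Gamma mul_cont); apply: open_comp => // p _.
  exact: ltrans_continuous.
pose Tp := isPointed.Build (coset_space Gamma) (coset_proj Gamma 1%g).
pose T : ptopologicalType := HB.pack (coset_space Gamma) Tp.
have : @compact T setT := cpt.
rewrite (@compact_cover T) => /(_ G setT f)[t _|x _|D _ Dcov]; first exact: of_.
  have [p <-] := coset_proj_surj x; exists p => //; exists p => //.
  rewrite /= /O mulVg; split=> //=; exact: ballxx.
exists (finmap.enum_fset D) => p.
have [t tD [q [/= iq bq] qp]] := Dcov (coset_proj Gamma p) Logic.I.
have [g gG pE] := coset_projE (esym qp).
exists g, t, (cmap (A i0) (t^-1 * q)%g); split=> //.
by rewrite cmapK// -mulgA mulKVg.
Qed.

Let nbhs_prod_ball (P : set (E * E)) : nbhs (e0, e0) P ->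
  exists2 r, 0 < r & forall u v, ball e0 r u -> ball e0 r v -> P (u, v).
Proof.
move=> /nbhs_ballP[r /= r0 rP]; exists r => // u v bu bv; apply: rP.
by split.
Qed.

Lemma local_lipschitz (B : set G) : open B -> B 1%g -> exists r C,
  [/\ 0 < r, 0 < C,
      forall u v, ball e0 r u -> ball e0 r v ->
        [/\ cimg (A i0) u, m_dom (u, v) & B (ci (m (u, v)))]
    & forall u v v', ball e0 r u -> ball e0 r v -> ball e0 r v' ->
        `|m (u, v) - m (u, v')| <= C * `|v - v'|].
Proof.
move=> oB B1.
have m00 : m (e0, e0) = e0 by rewrite /mulc /local_expr /= cinv_e0 mulg1.
have mc : {for (e0, e0), continuous m}.
  by apply: differentiable_continuous; exact: (smooth_on_differentiable ms).
have n1 : \forall p \near (e0, e0), m_dom p.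
  by apply: open_nbhs_nbhs; split=> //; exact: open_mulc_dom.
have n2 : \forall p \near (e0, e0), B (ci (m p)).
  have cc : {for (e0, e0), continuous (ci \o m)}.
    by apply: continuous_comp => //; rewrite m00; exact: chart_inv_continuous_at.
  by apply: cc; apply: open_nbhs_nbhs; split=> //=; rewrite m00 cinv_e0.
pose K l := `|dif m (e0, e0) (0, fvec fr l)| + 1.
have n3 : \forall p \near (e0, e0), forall l, `|dif m p (0, fvec fr l)| <= K l.
  suff n3 l : \forall p \near (e0, e0), `|dif m p (0, fvec fr l)| <= K l.
    exact: filter_forall n3.
  have dc : {for (e0, e0), continuous (fun p => `|dif m p (0, fvec fr l)|)}.
    apply: continuous_comp; last exact: norm_continuous.
    exact: (smooth_on_dif (0, fvec fr l) ms 0%N).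
  move: dc => /cvgrPdist_lt /(_ 1 ltr01); apply: filterS => p.
  by rewrite ltr_norml /K => /andP[? _]; lra.
have [r r0 rP] : exists2 r, 0 < r & forall u v, ball e0 r u -> ball e0 r v ->
    [/\ m_dom (u, v), B (ci (m (u, v)))
      & forall l, `|dif m (u, v) (0, fvec fr l)| <= K l].
  have n4 : \forall p \near (e0, e0), [/\ m_dom p, B (ci (m p))
      & forall l, `|dif m p (0, fvec fr l)| <= K l].
    by near=> p; split; near: p.
  exact: (nbhs_prod_ball n4).
pose C := \sum_l K l + 1.
have K0 l : 0 <= K l by rewrite addr_ge0.
have C0 : 0 < C by rewrite ltr_wpDl// sumr_ge0.
exists r, C; split=> // [u v bu bv|u v v' bu bv bv'].
  by have [Duv Buv _] := rP u v bu bv; split=> //; have [[]] := Duv.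
apply: (norm_le_fcoord (f := fr)); first by rewrite mulr_ge0// ltW.
move=> j; rewrite linearB /=.
have D w : ball e0 r w -> is_diff w (fun v => fr j (m (u, v)))
    (fun z => fr j (dif m (u, w) (0, z))).
  move=> bw; have [Duw _ _] := rP u w bu bw.
  have D1 : is_diff w (fun v : E => (u, v)) (fun v => (0, v)) by exact: is_diff_pair.
  have D2 : is_diff (u, w) m (dif m (u, w)).
    by apply: is_diff_dif; exact: (smooth_on_differentiable ms).
  have D3 : is_diff (m (u, w)) (fr j) (fr j).
    by apply: is_diff_lin; exact: fcoord_continuous.
  exact: (is_diff_comp (is_diff_comp D1 D2) D3).
apply: (bounded_diff_lipschitz (f := fun v => fr j (m (u, v))) (c := e0) (r := r)) => //.
  by move=> w /D /is_diffP.
move=> w z bw; rewrite (dif_val (D w bw)).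
have [_ _ KP] := rP u w bu bw.
have -> : (0, z) = \sum_l fr l z *: (0, fvec fr l) :> E * E.
  rewrite {1}(fvec_decomp fr z).
  rewrite (eq_bigr (fun l => (0, fr l z *: fvec fr l))); last first.
    by move=> l _; congr pair; rewrite /= scaler0.
  by elim/big_ind2: _ => // [x1 x2 y1 y2 <- <-]; congr pair; rewrite /= addr0.
rewrite !linear_sum; apply: le_trans (ler_norm_sum _ _ _) _.
apply: le_trans (_ : \sum_l K l * `|z| <= _); last first.
  by rewrite -mulr_suml ler_wpM2r// /C lerDl.
apply: ler_sum => l _; rewrite !linearZ normrM mulrC ler_pM//.
  by apply: le_trans (fcoord_norm _ _ _) _; exact: KP.
exact: fcoord_norm.
Unshelve. all: by end_near. Qed.

(** With [q'] the coordinate of the inverse of [q], the products [m (q', q) = e0] and [m (q', v)]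
    differ only in the right factor, where [m] is Lipschitz. *)
Lemma quotient_estimate r C : 0 < r -> 0 < C ->
  (forall u v, ball e0 r u -> ball e0 r v -> cimg (A i0) u /\ m_dom (u, v)) ->
  (forall u v v', ball e0 r u -> ball e0 r v -> ball e0 r v' ->
        `|m (u, v) - m (u, v')| <= C * `|v - v'|) ->
  exists2 r', 0 < r' <= r & forall q v, ball e0 r' q -> ball e0 r' v ->
    exists2 y, `|y - e0| <= C * `|v - q| & ci y = ((ci q)^-1 * ci v)%g.
Proof.
move=> r0 C0 rP lip.
have nr : \forall q \near e0, cdom (A i0) (ci q)^-1%g
    /\ ball e0 r (cmap (A i0) (ci q)^-1%g).
  have c1 : {for e0, continuous (fun q => (ci q)^-1%g)}.
    apply: continuous_comp; [exact: chart_inv_continuous_at|exact: inv_cont].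
  have i1 : cdom (A i0) (ci e0)^-1%g by rewrite cinv_e0 invg1.
  have c2 : {for e0, continuous (fun q => cmap (A i0) (ci q)^-1%g)}.
    by apply: (continuous_comp c1); exact: chart_continuous_at.
  apply: filterI.
    by apply: c1; apply: open_nbhs_nbhs; split=> //; exact: open_cdom.
  apply: c2; apply: open_nbhs_nbhs; split; first exact: ball_open.
  by rewrite cinv_e0 invg1; exact: ballxx.
move/nbhs_ballP: nr => [d /= d0 dP].
exists (Num.min d r); first by rewrite lt_min d0 r0 ge_min lexx orbT.
move=> q v bq bv.
have md : Num.min d r <= d by rewrite ge_min lexx.
have mr : Num.min d r <= r by rewrite ge_min lexx orbT.
have [iq br] := dP q (le_ball md bq).
have bq' := le_ball mr bq; have bv' := le_ball mr bv.
set q' := cmap (A i0) (ci q)^-1%g in br.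
have q'E : ci q' = (ci q)^-1%g by rewrite cmapK.
exists (m (q', v)).
  have <- : m (q', q) = e0 by rewrite /mulc /local_expr /= q'E mulVg.
  exact: lip.
have [_ [_ /=]] := rP q' v br bv'.
by rewrite /mulc /local_expr /= q'E => /(cmapK (Ac i0)).
Qed.

Section ReducedBall.
Variables (r C r' : R).
Hypotheses (r0 : 0 < r) (C0 : 0 < C) (r'0 : 0 < r').
Hypothesis rP : forall u v, ball e0 r u -> ball e0 r v ->
  cimg (A i0) u /\ m_dom (u, v).
Hypothesis lip : forall u v v', ball e0 r u -> ball e0 r v -> ball e0 r v' ->
  `|m (u, v) - m (u, v')| <= C * `|v - v'|.
Hypothesis quot : forall q v, ball e0 r' q -> ball e0 r' v ->
  exists2 y, `|y - e0| <= C * `|v - q| & ci y = ((ci q)^-1 * ci v)%g.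

(* [ci u] below is written [a^-1 (a (ci u) a^-1) a], so that right translation
   of a cover by [a^-1] replaces the chart balls by their images under [Ad a]. *)
Lemma refine_cover a mu eta : 0 < eta ->
  cube_code (frame_mx fr (Ad A i0 a)) mu eta ->
  exists2 d, 0 < d & forall eps s, 0 < eps < d -> cover_by eps s ->
    exists2 s', cover_by (4 * C * eta * eps) s' &
      (size s')%:R <= mu * (size s)%:R.
Proof.
move=> eta0 [K [code [Kmu codeP]]].
pose phi := conjc A i0 a; pose L := Ad A i0 a.
have phid := is_diff_conjc Ac Acov mul_smooth trans_smooth i0P a.
have [d1 d10 d1P] := differentiable_eps (is_diffP phid) eta0.
have nphi : \forall w \near e0, conjc_dom A i0 a w /\ ball e0 r' (phi w).
  apply: filterI; first exact: near_conjc_dom.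
  have pc : {for e0, continuous phi}.
    by apply: differentiable_continuous; exact: (is_diffP phid).
  apply: pc; rewrite /phi conjc_e0//; apply: open_nbhs_nbhs; split.
    exact: ball_open.
  exact: ballxx.
move/nbhs_ballP: nphi => [d2 /= d20 d2P].
exists (Num.min d1 d2); first by rewrite lt_min d10.
move=> eps s /andP[eps0]; rewrite lt_min => /andP[ed1 ed2] scov.
pose w u : 'rV[R]_N := eps^-1 *: \row_j fr j (u - e0).
have wc u : ball e0 eps u -> cube (w u).
  rewrite -ball_normE /= distrC => bu j; rewrite !mxE normrM.
  rewrite gtr0_norm ?invr_gt0// mulrC ler_pdivrMr// mul1r.
  by apply: le_trans (ltW bu); exact: fcoord_norm.
(* Each code value in use gets a representative inside the ball; the value 0 for the others is a
   dummy. *)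
have ex c : exists z, forall u, ball e0 eps u -> code (w u) = c ->
    ball e0 eps z /\ code (w z) = c.
  have [[z [bz zE]]|no] := pselect (exists z, ball e0 eps z /\ code (w z) = c).
    by exists z.
  by exists 0 => u bu uE; case: no; exists u.
have [rho rhoP] := choice ex.
exists [seq (t * a^-1 * ci (phi (rho c)))%g | t <- s, c <- enum K]; last first.
  by rewrite size_allpairs -cardE natrM mulrC ler_wpM2r.
move=> p; have [g [t [u [gG ts bu pE]]]] := scov (p * a)%g.
pose z := rho (code (w u)).
have [bz zE] := rhoP _ u bu erefl.
have in2 x : ball e0 eps x -> conjc_dom A i0 a x /\ ball e0 r' (phi x).
  by move=> bx; apply: d2P; apply: le_ball bx; exact: ltW.
have [Du bphiu] := in2 u bu; have [Dz bphiz] := in2 z bz.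
have [y yle yE] := quot bphiz bphiu.
exists g, (t * a^-1 * ci (phi z))%g, y; split=> //.
- by apply/allpairsP; exists (t, code (w u)); rewrite mem_enum.
- rewrite -ball_normE /= distrC; apply: (le_lt_trans yle).
  have lin x : ball e0 eps x -> `|phi x - e0 - L (x - e0)| <= eta * eps.
    rewrite -ball_normE /= distrC => bx.
    have := d1P (x - e0) (lt_trans bx ed1).
    rewrite [e0 + _]addrC subrK conjc_e0// => H; apply: le_trans H _.
    by rewrite ler_wpM2l ?ltW.
  have Lle : `|L (u - z)| <= eta * eps.
    apply: (norm_le_fcoord (f := fr)); first by rewrite mulr_ge0 ?ltW.
    move=> j; have := codeP _ _ (wc u bu) (wc z bz) (esym zE) j.
    rewrite /w -scalerBr -scalemxAl mxE normrM gtr0_norm ?invr_gt0// mulrC.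
    rewrite ler_pdivrMr//; congr (`|_| <= _).
    rewrite mxE [in RHS](fvec_decomp fr (u - z)) !linear_sum; apply: eq_bigr => i _.
    rewrite !linearZ !mxE; congr (_ * _).
    by rewrite -linearB opprB addrA subrK.
  have -> : phi u - phi z = (phi u - e0 - L (u - e0)) - (phi z - e0 - L (z - e0))
      + L (u - z).
    have -> : u - z = (u - e0) - (z - e0) by rewrite opprB addrA subrK.
    rewrite (linearB L (u - e0) (z - e0)) [RHS]addrAC.
    rewrite (addrA (phi u - e0 - L (u - e0))) subrK.
    by rewrite [- (phi z - e0 - _)]opprB addrA subrK opprB addrA subrK.
  (* Two linearization errors and one coding error, each at most [eta * eps]. The radius has the
     factor 4 instead of 3 because balls are open. *)
  have H : `|(phi u - e0 - L (u - e0)) - (phi z - e0 - L (z - e0)) + L (u - z)|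
      <= 3 * (eta * eps).
    apply: le_trans (ler_normD _ _) _.
    have := le_trans (ler_normB _ _) (lerD (lin u bu) (lin z bz)).
    by move: Lle; lra.
  apply: le_lt_trans (ler_wpM2l (ltW C0) H) _.
  have : 0 < C * (eta * eps) by rewrite !mulr_gt0.
  by lra.
- rewrite yE !mulgA mulgK.
  have vE : ci (phi u) = (a * ci u * a^-1)%g by exact: cinv_conjc.
  by rewrite vE !mulgA mulgVK -pE mulgK.
Qed.

(** A grid of [M ^ N] points with spacing [kappa * eps] fits in the ball of radius [r]. Two grid
    points in the same translate would be closer than the spacing, first modulo [Gamma], then truly,
    because the projection is injective on [B]. *)
Lemma cover_lower_bound (B : set G) : set_inj B (coset_proj Gamma) ->
  (forall u v, ball e0 r u -> ball e0 r v -> B (ci (m (u, v)))) ->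
  exists kappa d, [/\ 0 < kappa, 0 < d & forall eps s M, 0 < eps < d ->
    cover_by eps s -> M%:R * (kappa * eps) <= r / 2 -> (M ^ N <= size s)%N].
Proof.
(* The quotient of two points of the [eps] ball is within [2 C eps] of the identity, and left
   multiplication by a grid point costs another [C]; the [+ 1] makes the spacing strictly larger. *)
move=> Binj BP; pose kappa := 2 * C * C + 1.
have k0 : 0 < kappa by rewrite ltr_wpDl// !mulr_ge0// ltW.
exists kappa, (Num.min r' (r / (2 * C))); split=> //.
  by rewrite lt_min r'0 divr_gt0// mulr_gt0.
move=> eps s M /andP[eps0]; rewrite lt_min => /andP[er' eC] scov Mr.
pose rho := kappa * eps; have rho0 : 0 < rho by rewrite mulr_gt0.
pose gp (z : {ffun 'I_N -> 'I_M}) : E := e0 + \sum_j ((z j)%:R * rho) *: fvec fr j.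
have gpb z : ball e0 r (gp z).
  rewrite -ball_normE /= /gp opprD addrA subrr sub0r normrN.
  apply: (@le_lt_trans _ _ (r / 2)); last by rewrite ltr_pdivrMr// ltr_pMr// ltr1n.
  apply: (norm_le_fcoord (f := fr)); first by rewrite divr_ge0 ?ltW.
  move=> j; rewrite fcoord_sum ger0_norm; last by rewrite mulr_ge0 ?ler0n// ltW.
  by apply: le_trans Mr; rewrite ler_pM2r// ler_nat ltnW.
have [F FP] : exists F : {ffun 'I_N -> 'I_M} -> G * G * E, forall z,
    [/\ (F z).1.1 \in Gamma, (F z).1.2 \in s, ball e0 eps (F z).2
      & ci (gp z) = ((F z).1.1 * (F z).1.2 * ci (F z).2)%g].
  have exF (z : {ffun 'I_N -> 'I_M}) : exists x : G * G * E,
     [/\ x.1.1 \in Gamma, x.1.2 \in s, ball e0 eps x.2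
      & ci (gp z) = (x.1.1 * x.1.2 * ci x.2)%g].
    by have [g [t [u H]]] := scov (ci (gp z)); exists (g, t, u).
  by have [F FP] := choice exF; exists F.
have idx z : (index (F z).1.2 s < size s)%N by rewrite index_mem; have [] := FP z.
have inj : injective (fun z => Ordinal (idx z)).
  move=> z z' /(congr1 val) /= idxE.
  have tE : (F z).1.2 = (F z').1.2.
    have [_ tz _ _] := FP z; have [_ tz' _ _] := FP z'.
    by rewrite -(nth_index 1%g tz) idxE nth_index.
  have [gz _ bz zE] := FP z; have [gz' _ bz' z'E] := FP z'.
  have sub x : ball e0 eps x -> ball e0 r' x by apply: le_ball; exact: ltW.
  have [y yle yE] := quot (sub _ bz) (sub _ bz').
  have yC : `|y - e0| <= 2 * C * eps.
    apply: le_trans yle _; have -> : 2 * C * eps = C * (eps + eps) by ring.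
    rewrite ler_pM2l//.
    have -> : (F z').2 - (F z).2 = (e0 - (F z).2) - (e0 - (F z').2).
      by rewrite opprB [RHS]addrC addrA subrK.
    move: bz bz'; rewrite -ball_normE /= => bz bz'.
    by apply: le_trans (ler_normB _ _) _; apply: lerD; exact: ltW.
  have yb : ball e0 r y.
    rewrite -ball_normE /= distrC; apply: (le_lt_trans yC).
    by move: eC; rewrite ltr_pdivlMr ?mulr_gt0// mulrC.
  have eb : ball e0 r e0 by exact: ballxx.
  have me x : ball e0 r x -> m (x, e0) = x.
    move=> bx; have [ix _] := rP bx eb.
    by rewrite /mulc /local_expr /= cinv_e0 mulg1 cinvK.
  have mE : ci (m (gp z, y)) = (ci (gp z) * ci y)%g.
    by have [_ [_ /= D]] := rP (gpb z) yb; rewrite /mulc /local_expr /= cmapK.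
  (* With the same centre in [s], the two grid points are related by an element of [Gamma] and the
     small right factor [y]. *)
  have pE : ci (gp z') = ((F z').1.1 * (F z).1.1^-1 * ci (m (gp z, y)))%g.
    by rewrite mE yE zE z'E tE !mulgA mulgVK mulgK.
  have same : ci (gp z') = ci (m (gp z, y)).
    apply: (Binj _ _ _ _ _); rewrite ?inE.
    - by rewrite -(me _ (gpb z')); exact: BP.
    - exact: BP.
    - by rewrite pE; apply: coset_projM; rewrite gpredM// gpredV.
  have gE : gp z' = m (gp z, y).
    have [iz' _] := rP (gpb z') eb; have [_ [_ /= D]] := rP (gpb z) yb.
    by rewrite -(cinvK (Ac i0) iz') same /mulc /local_expr /= cmapK.
  have dle : `|gp z' - gp z| <= 2 * C * C * eps.
    rewrite gE -[X in _ - X](me _ (gpb z)).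
    apply: le_trans (lip (gpb z) yb eb) _.
    apply: le_trans (ler_wpM2l (ltW C0) yC) _.
    by rewrite le_eqVlt; apply/orP; left; apply/eqP; ring.
  apply/ffunP => j; apply/val_inj/eqP; rewrite eqn_leq.
  have jle : `|(z' j)%:R - (z j)%:R| * rho < 1 * rho.
    rewrite -[X in _ * X < _](gtr0_norm rho0) -normrM mulrBl.
    have -> : (z' j)%:R * rho - (z j)%:R * rho = fr j (gp z' - gp z).
      by rewrite /gp opprD addrACA subrr add0r linearB /= !fcoord_sum.
    apply: le_lt_trans (fcoord_norm _ _ _) _; apply: (le_lt_trans dle).
    by rewrite mul1r /rho ltr_pM2r// /kappa ltrDl.
  move: jle; rewrite ltr_pM2r// ltr_norml ltrBrDl ltrBlDl => /andP[H1 H2].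
  have {}H1 : (z j < (z' j).+1)%N by rewrite -(ltr_nat R) -natr1; lra.
  have {}H2 : (z' j < (z j).+1)%N by rewrite -(ltr_nat R) -natr1; lra.
  by apply/andP; split; rewrite -ltnS.
have := leq_card _ inj; rewrite card_ord card_ffun !card_ord; exact.
Qed.

End ReducedBall.
End Covers.

Lemma exists_exprn_lt {R : realType} (x y : R) : 0 <= x < 1 -> 0 < y ->
  exists k, x ^+ k < y.
Proof.
move=> /andP[x0 x1] y0.
have : (GRing.exp x : nat -> R) @ \oo --> (0 : R) by apply: cvg_expr; rewrite ger0_norm.
move=> /cvgrPdist_lt /(_ y y0) [k _ /(_ k (leqnn k))]; rewrite /= sub0r normrN.
by rewrite ger0_norm ?exprn_ge0//; exists k.
Qed.

(** * Unimodularity *)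

Section Unimodular.
Context {R : realType} {E : normedModType R} {N : nat}.
Variable fr : frame E N.
Context {G : topGroupType} {I : Type}.
Variable A : I -> chart E G.
Hypothesis Ac : forall i, is_chart (A i).
Hypothesis Acov : forall p, exists i, cdom (A i) p.
Hypothesis mul_smooth :
  smooth_map (prod_atlas A A) A (fun p : G * G => p.1 * p.2)%g.
Hypothesis trans_smooth : forall g : G, smooth_map A A (fun p => g * p)%g.
Hypothesis inv_cont : continuous (fun p : G => p^-1)%g.
Variable i0 : I.
Hypothesis i0P : cdom (A i0) 1%g.
Variable Gamma : groupClosed G.
Hypothesis cpt : compact [set: coset_space Gamma].
Hypothesis discrete : isolated [set` Gamma] = [set` Gamma].

Local Notation det := (detAd fr A i0).

Let mul_cont : continuous (fun p : G * G => p.1 * p.2)%g.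
Proof. by have [] := mul_smooth. Qed.

Lemma detAdX a k : det (a ^+ k)%g = det a ^+ k.
Proof.
elim: k => [|k IHk]; first by rewrite expg0 detAd1.
by rewrite expgS detAdM// IHk exprS.
Qed.

(* If [|det (Ad a)| < 1], refining a cover of the quotient along a power of [a]
   multiplies [(number of balls) * radius ^ N] by at most [1 / 2], but this
   quantity is bounded below. *)
Lemma detAd_ge1 a : 1 <= `|det a|.
Proof.
rewrite leNgt; apply/negP => da1.
have [B [oB B1 Binj]] := coset_proj_injective_near mul_cont inv_cont discrete 1%g.
have [r [C [r0 C0 rP lip]]] := local_lipschitz fr Ac mul_smooth i0P oB B1.
have rP' u v : ball (cmap (A i0) 1%g) r u -> ball (cmap (A i0) 1%g) r v ->
    cimg (A i0) u /\ mulc_dom A i0 i0 (u, v).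
  by move=> bu bv; have [] := rP u v bu bv.
have [r' /andP[r'0 r'r] quot] := quotient_estimate Ac inv_cont i0P r0 C0 rP' lip.
(* [25 ^ N] is the cost of coding, [(4 C) ^ N] that of the growth of the radius in
   [refine_cover]. *)
pose c : R := 25 ^+ N * (4 * C) ^+ N.
have c0 : 0 < c by rewrite mulr_gt0// exprn_gt0// mulr_gt0.
have [j jP] : exists j, `|det a| ^+ j < (2 * c)^-1.
  by apply: exists_exprn_lt; rewrite ?normr_ge0// invr_gt0 mulr_gt0.
pose b := (a ^+ j)%g.
have db : `|det b| <= (2 * c)^-1 by rewrite detAdX normrX ltW.
have [mu [eta [eta0 code muP]]] :=
  cube_code_exists (detAd_neq0 fr Ac Acov mul_smooth trans_smooth i0P b).
have mu1 : 1 <= mu.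
  have [K [f [Kmu _]]] := code; apply: le_trans Kmu.
  by rewrite ler1n; apply/card_gt0P; exists (f 0).
pose t := 4 * C * eta; have t0 : 0 < t by rewrite !mulr_gt0.
have q2 : mu * t ^+ N <= 2^-1.
  have -> : mu * t ^+ N = (mu * eta ^+ N) * (4 * C) ^+ N.
    by rewrite /t [in LHS]exprMn; ring.
  have c4 : 0 < (4 * C) ^+ N :> R by rewrite exprn_gt0// mulr_gt0.
  rewrite -ler_pdivlMr//; apply: le_trans muP _.
  have -> : 2^-1 / (4 * C) ^+ N = 25 ^+ N * (2 * c)^-1 :> R.
    by rewrite /c; field; rewrite !expf_neq0// ?gt_eqF// mulr_gt0.
  by rewrite ler_wpM2l// exprn_ge0.
(* As [mu >= 1], the bound [q2] forces the radii to shrink, so they stay below [d1] and [d2] and the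
   refinement can be iterated. *)
have t1 : t < 1.
  rewrite ltNge; apply/negP => t1; have tN : 1 <= t ^+ N by exact: exprn_ege1.
  by have := ler_pM ler01 ler01 mu1 tN; move: q2; lra.
have [d1 d10 refine] := refine_cover Ac Acov mul_smooth trans_smooth i0P Gamma
  C0 r'0 quot eta0 code.
have [kappa [d2 [kappa0 d20 lower]]] := cover_lower_bound fr Ac i0P r0 C0 r'0
  rP' lip quot Binj (fun u v bu bv => let: And3 _ _ h := rP u v bu bv in h).
pose eps := Num.min (d1 / 2) (Num.min (d2 / 2) (r / 2 / kappa)).
have eps0 : 0 < eps by rewrite !lt_min !divr_gt0.
have epsd1 : eps < d1.
  by apply: (@le_lt_trans _ _ (d1 / 2)); [rewrite ge_min lexx|lra].
have epsd2 : eps < d2.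
  by apply: (@le_lt_trans _ _ (d2 / 2)); [rewrite !ge_min lexx orbT|lra].
have epsr : eps <= r / 2 / kappa by rewrite !ge_min lexx !orbT.
have [s0 s0P] := cover_exists Ac mul_smooth i0P cpt eps0.
have tk k : 0 < t ^+ k * eps <= eps.
  by rewrite mulr_gt0 ?exprn_gt0//= ler_piMl ?(ltW eps0)// exprn_ile1 ?ltW.
have cover k : exists2 s, cover_by A i0 Gamma (t ^+ k * eps) s
    & (size s)%:R <= mu ^+ k * (size s0)%:R.
  elim: k => [|k [s sP sle]]; first by exists s0; rewrite ?expr0 ?mul1r.
  have /andP[tk0 tk1] := tk k.
  have [|s' s'P s'le] := refine _ _ _ sP; first by rewrite tk0 (le_lt_trans tk1).
  exists s'; first by rewrite exprS -mulrA.
  by apply: le_trans s'le _; rewrite exprS -mulrA ler_pM2l// (lt_le_trans _ mu1).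
pose X := r / 2 / (kappa * eps).
have X0 : 0 < X by rewrite !divr_gt0// mulr_gt0.
(* After [k] refinements the size of the cover is at most [mu ^ k] times the initial one, and at
   least the number of grid points at radius [t ^ k * eps]; [2 ^ N] pays for rounding [x] down to
   [M]. Letting [k] grow contradicts [X > 0]. *)
have main k : X ^+ N <= 2 ^+ N * (size s0)%:R * 2^-1 ^+ k.
  have [s sP sle] := cover k; have /andP[tk0 tk1] := tk k.
  pose e := t ^+ k * eps; pose x := r / 2 / (kappa * e).
  have ke0 : 0 < kappa * e by rewrite mulr_gt0.
  have x1 : 1 <= x.
    rewrite ler_pdivlMr// mul1r; apply: le_trans (_ : kappa * eps <= _).
      by rewrite ler_pM2l.
    by rewrite mulrC -ler_pdivlMr.
  have x0 : 0 <= x by apply: le_trans x1.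
  pose M := Num.truncn x; have /andP[Mx xM] := truncn_itv x0.
  have Ms : (M ^ N <= size s)%N.
    apply: (lower _ _ _ _ sP); first by rewrite tk0 (le_lt_trans tk1).
    by rewrite -ler_pdivlMr.
  have M1 : 1 <= M%:R :> R by rewrite ler1n -ltnS -(ltr_nat R) (le_lt_trans x1).
  have x2M : x <= 2 * M%:R by move: xM; rewrite -natr1 -/M; lra.
  have xN : x ^+ N <= 2 ^+ N * (mu ^+ k * (size s0)%:R).
    apply: (@le_trans _ _ ((2 * M%:R) ^+ N)).
      by rewrite lerXn2r// nnegrE ?mulr_ge0.
    rewrite exprMn ler_pM2l ?exprn_gt0//; apply: le_trans sle.
    by rewrite -natrX ler_nat.
  have XE : X = x * t ^+ k.
    by rewrite /X /x /e; field; rewrite !gt_eqF// exprn_gt0.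
  rewrite XE exprMn.
  apply: (@le_trans _ _ (2 ^+ N * (mu ^+ k * (size s0)%:R) * (t ^+ k) ^+ N)).
    by rewrite ler_pM2r// !exprn_gt0.
  have -> : 2 ^+ N * (mu ^+ k * (size s0)%:R) * (t ^+ k) ^+ N
      = 2 ^+ N * (size s0)%:R * (mu * t ^+ N) ^+ k.
    by rewrite [in RHS]exprMn -!exprM [(k * N)%N]mulnC; ring.
  rewrite ler_wpM2l ?mulr_ge0 ?exprn_ge0// lerXn2r// nnegrE ?invr_ge0//.
  by rewrite mulr_ge0 ?exprn_ge0 ?ltW// (lt_le_trans _ mu1).
pose W : R := 2 ^+ N * (size s0)%:R + 1.
have W0 : 0 < W by rewrite ltr_wpDl// mulr_ge0// exprn_ge0.
have [k kP] : exists k, (2^-1 : R) ^+ k < X ^+ N / W.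
  by apply: exists_exprn_lt; [lra|rewrite divr_gt0// exprn_gt0].
have /le_lt_trans : X ^+ N <= W * 2^-1 ^+ k.
  by apply: le_trans (main k) _; rewrite ler_wpM2r ?exprn_ge0 ?invr_ge0// lerDl.
by move=> /(_ (X ^+ N)); rewrite mulrC -ltr_pdivlMr// kP ltxx => /(_ isT).
Qed.

(** The lower bound holds for [a] and for its inverse, and the two determinants have product 1. *)
Lemma detAd_norm1 a : `|det a| = 1.
Proof.
apply/eqP; rewrite eq_le detAd_ge1 andbT leNgt; apply/negP => da.
have := congr1 (fun x => `|x|) (detAdM fr Ac Acov mul_smooth trans_smooth i0P a a^-1%g).
rewrite mulgV detAd1// normr1 normrM => E1.
have := ltr_pM2r (lt_le_trans ltr01 (detAd_ge1 a^-1%g)) 1 `|det a|.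
by rewrite da -E1 mul1r ltNge detAd_ge1.
Qed.

End Unimodular.

(** * The model space as a framed normed module *)

Section CvecFrame.
Context {R : realType} {n : nat}.
Local Notation E := (Cvec R n).

Definition ecoord (j : 'I_(n + n)) (z : E) : R^o := row_mx z.1 z.2 0 j.

Definition evec (j : 'I_(n + n)) : E :=
  (lsubmx (delta_mx 0 j), rsubmx (delta_mx 0 j)).

Fact ecoord_is_linear j : linear (ecoord j).
Proof. by move=> a z z'; rewrite /ecoord !mxE; case: splitP => k _; rewrite !mxE. Qed.

HB.instance Definition _ j :=
  GRing.isLinear.Build R E R^o *:%R (ecoord j) (ecoord_is_linear j).

Let ecoord_inj (z z' : E) : ecoord^~ z =1 ecoord^~ z' -> z = z'.
Proof.
move=> zz'; have : row_mx z.1 z.2 = row_mx z'.1 z'.2.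
  by apply/rowP => j; exact: zz'.
by move: z z' {zz'} => [z1 z2] [z'1 z'2] /= /eq_row_mx[-> ->].
Qed.

Let ecoord_evec i j : ecoord i (evec j) = (i == j)%:R.
Proof. by rewrite /ecoord /evec hsubmxK mxE eqxx. Qed.

Let ecoord_norm j (z : E) : `|ecoord j z| <= `|z|.
Proof.
have le_coord (x : 'rV[R]_n) k : `|x 0 k| <= `|x|.
  rewrite [leRHS]/Num.norm /= mx_normrE.
  exact: (le_bigmax _ (fun ij : 'I_1 * 'I_n => `|x ij.1 ij.2|) (0, k)).
rewrite /ecoord mxE prod_normE le_max.
by case: splitP => k _; rewrite le_coord ?orbT.
Qed.

Let norm_le_ecoord (z : E) c : 0 <= c ->
  (forall j, `|ecoord j z| <= c) -> `|z| <= c.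
Proof.
move=> c0 zc; have le_row (x : 'rV[R]_n) : (forall k, `|x 0 k| <= c) -> `|x| <= c.
  move=> xc; rewrite /Num.norm /= mx_normrE bigmax_le// => -[i k] _ /=.
  by rewrite ord1.
rewrite prod_normE ge_max; apply/andP; split; apply: le_row => k.
  by have := zc (lshift n k); rewrite /ecoord row_mxEl.
by have := zc (rshift n k); rewrite /ecoord row_mxEr.
Qed.

Definition cvec_frame : frame E (n + n) := @Frame R E (n + n)
  (fun j => ecoord j) evec ecoord_evec ecoord_inj ecoord_norm norm_le_ecoord.

Fact mulI_is_linear : linear (@mulI 'rV[R]_n : E -> E).
Proof. by move=> a [x1 x2] [y1 y2]; congr pair; rewrite /= ?opprD ?scalerN. Qed.

HB.instance Definition _ :=
  GRing.isLinear.Build R E E *:%R (@mulI 'rV[R]_n) mulI_is_linear.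

Lemma mulIK (z : E) : mulI (mulI z) = - z.
Proof. by case: z. Qed.

Lemma mulI_continuous : continuous (@mulI 'rV[R]_n : E -> E).
Proof.
have mulI_norm (z : E) : `|mulI z| = `|z| by rewrite !prod_normE /= normrN maxC.
move=> z; apply/cvgrPdist_lt => e e0.
apply/(nbhs_ballP z); exists e => //= y.
by rewrite -ball_normE /= => zy; rewrite -linearB mulI_norm.
Qed.

Lemma cvec_frame_re k z :
  cvec_frame (lshift n k) (mulI z) = - cvec_frame (rshift n k) z.
Proof. by rewrite /= /ecoord row_mxEl row_mxEr mxE. Qed.

Lemma cvec_frame_im k z :
  cvec_frame (rshift n k) (mulI z) = cvec_frame (lshift n k) z.
Proof. by rewrite /= /ecoord row_mxEl row_mxEr. Qed.

Lemma cvec_cvec_frame k : cvec cvec_frame k = (delta_mx 0 k, 0).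
Proof.
congr pair; apply/rowP => j; rewrite !mxE //= ?eqxx ?(inj_eq (@lshift_inj _ _))//.
by rewrite eq_rlshift.
Qed.

Lemma ccoord_cvec_frame k z : ccoord cvec_frame k z = toC (z.1 0 k, z.2 0 k).
Proof. by rewrite /ccoord /= /ecoord row_mxEl row_mxEr. Qed.

Lemma complex_jacobian_cjac (f : E -> E) u :
  complex_jacobian f u = cjac cvec_frame f u.
Proof.
congr (\det _); apply/matrixP => j k.
by rewrite !mxE ccoord_cvec_frame cvec_cvec_frame difE.
Qed.

End CvecFrame.

(** * The canonical bundle of the quotient *)

Section ComplexLieGroup.
Context {R : realType} {n : nat} {G : topGroupType} {I : Type}.
Variable A : I -> chart (Cvec R n) G.
Hypothesis Am : complex_manifold A.
Hypothesis Al : lie_group A.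
Hypothesis Ai : left_invariant A.
Local Notation E := (Cvec R n).
Local Notation fr := (@cvec_frame R n).
Local Notation J := (@mulI 'rV[R]_n : {linear E -> E}).

Lemma cm_chart i : is_chart (A i). Proof. by case: Am => _ /(_ i). Qed.

Lemma cm_cover p : exists i, cdom (A i) p. Proof. by case: Am => _ _ /(_ p). Qed.

Lemma left_invariant_smooth g : smooth_map A A (fun p => g * p)%g.
Proof. by have [gc gh] := Ai g; split=> // i j; have [] := gh i j. Qed.

Lemma left_invariant_J g i j u v : ltrans_dom A g i j u ->
  dif (ltrans A g i j) u (J v) = J (dif (ltrans A g i j) u v).
Proof. by move=> Du; have [_ /(_ i j)[_ /(_ u Du v)]] := Ai g; rewrite !difE. Qed.

Let mul_smooth : smooth_map (prod_atlas A A) A (fun p : G * G => p.1 * p.2)%g.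
Proof. by case: Al. Qed.
Let mul_cont : continuous (fun p : G * G => p.1 * p.2)%g.
Proof. by case: mul_smooth. Qed.
Let inv_cont : continuous (fun p : G => p^-1)%g.
Proof. by case: Al => _ []. Qed.

Variable i0 : I.
Hypothesis i0P : cdom (A i0) 1%g.
Variable Gamma : groupClosed G.
Hypothesis lattice : uniform_lattice Gamma.

Local Notation Q := (quotient_atlas Gamma A).
Local Notation admissible := (fun iO : I * set G =>
  [/\ open iO.2, iO.2 `<=` cdom (A iO.1) & set_inj iO.2 (coset_proj Gamma)]).
Local Notation K := {iO | admissible iO}.
Local Notation ci kappa := (sval (kappa : K)).1.
Local Notation cO kappa := (sval (kappa : K)).2.

Lemma quotient_atlas_cover p : exists kappa : K, cO kappa p.
Proof.
have [i ip] := cm_cover p.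
have [B [oB Bp Binj]] :=
  coset_proj_injective_near mul_cont inv_cont lattice.1 p.
have H : admissible (i, B `&` cdom (A i)).
  split=> /=; first by apply: openI => //; exact: open_cdom (cm_chart i).
  - by move=> q [].
  - by apply: sub_in2 Binj => q; rewrite !inE => -[].
by exists (exist admissible _ H).
Qed.

(** The projection is injective on the piece, so the lift chosen by [xget] has to be the point of
    the coset lying there. *)
Lemma local_lift_coset (kappa : K) g q : g \in Gamma -> cO kappa (g * q)%g ->
  local_lift (cO kappa) (coset_proj Gamma q) = (g * q)%g.
Proof.
move=> gG Ogq; have [_ _ inj] := svalP kappa.
have ex : [set p | cO kappa p /\ coset_proj Gamma p = coset_proj Gamma q] (g * q)%g.
  by split=> //; exact: coset_projM.
rewrite /local_lift; case: xgetP => [p _ [Op pq]|/(_ _ ex)//].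
by apply: inj; rewrite ?inE// pq coset_projM.
Qed.

(** A single [g] of [Gamma] relates the two lifts on a whole neighbourhood, by continuity; there the
    transition map is left translation by [g] read in charts of [G], with the same Jacobian. *)
Lemma quotient_transition (c d : K) g p : g \in Gamma -> cO c p ->
  cO d (g * p)%g ->
  [/\ local_dom (Q c) (Q d) id (cmap (A (ci c)) p),
      local_expr (Q c) (Q d) id (cmap (A (ci c)) p) = cmap (A (ci d)) (g * p)%g
    & complex_jacobian (local_expr (Q c) (Q d) id) (cmap (A (ci c)) p)
      = cjac fr (ltrans A g (ci c) (ci d)) (cmap (A (ci c)) p)].
Proof.
move=> gG cp dgp; have [oc cd _] := svalP c; have [od dd _] := svalP d.
have chc := cm_chart (ci c); have chd := cm_chart (ci d).
have exprE q : cO c q -> cO d (g * q)%g ->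
    local_expr (Q c) (Q d) id (cmap (A (ci c)) q) = cmap (A (ci d)) (g * q)%g.
  move=> cq dq; rewrite /local_expr /= cmapK//; last exact: cd.
  by rewrite (local_lift_coset gG).
split; [|exact: exprE|].
  split; first by exists p.
  rewrite /= cmapK//; last exact: cd.
  by exists (g * p)%g => //; exact: coset_projM.
rewrite complex_jacobian_cjac; congr (\det _); apply/matrixP => j k.
rewrite !mxE; congr (ccoord _ _ _); apply: dif_val.
set u := cmap (A (ci c)) p.
have Du : ltrans_dom A g (ci c) (ci d) u.
  split; first by apply: cimg_cmap => //; exact: cd.
  by rewrite /u cmapK//; [exact: dd|exact: cd].
apply: is_diff_near (is_diff_ltrans left_invariant_smooth Du).
have cu : {for u, continuous (cinv (A (ci c)))}.
  by apply: chart_inv_continuous_at => //; case: Du.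
have uK : cinv (A (ci c)) u = p by rewrite cmapK//; exact: cd.
have n1 : \forall w \near u, cO c (cinv (A (ci c)) w).
  by apply: cu; rewrite uK; exact: open_nbhs_nbhs.
have n2 : \forall w \near u, cO d (g * cinv (A (ci c)) w)%g.
  apply: (cu [set q | cO d (g * q)%g]); rewrite uK.
  by apply: (ltrans_continuous mul_cont); exact: open_nbhs_nbhs.
have n3 : \forall w \near u, cimg (A (ci c)) w.
  by apply: open_nbhs_nbhs; split; [exact: open_cimg|case: Du].
near=> w; have iw : cimg (A (ci c)) w by near: w.
rewrite -[w in RHS](cinvK chc iw) exprE; first by rewrite /ltrans /local_expr.
  by near: w.
by near: w.
Unshelve. all: by end_near. Qed.

Lemma torsion_adtrace_bracket k x y : (0 < k)%N ->
  canonical_power_trivial Q k ->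
  complex.Im (adtrace fr J A i0 (lie_bracket A i0 x y)) = 0.
Proof.
move=> k0 [h [[hhol htrans] hne]].
have fst_cont : continuous (@fst R^o R^o) by move=> z; exact: cvg_fst.
have snd_cont : continuous (@snd R^o R^o) by move=> z; exact: cvg_snd.
have hs c : csmooth (cmap (A (ci c)) @` cO c) (fun u => toC (h c u)).
  have [oc cd _] := svalP c.
  have oV := open_chart_image (cm_chart (ci c)) cd oc.
  have [hsm _] := hhol c; split.
    exact: (smooth_on_linear (L := @fst R^o R^o) oV fst_cont hsm).
  exact: (smooth_on_linear (L := @snd R^o R^o) oV snd_cont hsm).
have oO (c : K) : open (cO c) by have [] := svalP c.
have Oi (c : K) : cO c `<=` cdom (A (ci c)) by have [] := svalP c.
have hd c u w : (cmap (A (ci c)) @` cO c) u -> dbar_at J u w (fun u => toC (h c u)) 0.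
  move=> Vu; have [hsm hcr] := hhol c.
  have D := is_diff_dif (smooth_on_differentiable hsm Vu).
  exists (fst \o dif (h c) u), (snd \o dif (h c) u); split.
  - by apply: is_diff_comp D _; exact: (is_diff_lin (f := @fst R^o R^o)).
  - by apply: is_diff_comp D _; exact: (is_diff_lin (f := @snd R^o R^o)).
  (* The Cauchy-Riemann equations say that [X + i J X] kills the coefficient. *)
  - by rewrite /= difE hcr//= subrr subrr.
have ht c d g p : g \in Gamma -> cO c p -> cO d (g * p)%g ->
    toC (h c (cmap (A (ci c)) p))
    = cjac fr (ltrans A g (ci c) (ci d)) (cmap (A (ci c)) p) ^+ k
      * toC (h d (cmap (A (ci d)) (g * p)%g)).
  move=> gG cp dp; have [Du uE jE] := quotient_transition gG cp dp.
  by rewrite (htrans c d _ Du) jE uE.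
have := @adtrace_bracket_eq0 R E n fr J cvec_frame_re cvec_frame_im
  mulI_continuous mulIK G I A cm_chart mul_smooth left_invariant_smooth i0 i0P
  left_invariant_J Gamma lattice.2 K (fun c => ci c) (fun c => cO c) k
  (fun c u => toC (h c u)) oO Oi quotient_atlas_cover hs hd hne ht x y.
case: (adtrace _ _ _ _ _) => a b.
rewrite -[k%:R](rmorph_nat (real_complex R)) /= mul0r addr0 => /eqP.
by rewrite mulf_eq0 pnatr_eq0 eqn0Ngt k0 => /eqP.
Qed.

End ComplexLieGroup.

(** * Traces on the Lie algebra of invariant fields *)

Section LieTraces.
Context {R : realType} {n : nat} {G : topGroupType} {I : Type}.
Variable A : I -> chart (Cvec R n) G.
Hypothesis Am : complex_manifold A.
Hypothesis Al : lie_group A.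
Hypothesis Ai : left_invariant A.
Variable i0 : I.
Hypothesis i0P : cdom (A i0) 1%g.

Local Notation E := (Cvec R n).
Local Notation fr := (@cvec_frame R n).
Local Notation J := (@mulI 'rV[R]_n : {linear E -> E}).
Local Notation e0 := (cmap (A i0) 1%g).
Local Notation field := (lfield A i0).
Local Notation brk := (lie_bracket A i0).

Let Ac := cm_chart Am.
Let trans_smooth := left_invariant_smooth Ai.
Let mul_smooth : smooth_map (prod_atlas A A) A (fun p : G * G => p.1 * p.2)%g.
Proof. by case: Al. Qed.

Let field_preserved v g : preserved_by A (fun p => g * p)%g (field v).
Proof.
by move=> i j u Du; rewrite -difE (lfield_ltrans Ac trans_smooth i0P v Du).
Qed.

Lemma Lie_lfield v : Lie A (field v).
Proof.
split; last exact: field_preserved.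
split; [exact: lfield_smooth|by move=> i u; exact: lfield_out|].
by have := @field_preserved v 1%g; rewrite (_ : (fun p : G => 1 * p)%g = id)//;
  apply/funext => p; rewrite mul1g.
Qed.

Lemma Lie_lfieldE X : Lie A X -> X = field (X i0 e0).
Proof.
move=> [[_ Xout _] Xinv]; apply/funext => i; apply/funext => u.
have [iu|iu] := pselect (cimg (A i) u); last by rewrite Xout// lfield_out.
apply: (lfield_unique Ac i0P) iu => g k l w Dw.
by rewrite difE; exact: Xinv.
Qed.

Fact lfield_linear : linear field.
Proof.
move=> a v w; apply/funext => i; apply/funext => u.
exact: lfield_is_linear.
Qed.

Let lfB := GRing.isLinear.Build R E (I -> E -> E) *:%R field lfield_linear.
Let LF : {linear E -> (I -> E -> E)} := HB.pack field lfB.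

Lemma lfield_injective : injective field.
Proof.
move=> v w vw; have e0P := cimg_cmap (Ac i0) i0P.
by apply: (lfield_inj Ac trans_smooth i0P e0P); rewrite vw.
Qed.

Lemma bracket_lfield v w : bracket A (field v) (field w) = field (brk v w).
Proof.
apply/funext => i; apply/funext => u; rewrite /bracket.
case: ifPn => [/[1!inE] iu|/negP iu]; last first.
  by rewrite lfield_out// => ?; apply: iu; rewrite inE.
by rewrite -(vbracket_lfield fr Ac mul_smooth trans_smooth i0P v w iu) /vbracket !difE.
Qed.

Lemma vfJ_lfield v : vfJ (field v) = field (J v).
Proof.
apply/funext => i; apply/funext => u.
by rewrite (lfieldJ Ac i0P (left_invariant_J Ai)).
Qed.

Let basis_lfield : basis_of_set (Lie A) (fun j => field (fvec fr j)).
Proof.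
split=> [j|X /Lie_lfieldE ->]; first exact: Lie_lfield.
set v := X i0 e0.
exists (\row_j fr j v); split.
  rewrite {1}(fvec_decomp fr v) -[field _]/(LF _) linear_sum.
  by apply: eq_bigr => j _; rewrite linearZ mxE.
move=> c vE; apply/rowP => j; rewrite mxE.
have {}vE : v = \sum_i c 0 i *: fvec fr i.
  apply: lfield_injective; rewrite vE -[RHS]/(LF _) linear_sum.
  by apply: eq_bigr => i _; rewrite linearZ.
by rewrite vE fcoord_sum.
Qed.

(** [trace_on] picks some value satisfying [is_trace]; uniqueness identifies it with the one
    computed in the basis of invariant fields attached to the frame. *)
Lemma trace_on_Lie (T : (I -> E -> E) -> I -> E -> E) (S : E -> E) :
  linear S -> (forall v, T (field v) = field (S v)) ->
  trace_on (Lie A) T = frame_trace fr S.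
Proof.
move=> Slin TS; pose SB := GRing.isLinear.Build R E E *:%R S Slin.
pose S' : {linear E -> E} := HB.pack S SB.
have tr : is_trace (Lie A) T (frame_trace fr S).
  exists (n + n)%N, (fun j => field (fvec fr j)).
  exists (\matrix_(i, j) fr i (S (fvec fr j))); split=> //.
    move=> j; rewrite TS {1}(fvec_decomp fr (S _)) -[field _]/(LF _) linear_sum.
    by apply: eq_bigr => i _; rewrite linearZ mxE.
  by apply: eq_bigr => j _; rewrite mxE.
apply: (is_trace_unique (W := Lie A) (T := T)) (tr) => [w /Lie_lfieldE ->||].
- by rewrite TS; exact: Lie_lfield.
- move=> d e c eW.
  have eE i : e i = LF (e i i0 e0) by exact: Lie_lfieldE.
  have -> : \sum_i c i *: e i = LF (\sum_i c i *: e i i0 e0).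
    by rewrite linear_sum; apply: eq_bigr => i _; rewrite linearZ -eE.
  rewrite [LHS]TS -[field _]/(LF (S' _)) !linear_sum; apply: eq_bigr => i _.
  by rewrite !linearZ {2}eE /= TS.
- exact: (xgetPex 0 (ex_intro _ _ tr)).
Qed.

Local Notation adtr := (adtrace fr J A i0).

Let brk_linear z : linear (brk z).
Proof.
by move=> a v w; rewrite (lie_bracketDr Ac mul_smooth i0P)
  (lie_bracketZr Ac mul_smooth i0P).
Qed.

Let trace_bracket z :
  trace_on (Lie A) (bracket A (field z)) = frame_trace fr (brk z).
Proof. by apply: trace_on_Lie (brk_linear z) _ => v; exact: bracket_lfield. Qed.

Let trace_Jbracket z : trace_on (Lie A) (fun Z => vfJ (bracket A (field z) Z))
  = frame_trace fr (fun v => J (brk z v)).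
Proof.
apply: trace_on_Lie => [a v w|v]; first by rewrite brk_linear linearP.
by rewrite bracket_lfield vfJ_lfield.
Qed.

Lemma trace_Jbracket_lfield z : complex.Im (adtr z) = 0 ->
  trace_on (Lie A) (fun Z => vfJ (bracket A (field z) Z))
  = trace_on (Lie A) (bracket A (vfJ (field z))).
Proof.
move=> z0; rewrite vfJ_lfield trace_bracket trace_Jbracket.
exact: (@adtrace_eq0 R E n fr J cvec_frame_re cvec_frame_im mulI_continuous
  mulIK G I A Ac mul_smooth i0 i0P (left_invariant_J Ai) z z0).
Qed.

Lemma lfield_sum_eq m (z : 'I_m -> E) :
  \sum_l field (z l) = field (\sum_l z l).
Proof. by rewrite -[RHS]/(LF _) linear_sum. Qed.

Lemma trace_bracket_lattice (Gamma : groupClosed G) z :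
  uniform_lattice Gamma -> trace_on (Lie A) (bracket A (field z)) = 0.
Proof.
move=> lat; rewrite trace_bracket.
have inv_cont : continuous (fun p : G => p^-1)%g by case: Al => _ [].
apply: (trace_bracket_eq0 Ac (cm_cover Am) mul_smooth trans_smooth i0P) => a.
exact: (detAd_norm1 fr Ac (cm_cover Am) mul_smooth trans_smooth inv_cont i0P
  lat.2 lat.1).
Qed.

End LieTraces.

Theorem theorem5p3 (R : realType) (n : nat) (G : topGroupType) (I : Type)
    (A : I -> chart (Cvec R n) G) (Gamma : groupClosed G) :
  complex_manifold A ->
  lie_group A ->
  left_invariant A ->
  simply_connected R G ->
  uniform_lattice Gamma ->
  canonical_trivial (quotient_atlas Gamma A) \/
  canonical_torsion (quotient_atlas Gamma A) ->
  (forall X Y, Lie A X -> Lie A Y ->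
     trace_on (Lie A) (fun Z => vfJ (bracket A (bracket A X Y) Z)) = 0%R) /\
  (forall Z, derived_Lie A Z -> koszul_form A Z = 0%R).
Proof.
move=> Am Al Ai _ lat triv.
have [k k0 ktriv] : canonical_torsion (quotient_atlas Gamma A).
  by case: triv => // ?; exists 1%N.
have [i0 i0P] := cm_cover Am 1%g.
have LieE := Lie_lfieldE Am i0P.
have Im0 x y := torsion_adtrace_bracket Am Al Ai i0P lat x y k0 ktriv.
split=> [X Y /LieE -> /LieE ->|Z [m [X [Y [LX LY ->]]]]].
  (* Vanishing of [Im tau] on the bracket turns the trace into that of [ad (J [X, Y])], which
     unimodularity makes zero. *)
  rewrite (bracket_lfield Am Al Ai i0P) (trace_Jbracket_lfield Am Al Ai i0P)//.
  by rewrite (vfJ_lfield Am Ai i0P) (trace_bracket_lattice Am Al Ai i0P _ lat).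
rewrite (eq_bigr _ (fun l _ => congr2 (bracket A) (LieE _ (LX l)) (LieE _ (LY l)))).
under eq_bigr => l _ do rewrite (bracket_lfield Am Al Ai i0P).
(* On sums of brackets [Im tau] still vanishes by additivity, and this alone makes the two traces in
   the Koszul form equal. *)
rewrite lfield_sum_eq /koszul_form (trace_Jbracket_lfield Am Al Ai i0P) ?subrr//.
exact: (@adtrace_sum_eq0 R (Cvec R n) n (@cvec_frame R n) (@mulI 'rV[R]_n) G I A
  (cm_chart Am) Al.1 i0 i0P _ _ (fun l => Im0 _ _)).
Qed.
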